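(* Let $X$ be an affine algebraic super-variety over the field $\mathbb{C}$ of complex numbers, with coordinate superalgebra $\mathcal{O}_X$ (a finitely generated super-commutative superalgebra over $\mathbb{C}$). Then $X$ is smooth in the sense of Fioresi if and only if $\mathcal{O}_X$ is smooth over $\mathbb{C}$.
   Context: $\mathsf{SAlg}_{\mathbb{C}}$ is the category of super-commutative superalgebras over $\mathbb{C}$. An object $A\in\mathsf{SAlg}_{\mathbb{C}}$ is smooth over $\mathbb{C}$ if for every $B\in\mathsf{SAlg}_{\mathbb{C}}$ and every nilpotent super-ideal $J\subset B$, the natural map $\mathsf{SAlg}_{\mathbb{C}}(A,B)\to\mathsf{SAlg}_{\mathbb{C}}(A,B/J)$ is surjective. For $A\in\mathsf{SAlg}_{\mathbb{C}}$, maximal super-ideals are of the form $\mathfrak{m}_0\oplus A_1$ with $\mathfrak{m}_0$ a maximal ideal of $A_0$; closed points $P$ of $X$ correspond to the maximal super-ideals of $A=\mathcal{O}_X$, and $\mathcal{O}_{X,P}$ is the localization of $A$ at $\mathfrak{m}_0$, a local superalgebra. $\widehat{\mathcal{O}}_{X,P}$ is its completion with respect to the powers of its maximal super-ideal. $X$ is smooth in the sense of Fioresi if for every closed point $P$ of $X$, $\widehat{\mathcal{O}}_{X,P}$ is isomorphic to a formal power series superalgebra $\mathbb{C}[[X_1,\dots,X_r]]\otimes_{\mathbb{C}}\wedge(Y_1,\dots,Y_s)$, with $X_i$ even variables and $Y_j$ odd variables, for some $r,s\ge 0$ (depending on $P$). *)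

(* Defs.v *)
From HB Require Import structures.
From mathcomp Require Import all_boot all_order all_algebra.
From mathcomp Require Import generic_quotient ring_quotient.
From mathcomp Require Import boolp reals complex.
From mathcomp Require Import mpoly ring.

Set Implicit Arguments.
Unset Strict Implicit.
Unset Printing Implicit Defensive.

Import GRing.Theory Num.Theory.
Local Open Scope ring_scope.
Local Open Scope quotient_scope.

(* A super-commutative superalgebra over K. Parities are booleans, with
   [true] for odd; [parity p] is the summand of parity p. The K-algebra
   structure is the ring morphism [sconst] from K to the (central) even
   elements; the library's [algType] would exclude the zero algebra. Since 2
   is invertible in K, odd elements have square zero. *)
HB.mixin Record isSuperAlgebra (K : numFieldType) A of GRing.PzRing A := {
  sconst : {rmorphism K -> A};
  parity : bool -> A -> Prop;
  parity_sconst : forall k, parity false (sconst k);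
  parity0 : forall p, parity p 0;
  parityD : forall p x y, parity p x -> parity p y -> parity p (x + y);
  parity_dec : forall x, exists x0 x1,
    [/\ parity false x0, parity true x1 & x = x0 + x1];
  parity_cap : forall x, parity false x -> parity true x -> x = 0;
  parityM : forall p q x y, parity p x -> parity q y ->
    parity (p (+) q) (x * y);
  parityC : forall p q x y, parity p x -> parity q y ->
    x * y = (-1) ^+ (p && q) * (y * x)
}.

#[short(type="superAlgType")]
HB.structure Definition SuperAlgebra (K : numFieldType) :=
  {A of GRing.PzRing A & isSuperAlgebra K A}.

Arguments parityD {K s} [p x y] : rename.
Arguments parity_dec {K s} x : rename.
Arguments parity_cap {K s} [x] : rename.
Arguments parityM {K s} [p q x y] : rename.
Arguments parityC {K s} [p q x y] : rename.

HB.mixin Record isSuperMorphism (K : numFieldType) (A B : superAlgType K)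
    (f : A -> B) := {
  morph_sconst : forall k : K, f (sconst k) = sconst k;
  morph_parity : forall p x, parity p x -> parity p (f x)
}.

#[short(type="superHom")]
HB.structure Definition SuperMorphism (K : numFieldType)
    (A B : superAlgType K) :=
  {f of @GRing.RMorphism A B f & @isSuperMorphism K A B f}.

Section Basics.
Variables (K : numFieldType) (A : superAlgType K).
Implicit Types (x y : A) (p q : bool).

Lemma parity1 : parity false (1 : A).
Proof. by rewrite -(rmorph1 (@sconst K A)); apply: parity_sconst. Qed.

Lemma parityN p x : parity p x -> parity p (- x).
Proof.
move=> hx; rewrite -mulN1r -(rmorph1 (@sconst K A)) -rmorphN.
exact: parityM (parity_sconst _) hx.
Qed.

Lemma parityB p x y : parity p x -> parity p y -> parity p (x - y).
Proof. by move=> hx hy; apply: parityD => //; apply: parityN. Qed.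

Lemma parity_uniq x0 x1 y0 y1 :
  parity false x0 -> parity true x1 -> parity false y0 -> parity true y1 ->
  x0 + x1 = y0 + y1 -> x0 = y0 /\ x1 = y1.
Proof.
move=> h0 h1 g0 g1 e.
have e' : x0 - y0 = y1 - x1.
  by apply/eqP; rewrite subr_eq addrAC eq_sym subr_eq addrC eq_sym addrC e addrC.
have z : x0 - y0 = 0.
  by apply: parity_cap; [apply: parityB | rewrite e'; apply: parityB].
split; first by apply/eqP; rewrite -subr_eq0 z.
by apply/esym/eqP; rewrite -subr_eq0 -e' z.
Qed.

Lemma evenC x y : parity false x -> x * y = y * x.
Proof.
move=> hx; have [y0 [y1 [h0 h1 ->]]] := parity_dec y.
by rewrite mulrDr mulrDl (parityC hx h0) (parityC hx h1) !mul1r.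
Qed.

Lemma parity_swap p x y : parity p x -> exists y', x * y = y' * x.
Proof.
move=> hx; have [y0 [y1 [h0 h1 ->]]] := parity_dec y.
exists (y0 + (-1) ^+ p * y1).
by rewrite mulrDr mulrDl (parityC hx h0) (parityC hx h1) andbF andbT mul1r mulrA.
Qed.

Lemma odd_sqr0 x : parity true x -> x * x = 0.
Proof.
move=> hx; have := parityC hx hx; rewrite expr1 mulN1r => /eqP.
rewrite -subr_eq0 opprK -mulr2n -mulr_natl => /eqP e.
have n2 : 2%:R != 0 :> K by rewrite pnatr_eq0.
rewrite -[x * x]mul1r -(rmorph1 (@sconst K A)) -(mulVf n2) rmorphM rmorph_nat.
by rewrite -mulrA e mulr0.
Qed.

End Basics.

(* finitely_generated: some finite sequence lies in no proper subalgebra; no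
   subtraction is needed in [subalgebra], as it contains the constant -1 *)
Definition subalgebra (K : numFieldType) (A : superAlgType K)
    (S : A -> Prop) : Prop :=
  [/\ (forall k : K, S (sconst k)), (forall x y, S x -> S y -> S (x + y))
   & forall x y, S x -> S y -> S (x * y)].

Definition finitely_generated (K : numFieldType) (A : superAlgType K) : Prop :=
  exists gs : seq A, forall S : A -> Prop,
    subalgebra S -> (forall g, g \in gs -> S g) -> forall x, S x.

Record superideal (K : numFieldType) (A : superAlgType K) := SuperIdeal {
  si_mem :> A -> Prop;
  si0 : si_mem 0;
  siD : forall x y, si_mem x -> si_mem y -> si_mem (x + y);
  siMl : forall a x, si_mem x -> si_mem (a * x);
  siMr : forall a x, si_mem x -> si_mem (x * a);
  si_graded : forall x, si_mem x -> exists x0 x1,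
    [/\ parity false x0, parity true x1, x = x0 + x1, si_mem x0 & si_mem x1]
}.

Section SuperIdeals.
Variables (K : numFieldType) (A : superAlgType K).
Implicit Types (I J : superideal A).

Lemma siN I x : I x -> I (- x).
Proof. by move=> hx; rewrite -mulN1r; apply: siMl. Qed.

Lemma siB I x y : I x -> I y -> I (x - y).
Proof. by move=> hx hy; apply: siD => //; apply: siN. Qed.

Fact top_graded (x : A) : True -> exists x0 x1,
  [/\ parity false x0, parity true x1, x = x0 + x1, True & True].
Proof. by have [x0 [x1 [h0 h1 e]]] := parity_dec x; exists x0, x1. Qed.

Definition si_top : superideal A :=
  @SuperIdeal K A (fun=> True) I (fun _ _ _ _ => I) (fun _ _ _ => I)
    (fun _ _ _ => I) top_graded.

(* finite sums of products of an element of I by an element of J *)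
Inductive prod_span I J : A -> Prop :=
| prod_span0 : prod_span I J 0
| prod_spanD a b x : I a -> J b -> prod_span I J x ->
    prod_span I J (a * b + x).

Lemma prod_span_add I J x y :
  prod_span I J x -> prod_span I J y -> prod_span I J (x + y).
Proof.
move=> hx hy; elim: hx => [|a b z ha hb _ IH]; first by rewrite add0r.
by rewrite -addrA; apply: prod_spanD.
Qed.

Lemma prod_span1 I J a b : I a -> J b -> prod_span I J (a * b).
Proof.
by move=> ha hb; rewrite -[_ * _]addr0; do !constructor.
Qed.

Fact prod_spanMl I J a x : prod_span I J x -> prod_span I J (a * x).
Proof.
elim=> [|b c y hb hc _ IH]; first by rewrite mulr0; constructor.
by rewrite mulrDr mulrA; constructor=> //; apply: siMl.
Qed.

Fact prod_spanMr I J a x : prod_span I J x -> prod_span I J (x * a).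
Proof.
elim=> [|b c y hb hc _ IH]; first by rewrite mul0r; constructor.
by rewrite mulrDl -mulrA; constructor=> //; apply: siMr.
Qed.

Fact prod_span_graded I J x : prod_span I J x -> exists x0 x1,
  [/\ parity false x0, parity true x1, x = x0 + x1, prod_span I J x0
    & prod_span I J x1].
Proof.
elim=> [|a b y ha hb _ [y0 [y1 [h0 h1 -> s0 s1]]]].
  by exists 0, 0; split; rewrite ?addr0 //; first [exact: parity0|constructor].
have [a0 [a1 [ha0 ha1 -> sa0 sa1]]] := si_graded ha.
have [b0 [b1 [hb0 hb1 -> sb0 sb1]]] := si_graded hb.
exists (a0 * b0 + (a1 * b1 + y0)), (a0 * b1 + (a1 * b0 + y1)); split.
- apply: parityD; first exact: parityM ha0 hb0.
  by apply: parityD => //; apply: parityM ha1 hb1.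
- apply: parityD; first exact: parityM ha0 hb1.
  by apply: parityD => //; apply: parityM ha1 hb0.
- rewrite mulrDl !mulrDr -!addrA; congr (_ + _).
  rewrite (addrCA y0 (a0 * b1)) (addrCA y0 (a1 * b0)).
  by rewrite (addrCA (a1 * b1) (a0 * b1)) (addrCA (a1 * b1) (a1 * b0)).
- by constructor=> //; constructor.
- by constructor=> //; constructor.
Qed.

Definition si_mul I J : superideal A :=
  SuperIdeal (prod_span0 I J) (@prod_span_add I J) (@prod_spanMl I J)
    (@prod_spanMr I J) (@prod_span_graded I J).

Fixpoint si_exp I n : superideal A :=
  if n is n'.+1 then si_mul I (si_exp I n') else si_top.

Definition nilpotent_superideal I : Prop :=
  exists n, forall x, si_exp I n x -> x = 0.

Definition maximal_superideal I : Prop :=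
  ~ I 1 /\ forall J, (forall x, I x -> J x) -> ~ J 1 -> forall x, J x -> I x.

Lemma si_expS I n x : si_exp I n.+1 x -> si_exp I n x.
Proof.
elim: n x => [//|n IH] x; rewrite -[si_exp I n.+2]/(si_mul I (si_exp I n.+1)).
elim=> [|a b y ha hb _ IHy]; first exact: si0.
by apply: siD => //; apply: prod_span1 => //; apply: IH.
Qed.

End SuperIdeals.

Section Quotient.
Variables (K : numFieldType) (A : superAlgType K) (J : superideal A).

Definition si_pred : {pred A} := fun x => `[< J x >].

Lemma si_predP x : reflect (J x) (x \in si_pred).
Proof. exact: asboolP. Qed.

Fact si_pred_zmod : zmod_closed si_pred.
Proof.
split; first by apply/si_predP; apply: si0.
by move=> x y /si_predP hx /si_predP hy; apply/si_predP; apply: siB.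
Qed.

HB.instance Definition _ := GRing.isZmodClosed.Build A si_pred si_pred_zmod.

Definition squot : Type := Quotient.quot si_pred.
HB.instance Definition _ := GRing.Zmodule.on squot.

Definition squot_pi (x : A) : squot := \pi_(Quotient.quot si_pred) x.
Definition squot_repr (x : squot) : A := repr (x : Quotient.quot si_pred).

Lemma squot_reprK x : squot_pi (squot_repr x) = x.
Proof. exact: reprK. Qed.

Lemma squot_piP x y : squot_pi x = squot_pi y <-> J (x - y).
Proof.
split=> [/eqP|h]; first by rewrite -Quotient.idealrBE => /si_predP.
by apply/eqP; rewrite -Quotient.idealrBE; apply/si_predP.
Qed.

Lemma squot_piD x y : squot_pi (x + y) = squot_pi x + squot_pi y.
Proof. exact: raddfD. Qed.

Lemma squot_pi0 : squot_pi 0 = 0.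
Proof. exact: raddf0. Qed.

Lemma squot_pi_repr x : J (squot_repr (squot_pi x) - x).
Proof. by apply/squot_piP; rewrite squot_reprK. Qed.

Lemma squot_piW (P : squot -> Prop) :
  (forall a, P (squot_pi a)) -> forall x, P x.
Proof. by move=> h x; rewrite -[x]squot_reprK. Qed.

Definition squot_mul (x y : squot) := squot_pi (squot_repr x * squot_repr y).
Lemma squot_mulE x y : squot_mul (squot_pi x) (squot_pi y) = squot_pi (x * y).
Proof.
apply/squot_piP; set x' := squot_repr _; set y' := squot_repr _.
have -> : x' * y' - x * y = (x' - x) * y' + x * (y' - y).
  by rewrite mulrBl mulrBr addrA subrK.
by apply: siD; [apply: siMr|apply: siMl]; apply: squot_pi_repr.
Qed.

Fact squot_mulA : associative squot_mul.
Proof.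
elim/squot_piW=> a; elim/squot_piW=> b; elim/squot_piW=> c.
by rewrite !squot_mulE mulrA.
Qed.
Fact squot_mul1 : left_id (squot_pi 1) squot_mul.
Proof. by elim/squot_piW=> a; rewrite squot_mulE mul1r. Qed.
Fact squot_mulr1 : right_id (squot_pi 1) squot_mul.
Proof. by elim/squot_piW=> a; rewrite squot_mulE mulr1. Qed.
Fact squot_mulDl : left_distributive squot_mul +%R.
Proof.
elim/squot_piW=> a; elim/squot_piW=> b; elim/squot_piW=> c.
by rewrite -squot_piD !squot_mulE mulrDl squot_piD.
Qed.
Fact squot_mulDr : right_distributive squot_mul +%R.
Proof.
elim/squot_piW=> a; elim/squot_piW=> b; elim/squot_piW=> c.
by rewrite -squot_piD !squot_mulE mulrDr squot_piD.
Qed.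

HB.instance Definition _ := GRing.Zmodule_isPzRing.Build squot
  squot_mulA squot_mul1 squot_mulr1 squot_mulDl squot_mulDr.

Lemma squot_pi1 : squot_pi 1 = 1. Proof. by []. Qed.
Lemma squot_piM x y : squot_pi (x * y) = squot_pi x * squot_pi y.
Proof. by rewrite -squot_mulE. Qed.
Lemma squot_piN x : squot_pi (- x) = - squot_pi x.
Proof. exact: raddfN. Qed.

Definition squot_parity p (x : squot) : Prop :=
  exists2 a, parity p a & x = squot_pi a.

Definition squot_const (k : K) : squot := squot_pi (sconst k).

Fact squot_const_zmod : zmod_morphism squot_const.
Proof. by move=> k l; rewrite /squot_const rmorphB squot_piD squot_piN. Qed.
Fact squot_const_monoid : monoid_morphism squot_const.
Proof.
by split=> [|k l]; rewrite /squot_const ?rmorph1 // rmorphM squot_piM.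
Qed.
HB.instance Definition _ :=
  GRing.isZmodMorphism.Build K squot squot_const squot_const_zmod.
HB.instance Definition _ :=
  GRing.isMonoidMorphism.Build K squot squot_const squot_const_monoid.

Fact squot_parity_const k : squot_parity false (squot_const k).
Proof. by exists (sconst k) => //; apply: parity_sconst. Qed.
Fact squot_parity0 p : squot_parity p 0.
Proof. by exists 0; [apply: parity0|rewrite squot_pi0]. Qed.
Fact squot_parityD p x y :
  squot_parity p x -> squot_parity p y -> squot_parity p (x + y).
Proof.
move=> [a ha ->] [b hb ->].
by exists (a + b); [apply: parityD|rewrite squot_piD].
Qed.
Fact squot_parity_dec x : exists x0 x1,
  [/\ squot_parity false x0, squot_parity true x1 & x = x0 + x1].
Proof.
elim/squot_piW: x => a; have [a0 [a1 [h0 h1 ->]]] := parity_dec a.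
exists (squot_pi a0), (squot_pi a1).
by split; [exists a0|exists a1|rewrite squot_piD].
Qed.
Fact squot_parity_cap x : squot_parity false x -> squot_parity true x -> x = 0.
Proof.
move=> [a ha ->] [b hb /squot_piP hab].
have [x0 [x1 [h0 h1 e s0 s1]]] := si_graded hab.
have [ea _] := parity_uniq ha (parityN hb) h0 h1 e; rewrite -ea in s0.
by rewrite -squot_pi0; apply/squot_piP; rewrite subr0.
Qed.
Fact squot_parityM p q x y :
  squot_parity p x -> squot_parity q y -> squot_parity (p (+) q) (x * y).
Proof.
move=> [a ha ->] [b hb ->].
by exists (a * b); [apply: parityM|rewrite squot_piM].
Qed.
Fact squot_parityC p q x y : squot_parity p x -> squot_parity q y ->
  x * y = (-1) ^+ (p && q) * (y * x).
Proof.
move=> [a ha ->] [b hb ->]; rewrite -!squot_piM (parityC ha hb).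
by case: (p && q); rewrite !(expr0, expr1) ?mul1r // !mulN1r squot_piN.
Qed.

HB.instance Definition _ := isSuperAlgebra.Build K squot (sconst := squot_const)
  squot_parity_const squot_parity0 squot_parityD squot_parity_dec
  squot_parity_cap squot_parityM squot_parityC.

End Quotient.

(* multiplicative sets of even (hence central) elements *)
Record denominators (K : numFieldType) (A : superAlgType K) := Denominators {
  den_mem :> A -> Prop;
  den_even : forall s, den_mem s -> parity false s;
  den1 : den_mem 1;
  denM : forall s t, den_mem s -> den_mem t -> den_mem (s * t)
}.

Section Localization.
Variables (K : numFieldType) (A : superAlgType K) (S : denominators A).

Definition dens : Type := {s : A | `[< S s >]}.
HB.instance Definition _ := Choice.on dens.
Definition dval (s : dens) : A := sval s.
Arguments dval : simpl never.
Implicit Types (s t u : dens) (a b c : A).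

Definition mkden a (h : S a) : dens := exist _ a (asboolT h).
Definition dens1 : dens := mkden (den1 S).
Lemma dval_inj : injective dval. Proof. exact: val_inj. Qed.
Lemma densP s : S (dval s).
Proof. by apply/asboolP; apply: (valP s). Qed.
Definition densM s t : dens := mkden (denM (densP s) (densP t)).
Lemma dval1 : dval dens1 = 1. Proof. by []. Qed.
Lemma dvalM s t : dval (densM s t) = dval s * dval t. Proof. by []. Qed.

Lemma densC s a : dval s * a = a * dval s.
Proof. exact: evenC (den_even (densP s)). Qed.
Lemma densCA s a b : dval s * (a * b) = a * (dval s * b).
Proof. by rewrite mulrA densC mulrA. Qed.
Lemma densMC s t : densM s t = densM t s.
Proof. by apply: dval_inj; rewrite !dvalM ?dval1 densC. Qed.

(* a/s = b/t when u(ta) = u(sb) for some denominator u *)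
Definition sloc_eq (x y : A * dens) : bool :=
  `[< exists u : dens, dval u * (dval y.2 * x.1) = dval u * (dval x.2 * y.1) >].

Fact sloc_eq_equiv : equiv_class_of sloc_eq.
Proof.
split=> [[a s]|[a s] [b t]|[b t] [a s] [c r]].
- by apply/asboolP; exists dens1.
- by apply/asboolP/asboolP=> -[u h]; exists u.
move=> /asboolP [u /= h] /asboolP [v /= g]; apply/asboolP.
exists (densM (densM u v) t); rewrite /= !dvalM -!mulrA.
have -> : dval u * (dval v * (dval t * (dval r * a))) =
          dval r * (dval v * (dval u * (dval t * a))).
  by rewrite !(densCA _ (dval r)) (densCA u).
rewrite h.
have -> : dval r * (dval v * (dval u * (dval s * b))) =
          dval s * (dval u * (dval v * (dval r * b))).
  by rewrite (densCA u (dval s)) (densCA v (dval s)) (densCA r (dval s))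
     (densCA r (dval v)) (densCA r (dval u)) (densCA v (dval u)).
by rewrite g !(densCA _ (dval s)).
Qed.
Canonical sloc_equiv := EquivRelPack sloc_eq_equiv.
Canonical sloc_encModRel := defaultEncModRel sloc_eq.

Definition sloc : Type := {eq_quot sloc_eq}.
HB.instance Definition _ := Choice.on sloc.

Definition sfrac a s : sloc := \pi_({eq_quot sloc_eq}) (a, s).
Definition snum (x : sloc) : A := (repr (x : {eq_quot sloc_eq})).1.
Definition sden (x : sloc) : dens := (repr (x : {eq_quot sloc_eq})).2.

Lemma sfracK x : sfrac (snum x) (sden x) = x.
Proof. by rewrite /sfrac /snum /sden -surjective_pairing; apply: reprK. Qed.

Lemma sfracW (P : sloc -> Prop) : (forall a s, P (sfrac a s)) -> forall x, P x.
Proof. by move=> h x; rewrite -[x]sfracK. Qed.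

Lemma sfracP a b s t : sfrac a s = sfrac b t <->
  exists u : dens, dval u * (dval t * a) = dval u * (dval s * b).
Proof.
by split=> [/eqmodP /asboolP|h]; [|apply/eqmodP/asboolP].
Qed.

Lemma sfrac_expand u a s : sfrac (dval u * a) (densM u s) = sfrac a s.
Proof.
by apply/sfracP; exists dens1; rewrite !dvalM -!mulrA (densCA s (dval u)).
Qed.

Lemma sfrac2 (x y : sloc) : exists a b s, x = sfrac a s /\ y = sfrac b s.
Proof.
elim/sfracW: x => a s; elim/sfracW: y => b t.
exists (dval t * a), (dval s * b), (densM t s).
by rewrite sfrac_expand densMC sfrac_expand.
Qed.

Lemma sfrac3 (x y z : sloc) : exists a b c s,
  [/\ x = sfrac a s, y = sfrac b s & z = sfrac c s].
Proof.
have [a [b [s [-> ->]]]] := sfrac2 x y; elim/sfracW: z => c t.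
exists (dval t * a), (dval t * b), (dval s * c), (densM t s).
by rewrite !sfrac_expand densMC sfrac_expand.
Qed.

Definition sloc_add (x y : sloc) : sloc :=
  sfrac (dval (sden y) * snum x + dval (sden x) * snum y)
        (densM (sden x) (sden y)).
Definition sloc_mul (x y : sloc) : sloc :=
  sfrac (snum x * snum y) (densM (sden x) (sden y)).
Definition sloc_opp (x : sloc) : sloc := sfrac (- snum x) (sden x).

Lemma sloc_oppE a s : sloc_opp (sfrac a s) = sfrac (- a) s.
Proof.
rewrite /sloc_opp; have /sfracP [u h] := sfracK (sfrac a s).
by apply/sfracP; exists u; rewrite !mulrN h.
Qed.

Let add_congr a a' s s' b t : sfrac a s = sfrac a' s' ->
  sfrac (dval t * a + dval s * b) (densM s t) =
  sfrac (dval t * a' + dval s' * b) (densM s' t).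
Proof.
move=> /sfracP [u h]; apply/sfracP; exists u; rewrite !dvalM !mulrDr -!mulrA.
have e r (c : A) : dval u * (dval r * (dval t * (dval t * c))) =
    dval t * (dval t * (dval u * (dval r * c))).
  by rewrite !(densCA _ (dval t)).
rewrite !e h; congr (_ + _).
by rewrite (densCA t (dval s)) (densCA s' (dval s)) (densCA t (dval s')).
Qed.

Lemma sloc_addE a b s t : sloc_add (sfrac a s) (sfrac b t) =
  sfrac (dval t * a + dval s * b) (densM s t).
Proof.
rewrite /sloc_add (add_congr _ _ (sfracK (sfrac a s))).
rewrite addrC densMC (add_congr _ _ (sfracK (sfrac b t))).
by rewrite addrC densMC.
Qed.

Lemma sloc_addE1 a b s : sloc_add (sfrac a s) (sfrac b s) = sfrac (a + b) s.
Proof. by rewrite sloc_addE -mulrDr sfrac_expand. Qed.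

Lemma sloc_mulE a b s t :
  sloc_mul (sfrac a s) (sfrac b t) = sfrac (a * b) (densM s t).
Proof.
rewrite /sloc_mul.
have /sfracP [u h] := sfracK (sfrac a s).
have /sfracP [v g] := sfracK (sfrac b t).
move: h g; set a' := snum _; set s' := sden _; set b' := snum _; set t' := sden _.
move=> h g; apply/sfracP; exists (densM u v); rewrite !dvalM -!mulrA.
have e r q (c d : A) : dval u * (dval v * (dval r * (dval q * (c * d)))) =
    (dval u * (dval r * c)) * (dval v * (dval q * d)).
  by rewrite -!mulrA -(densCA v c) -(densCA q c) (densCA v (dval r)).
by rewrite !e h g.
Qed.

Fact sloc_addA : associative sloc_add.
Proof.
move=> x y z; have [a [b [c [s [-> -> ->]]]]] := sfrac3 x y z.
by rewrite !sloc_addE1 addrA.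
Qed.
Fact sloc_addC : commutative sloc_add.
Proof.
move=> x y; have [a [b [s [-> ->]]]] := sfrac2 x y.
by rewrite !sloc_addE1 addrC.
Qed.
Lemma sfrac0 s t : sfrac 0 s = sfrac 0 t.
Proof. by apply/sfracP; exists dens1; rewrite !mulr0. Qed.
Fact sloc_add0 : left_id (sfrac 0 dens1) sloc_add.
Proof. by elim/sfracW=> a s; rewrite (sfrac0 _ s) sloc_addE1 add0r. Qed.
Fact sloc_addN : left_inverse (sfrac 0 dens1) sloc_opp sloc_add.
Proof.
by elim/sfracW=> a s; rewrite sloc_oppE sloc_addE1 addNr; apply: sfrac0.
Qed.

HB.instance Definition _ :=
  GRing.isZmodule.Build sloc sloc_addA sloc_addC sloc_add0 sloc_addN.

Lemma sfracD a b s : sfrac (a + b) s = sfrac a s + sfrac b s.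
Proof. by rewrite -sloc_addE1. Qed.
Lemma sfracN a s : sfrac (- a) s = - sfrac a s.
Proof. by rewrite -sloc_oppE. Qed.
Lemma sfrac0E s : sfrac 0 s = 0.
Proof. exact: sfrac0. Qed.

Fact sloc_mulA : associative sloc_mul.
Proof.
elim/sfracW=> a s; elim/sfracW=> b t; elim/sfracW=> c r.
by rewrite !sloc_mulE mulrA; congr sfrac; apply: dval_inj; rewrite !dvalM ?dval1 mulrA.
Qed.
Fact sloc_mul1 : left_id (sfrac 1 dens1) sloc_mul.
Proof.
elim/sfracW=> a s; rewrite sloc_mulE mul1r; congr sfrac.
by apply: dval_inj; rewrite !dvalM ?dval1 mul1r.
Qed.
Fact sloc_mulr1 : right_id (sfrac 1 dens1) sloc_mul.
Proof.
elim/sfracW=> a s; rewrite sloc_mulE mulr1; congr sfrac.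
by apply: dval_inj; rewrite !dvalM ?dval1 mulr1.
Qed.
Fact sloc_mulDl : left_distributive sloc_mul +%R.
Proof.
move=> x y z; have [a [b [c [s [-> -> ->]]]]] := sfrac3 x y z.
by rewrite -sfracD !sloc_mulE mulrDl sfracD.
Qed.
Fact sloc_mulDr : right_distributive sloc_mul +%R.
Proof.
move=> x y z; have [a [b [c [s [-> -> ->]]]]] := sfrac3 x y z.
by rewrite -sfracD !sloc_mulE mulrDr sfracD.
Qed.

HB.instance Definition _ := GRing.Zmodule_isPzRing.Build sloc
  sloc_mulA sloc_mul1 sloc_mulr1 sloc_mulDl sloc_mulDr.

Lemma sfracM a b s t : sfrac (a * b) (densM s t) = sfrac a s * sfrac b t.
Proof. by rewrite -sloc_mulE. Qed.
Lemma sfrac1 : sfrac 1 dens1 = 1.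
Proof. by []. Qed.
Lemma sfracV s : sfrac 1 s * sfrac (dval s) dens1 = 1.
Proof.
by rewrite -sfracM -sfrac1; apply/sfracP; exists dens1; rewrite !dvalM dval1 !mul1r !mulr1.
Qed.

Definition sloc_const (k : K) : sloc := sfrac (sconst k) dens1.
Definition sloc_parity p (x : sloc) : Prop :=
  exists a s, parity p a /\ x = sfrac a s.

Lemma densM11 : densM dens1 dens1 = dens1.
Proof. by apply: dval_inj; rewrite !dvalM ?dval1 mul1r. Qed.

Fact sloc_const_zmod : zmod_morphism sloc_const.
Proof. by move=> k l; rewrite /sloc_const rmorphB sfracD sfracN. Qed.
Fact sloc_const_monoid : monoid_morphism sloc_const.
Proof.
split=> [|k l]; rewrite /sloc_const ?rmorph1 //.
by rewrite rmorphM -{1}densM11 sfracM.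
Qed.
HB.instance Definition _ :=
  GRing.isZmodMorphism.Build K sloc sloc_const sloc_const_zmod.
HB.instance Definition _ :=
  GRing.isMonoidMorphism.Build K sloc sloc_const sloc_const_monoid.

Lemma parity_den p s a : parity p a -> parity p (dval s * a).
Proof. exact: parityM (den_even (densP s)). Qed.

Fact sloc_parity_const k : sloc_parity false (sloc_const k).
Proof. by exists (sconst k), dens1; split=> //; apply: parity_sconst. Qed.
Fact sloc_parity0 p : sloc_parity p 0.
Proof. by exists 0, dens1; split=> //; apply: parity0. Qed.
Fact sloc_parityD p x y :
  sloc_parity p x -> sloc_parity p y -> sloc_parity p (x + y).
Proof.
move=> [a [s [ha ->]]] [b [t [hb ->]]].
exists (dval t * a + dval s * b), (densM s t); split; last exact: sloc_addE.
by apply: parityD; apply: parity_den.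
Qed.
Fact sloc_parity_dec x : exists x0 x1,
  [/\ sloc_parity false x0, sloc_parity true x1 & x = x0 + x1].
Proof.
elim/sfracW: x => a s; have [a0 [a1 [h0 h1 ->]]] := parity_dec a.
exists (sfrac a0 s), (sfrac a1 s).
by split; [exists a0, s|exists a1, s|rewrite sfracD].
Qed.
Fact sloc_parity_cap x : sloc_parity false x -> sloc_parity true x -> x = 0.
Proof.
move=> [a [s [ha ->]]] [b [t [hb /sfracP [u h]]]].
rewrite -(sfrac0E dens1); apply/sfracP; exists (densM u t).
rewrite !mulr0 dval1 mul1r dvalM -mulrA; apply: parity_cap.
  by do 2!apply: parity_den.
by rewrite h; do 2!apply: parity_den.
Qed.
Fact sloc_parityM p q x y :
  sloc_parity p x -> sloc_parity q y -> sloc_parity (p (+) q) (x * y).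
Proof.
move=> [a [s [ha ->]]] [b [t [hb ->]]].
by exists (a * b), (densM s t); split; [apply: parityM|rewrite sfracM].
Qed.
Fact sloc_parityC p q x y : sloc_parity p x -> sloc_parity q y ->
  x * y = (-1) ^+ (p && q) * (y * x).
Proof.
move=> [a [s [ha ->]]] [b [t [hb ->]]]; rewrite -!sfracM (parityC ha hb) densMC.
by case: (p && q); rewrite !(expr0, expr1) ?mul1r // !mulN1r sfracN.
Qed.

HB.instance Definition _ := isSuperAlgebra.Build K sloc (sconst := sloc_const)
  sloc_parity_const sloc_parity0 sloc_parityD sloc_parity_dec
  sloc_parity_cap sloc_parityM sloc_parityC.

End Localization.

Record closed_point (K : numFieldType) (A : superAlgType K) := ClosedPoint {
  pt_ideal :> superideal A;
  pt_max : maximal_superideal pt_ideal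
}.

Section LocalRing.
Variables (K : numFieldType) (A : superAlgType K) (P : closed_point A).

Let P1 : ~ P 1. Proof. by have [] := pt_max P. Qed.

Section Principal.
Variables (p : bool) (c : A) (hc : parity p c).

Definition adjoin_mem (x : A) : Prop := exists a b, P a /\ x = a + b * c.

Fact adjoin0 : adjoin_mem 0.
Proof. by exists 0, 0; split; [apply: si0|rewrite mul0r addr0]. Qed.
Fact adjoinD x y : adjoin_mem x -> adjoin_mem y -> adjoin_mem (x + y).
Proof.
move=> [a [b [ha ->]]] [a' [b' [ha' ->]]]; exists (a + a'), (b + b').
by split; [apply: siD|rewrite mulrDl addrACA].
Qed.
Fact adjoinMl z x : adjoin_mem x -> adjoin_mem (z * x).
Proof.
move=> [a [b [ha ->]]]; exists (z * a), (z * b).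
by split; [apply: siMl|rewrite mulrDr mulrA].
Qed.
Fact adjoinMr z x : adjoin_mem x -> adjoin_mem (x * z).
Proof.
move=> [a [b [ha ->]]]; have [z' e] := parity_swap z hc.
exists (a * z), (b * z').
by split; [apply: siMr|rewrite mulrDl -!mulrA e].
Qed.
Fact adjoin_graded x : adjoin_mem x -> exists x0 x1,
  [/\ parity false x0, parity true x1, x = x0 + x1, adjoin_mem x0
    & adjoin_mem x1].
Proof.
move=> [a [b [ha ->]]].
have [a0 [a1 [ha0 ha1 -> sa0 sa1]]] := si_graded ha.
have [b0 [b1 [hb0 hb1 ->]]] := parity_dec b.
have k0 := parityM hb0 hc; have k1 := parityM hb1 hc.
case: p in k0 k1 *.
  exists (a0 + b1 * c), (a1 + b0 * c); split; try exact: parityD.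
  - by rewrite mulrDl [b0 * c + _]addrC addrACA.
  - by exists a0, b1.
  - by exists a1, b0.
exists (a0 + b0 * c), (a1 + b1 * c); split; try exact: parityD.
- by rewrite mulrDl addrACA.
- by exists a0, b0.
- by exists a1, b1.
Qed.
Definition adjoin : superideal A :=
  SuperIdeal adjoin0 adjoinD adjoinMl adjoinMr adjoin_graded.

Lemma adjoin1 : ~ P c -> exists a b, P a /\ 1 = a + b * c.
Proof.
move=> nc; apply: contrapT => n1; apply: nc.
have [_ /(_ adjoin)] := pt_max P; apply=> //=.
  by move=> x hx; exists x, 0; rewrite mul0r addr0.
by exists 0, 1; split; [apply: si0|rewrite add0r mul1r].
Qed.
End Principal.

Lemma pt_odd c : parity true c -> P c.
Proof.
move=> hc; apply: contrapT => nc; have [a [b [ha e]]] := adjoin1 hc nc.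
apply: nc; rewrite -[c]mul1r e mulrDl -mulrA odd_sqr0 // mulr0 addr0.
exact: siMr.
Qed.

(* A_0 \ m_0, where P = m_0 + A_1 (see pt_odd) *)
Definition pt_compl (s : A) : Prop := parity false s /\ ~ P s.

Fact pt_compl_even s : pt_compl s -> parity false s.
Proof. by case. Qed.
Fact pt_compl1 : pt_compl 1.
Proof. by split; [apply: parity1|]. Qed.
Fact pt_complM s t : pt_compl s -> pt_compl t -> pt_compl (s * t).
Proof.
move=> [hs ns] [ht nt]; split; first exact: parityM hs ht.
move=> hst; apply: nt; have [a [b [ha e]]] := adjoin1 hs ns.
rewrite -[t]mul1r e mulrDl -mulrA.
by apply: siD; [apply: siMr|apply: siMl].
Qed.
Definition pt_den : denominators A :=
  Denominators pt_compl_even pt_compl1 pt_complM.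

Definition local_ring : Type := sloc pt_den.
HB.instance Definition _ := SuperAlgebra.on local_ring.

Definition local_max_mem (x : local_ring) : Prop :=
  exists a (s : dens pt_den), P a /\ x = sfrac a s.

Fact local_max0 : local_max_mem 0.
Proof.
exists 0, (dens1 pt_den); split; first exact: si0.
by rewrite sfrac0E.
Qed.
Fact local_maxD x y :
  local_max_mem x -> local_max_mem y -> local_max_mem (x + y).
Proof.
move=> [a [s [ha ->]]] [b [t [hb ->]]].
exists (dval t * a + dval s * b), (densM s t); split; last exact: sloc_addE.
by apply: siD; apply: siMl.
Qed.
Fact local_maxMl z x : local_max_mem x -> local_max_mem (z * x).
Proof.
move=> [a [s [ha ->]]]; elim/sfracW: z => b t.
by exists (b * a), (densM t s); split; [apply: siMl|rewrite sfracM].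
Qed.
Fact local_maxMr z x : local_max_mem x -> local_max_mem (x * z).
Proof.
move=> [a [s [ha ->]]]; elim/sfracW: z => b t.
by exists (a * b), (densM s t); split; [apply: siMr|rewrite sfracM].
Qed.
Fact local_max_graded x : local_max_mem x -> exists x0 x1,
  [/\ parity false x0, parity true x1, x = x0 + x1, local_max_mem x0
    & local_max_mem x1].
Proof.
move=> [a [s [ha ->]]]; have [a0 [a1 [h0 h1 -> s0 s1]]] := si_graded ha.
exists (sfrac a0 s), (sfrac a1 s); split; rewrite ?sfracD //.
- by exists a0, s.
- by exists a1, s.
- by exists a0, s.
- by exists a1, s.
Qed.
Definition local_max : superideal local_ring :=
  SuperIdeal local_max0 local_maxD local_maxMl local_maxMr local_max_graded.

Lemma local_max_proper : ~ local_max 1.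
Proof.
move=> [a [s [ha /sfracP [u]]]]; rewrite dval1 mul1r mulr1 => e.
have [_ n] := densP (densM u s); apply: n.
by rewrite dvalM e; apply: siMl.
Qed.

(* hence local_ring is local *)
Lemma local_maxP (J : superideal local_ring) :
  maximal_superideal J <-> forall x, J x <-> local_max x.
Proof.
have sub (I : superideal local_ring) : ~ I 1 -> forall x, I x -> local_max x.
  move=> I1 x hx; have [x0 [x1 [h0 h1 -> s0 s1]]] := si_graded hx.
  apply: siD; last first.
    by case: h1 => c [t [hc ->]]; exists c, t; split=> //; apply: pt_odd.
  case: h0 s0 => b [t [hb ->]] Ib; exists b, t; split=> //.
  apply: contrapT => nb; apply: I1.
  have sb : pt_den b by split.
  have -> : 1 = sfrac (dval t) (mkden sb) * sfrac b t.
    rewrite -sfracM -sfrac1; apply/sfracP; exists (dens1 pt_den).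
    by rewrite dvalM !dval1 !mul1r mulr1 densC.
  exact: siMl.
split=> [[J1 maxJ] x|e].
  split; first exact: sub.
  by apply: maxJ; [apply: sub|apply: local_max_proper].
split=> [/e|I _ I1 x hx]; first exact: local_max_proper.
by apply/e; apply: sub hx.
Qed.

End LocalRing.

Section Completion.
Variables (K : numFieldType) (B : superAlgType K) (I : superideal B).

(* the projection B/I^(n+1) -> B/I^n *)
Definition squot_trans n (x : squot (si_exp I n.+1)) : squot (si_exp I n) :=
  squot_pi _ (squot_repr x).

Lemma squot_transE n a : squot_trans (squot_pi (si_exp I n.+1) a) = squot_pi _ a.
Proof. by apply/squot_piP; apply: si_expS; apply: squot_pi_repr. Qed.

Lemma squot_transD n x y : @squot_trans n (x + y) = squot_trans x + squot_trans y.
Proof.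
elim/squot_piW: x => a; elim/squot_piW: y => b.
by rewrite -squot_piD !squot_transE squot_piD.
Qed.
Lemma squot_transN n x : @squot_trans n (- x) = - squot_trans x.
Proof.
by elim/squot_piW: x => a; rewrite -squot_piN !squot_transE squot_piN.
Qed.
Lemma squot_transM n x y : @squot_trans n (x * y) = squot_trans x * squot_trans y.
Proof.
elim/squot_piW: x => a; elim/squot_piW: y => b.
by rewrite -squot_piM !squot_transE squot_piM.
Qed.
Lemma squot_trans_parity n p x : parity p x -> parity p (@squot_trans n x).
Proof. by move=> [a ha ->]; exists a => //; rewrite squot_transE. Qed.

(* the inverse limit of the B/I^n *)
Record completion := Completion {
  cseq : forall n, squot (si_exp I n);
  cseqP : forall n, squot_trans (cseq n.+1) = cseq n
}.

HB.instance Definition _ := gen_eqMixin completion.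
HB.instance Definition _ := gen_choiceMixin completion.

Lemma cseq_inj x y : (forall n, cseq x n = cseq y n) -> x = y.
Proof.
case: x y => [x hx] [y hy] /= e.
have exy : x = y by apply: functional_extensionality_dep.
by subst y; congr Completion; apply: Prop_irrelevance.
Qed.

Fact cseq0P n : squot_trans (0 : squot (si_exp I n.+1)) = 0.
Proof. by rewrite -!squot_pi0 squot_transE. Qed.
Fact cseq1P n : squot_trans (1 : squot (si_exp I n.+1)) = 1.
Proof. by rewrite -!squot_pi1 squot_transE. Qed.
Fact cseqDP (x y : completion) n :
  squot_trans (cseq x n.+1 + cseq y n.+1) = cseq x n + cseq y n.
Proof. by rewrite squot_transD !cseqP. Qed.
Fact cseqNP (x : completion) n : squot_trans (- cseq x n.+1) = - cseq x n.
Proof. by rewrite squot_transN cseqP. Qed.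
Fact cseqMP (x y : completion) n :
  squot_trans (cseq x n.+1 * cseq y n.+1) = cseq x n * cseq y n.
Proof. by rewrite squot_transM !cseqP. Qed.
Fact cseq_constP (k : K) n :
  squot_trans (sconst k : squot (si_exp I n.+1)) = sconst k.
Proof. by rewrite /sconst /= /squot_const squot_transE. Qed.

Definition compl0 := Completion cseq0P.
Definition compl1 := Completion cseq1P.
Definition compl_add x y := Completion (cseqDP x y).
Definition compl_opp x := Completion (cseqNP x).
Definition compl_mul x y := Completion (cseqMP x y).
Definition compl_const k := Completion (cseq_constP k).

Fact compl_addA : associative compl_add.
Proof. by move=> x y z; apply: cseq_inj => n; apply: addrA. Qed.
Fact compl_addC : commutative compl_add.
Proof. by move=> x y; apply: cseq_inj => n; apply: addrC. Qed.
Fact compl_add0 : left_id compl0 compl_add.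
Proof. by move=> x; apply: cseq_inj => n; apply: add0r. Qed.
Fact compl_addN : left_inverse compl0 compl_opp compl_add.
Proof. by move=> x; apply: cseq_inj => n; apply: addNr. Qed.

HB.instance Definition _ :=
  GRing.isZmodule.Build completion compl_addA compl_addC compl_add0 compl_addN.

Fact compl_mulA : associative compl_mul.
Proof. by move=> x y z; apply: cseq_inj => n; apply: mulrA. Qed.
Fact compl_mul1 : left_id compl1 compl_mul.
Proof. by move=> x; apply: cseq_inj => n; apply: mul1r. Qed.
Fact compl_mulr1 : right_id compl1 compl_mul.
Proof. by move=> x; apply: cseq_inj => n; apply: mulr1. Qed.
Fact compl_mulDl : left_distributive compl_mul +%R.
Proof. by move=> x y z; apply: cseq_inj => n; apply: mulrDl. Qed.
Fact compl_mulDr : right_distributive compl_mul +%R.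
Proof. by move=> x y z; apply: cseq_inj => n; apply: mulrDr. Qed.

HB.instance Definition _ := GRing.Zmodule_isPzRing.Build completion
  compl_mulA compl_mul1 compl_mulr1 compl_mulDl compl_mulDr.

Fact compl_const_zmod : zmod_morphism compl_const.
Proof. by move=> k l; apply: cseq_inj => n; apply: rmorphB. Qed.
Fact compl_const_monoid : monoid_morphism compl_const.
Proof.
by split=> [|k l]; apply: cseq_inj => n; [apply: rmorph1|apply: rmorphM].
Qed.
HB.instance Definition _ :=
  GRing.isZmodMorphism.Build K completion compl_const compl_const_zmod.
HB.instance Definition _ :=
  GRing.isMonoidMorphism.Build K completion compl_const compl_const_monoid.

Definition compl_parity p (x : completion) : Prop :=
  forall n, parity p (cseq x n).

Fact compl_parity_const k : compl_parity false (compl_const k).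
Proof. by move=> n; apply: parity_sconst. Qed.
Fact compl_parity0 p : compl_parity p 0.
Proof. by move=> n; apply: parity0. Qed.
Fact compl_parityD p x y :
  compl_parity p x -> compl_parity p y -> compl_parity p (x + y).
Proof. by move=> hx hy n; apply: parityD (hx n) (hy n). Qed.
Fact compl_parity_dec x : exists x0 x1,
  [/\ compl_parity false x0, compl_parity true x1 & x = x0 + x1].
Proof.
have /cid [f hf] : exists f : forall n, squot (si_exp I n) * squot (si_exp I n),
    forall n, [/\ parity false (f n).1, parity true (f n).2
                & cseq x n = (f n).1 + (f n).2].
  have h n : {p : squot (si_exp I n) * squot (si_exp I n) |
      [/\ parity false p.1, parity true p.2 & cseq x n = p.1 + p.2]}.
    apply: cid; have [x0 [x1 [h0 h1 e]]] := parity_dec (cseq x n).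
    by exists (x0, x1).
  by exists (fun n => sval (h n)) => n; case: (h n).
have key n : squot_trans (f n.+1).1 = (f n).1 /\ squot_trans (f n.+1).2 = (f n).2.
  have [h0 h1 e] := hf n; have [g0 g1 e'] := hf n.+1.
  apply: parity_uniq => //; try exact: squot_trans_parity.
  by rewrite -squot_transD -e' cseqP e.
exists (Completion (fun n => (key n).1)), (Completion (fun n => (key n).2)).
split; try by move=> n; have [] := hf n.
by apply: cseq_inj => n; have [] := hf n.
Qed.
Fact compl_parity_cap x : compl_parity false x -> compl_parity true x -> x = 0.
Proof.
by move=> h0 h1; apply: cseq_inj => n; apply: parity_cap (h0 n) (h1 n).
Qed.
Fact compl_parityM p q x y :
  compl_parity p x -> compl_parity q y -> compl_parity (p (+) q) (x * y).
Proof. by move=> hx hy n; apply: parityM (hx n) (hy n). Qed.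
Fact compl_parityC p q x y : compl_parity p x -> compl_parity q y ->
  x * y = (-1) ^+ (p && q) * (y * x).
Proof.
move=> hx hy; apply: cseq_inj => n.
have := parityC (hx n) (hy n); case: (p && q) => /=.
  by rewrite !expr1 !mulN1r.
by rewrite !expr0 !mul1r.
Qed.

HB.instance Definition _ := isSuperAlgebra.Build K completion
  (sconst := compl_const) compl_parity_const compl_parity0 compl_parityD
  compl_parity_dec compl_parity_cap compl_parityM compl_parityC.

End Completion.

(* K[[X_1,...,X_r]]: f m is the coefficient of the monomial X^m *)
Section PowerSeries.
Variables (K : numFieldType) (r : nat).

Definition powser : Type := 'X_{1..r} -> K.
HB.instance Definition _ := gen_eqMixin powser.
HB.instance Definition _ := gen_choiceMixin powser.
Implicit Types (f g h : powser) (m : 'X_{1..r}).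

Definition ps_const (k : K) : powser := fun m => if m == 0%MM then k else 0.
Definition ps_add f g : powser := fun m => f m + g m.
Definition ps_opp f : powser := fun m => - f m.
(* the bounds on k only make the index type finite *)
Definition ps_mul f g : powser := fun m =>
  \sum_(k : 'X_{1..r < (mdeg m).+1, (mdeg m).+1} | m == (k.1 + k.2)%MM)
    f k.1 * g k.2.

Definition ps_trunc N f : {mpoly K[r]} :=
  \sum_(m : 'X_{1..r < N}) f m *: 'X_[m].

Lemma ps_truncE N f m : (mdeg m < N)%N -> (ps_trunc N f)@_m = f m.
Proof. exact: mcoeff_mpoly. Qed.

Lemma mcoeffM_eq (p p' q q' : {mpoly K[r]}) m :
  (forall k, (mdeg k <= mdeg m)%N -> p@_k = p'@_k) ->
  (forall k, (mdeg k <= mdeg m)%N -> q@_k = q'@_k) ->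
  (p * q)@_m = (p' * q')@_m.
Proof.
move=> ep eq; rewrite !mcoeffM; apply: eq_bigr => k _.
by rewrite ep ?eq // -ltnS bmdeg.
Qed.

Lemma ps_mulE N f g m : (mdeg m < N)%N ->
  ps_mul f g m = (ps_trunc N f * ps_trunc N g)@_m.
Proof.
move=> lt; rewrite mcoeffM; apply: eq_bigr => k _.
by rewrite !ps_truncE //; apply: leq_trans lt; rewrite bmdeg.
Qed.

Lemma ps_trunc_mul N f g k : (mdeg k < N)%N ->
  (ps_trunc N (ps_mul f g))@_k = (ps_trunc N f * ps_trunc N g)@_k.
Proof. by move=> lt; rewrite ps_truncE // (ps_mulE _ _ lt). Qed.

Lemma ps_trunc1 N k : (mdeg k < N)%N -> (ps_trunc N (ps_const 1))@_k = 1@_k.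
Proof.
move=> lt; rewrite ps_truncE // mcoeff1 /ps_const.
by case: (k == 0%MM).
Qed.

Fact ps_addA : associative ps_add.
Proof. by move=> f g h; apply: funext => m; apply: addrA. Qed.
Fact ps_addC : commutative ps_add.
Proof. by move=> f g; apply: funext => m; apply: addrC. Qed.
Fact ps_add0 : left_id (ps_const 0) ps_add.
Proof.
by move=> f; apply: funext => m; rewrite /ps_add /ps_const if_same add0r.
Qed.
Fact ps_addN : left_inverse (ps_const 0) ps_opp ps_add.
Proof.
by move=> f; apply: funext => m; rewrite /ps_add /ps_const if_same addNr.
Qed.
HB.instance Definition _ :=
  GRing.isZmodule.Build powser ps_addA ps_addC ps_add0 ps_addN.

Lemma psDE f g m : (f + g) m = f m + g m. Proof. by []. Qed.

Fact ps_mulA : associative ps_mul.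
Proof.
move=> f g h; apply: funext => m.
rewrite !(ps_mulE (N := (mdeg m).+1)) //.
transitivity ((ps_trunc (mdeg m).+1 f *
    (ps_trunc (mdeg m).+1 g * ps_trunc (mdeg m).+1 h))@_m).
  by apply: mcoeffM_eq => // k le; apply: ps_trunc_mul.
by rewrite mulrA; apply: mcoeffM_eq => // k le; rewrite ps_trunc_mul.
Qed.
Fact ps_mulC : commutative ps_mul.
Proof.
move=> f g; apply: funext => m.
by rewrite !(ps_mulE (N := (mdeg m).+1)) // mulrC.
Qed.
Fact ps_mul1 : left_id (ps_const 1) ps_mul.
Proof.
move=> f; apply: funext => m; rewrite (ps_mulE (N := (mdeg m).+1)) //.
rewrite -[RHS](ps_truncE (N := (mdeg m).+1)) // -[in RHS](mul1r (ps_trunc _ _)).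
by apply: mcoeffM_eq => // k le; apply: ps_trunc1.
Qed.
Fact ps_mulDl : left_distributive ps_mul +%R.
Proof.
move=> f g h; apply: funext => m; rewrite psDE -big_split /=.
by apply: eq_bigr => k _; rewrite psDE mulrDl.
Qed.
Fact ps_1neq0 : ps_const 1 != 0.
Proof.
apply/eqP => /(congr1 (fun f : powser => f 0%MM)).
by rewrite /= /ps_const eqxx => /eqP; rewrite /GRing.zero /= /ps_const eqxx oner_eq0.
Qed.
HB.instance Definition _ := GRing.Zmodule_isComNzRing.Build powser
  ps_mulA ps_mulC ps_mul1 ps_mulDl ps_1neq0.

Fact ps_const_zmod : zmod_morphism ps_const.
Proof.
move=> k l; apply: funext => m; rewrite psDE /ps_const.
rewrite -[(- _ : powser) m]/(- (ps_const l m)) /ps_const.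
by case: ifP => // _; rewrite subr0.
Qed.
Fact ps_const_monoid : monoid_morphism ps_const.
Proof.
split=> // k l; apply: funext => m.
rewrite -[(_ * _ : powser) m]/(ps_mul _ _ m) (ps_mulE (N := (mdeg m).+1)) //.
transitivity ((k%:MP_[r] * l%:MP_[r])@_m).
  by rewrite -mpolyCM mcoeffC /ps_const; case: eqP; rewrite ?mulr1 ?mulr0.
apply: mcoeffM_eq => i le; rewrite ps_truncE // mcoeffC /ps_const.
  by case: eqP; rewrite ?mulr1 ?mulr0.
by case: eqP; rewrite ?mulr1 ?mulr0.
Qed.
HB.instance Definition _ :=
  GRing.isZmodMorphism.Build K powser ps_const ps_const_zmod.
HB.instance Definition _ :=
  GRing.isMonoidMorphism.Build K powser ps_const ps_const_monoid.

End PowerSeries.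

(* The exterior algebra over R on Y_1,...,Y_s: f stands for the sum over S of
   (f S) Y_S, with Y_S the product of the Y_i, i in S, in increasing order. *)
Section Grassmann.
Variables (R : comNzRingType) (s : nat).

Definition grass : Type := {ffun {set 'I_s} -> R}.
HB.instance Definition _ := GRing.Zmodule.on grass.
Implicit Types (f g h : grass) (S T U V : {set 'I_s}).

(* Y_T Y_U = (-1)^(inversions T U) Y_(T u U) for disjoint T and U *)
Definition inversions T U : nat := \sum_(i in T) \sum_(j in U) (j < i)%N.

Definition gr_mul f g : grass :=
  [ffun S : {set 'I_s} => \sum_(T : {set 'I_s} | T \subset S)
    (-1) ^+ inversions T (S :\: T) * (f T * g (S :\: T))].
Definition gr_const (c : R) : grass :=
  [ffun S : {set 'I_s} => if S == set0 then c else 0].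

Lemma setUD T U : U \subset T -> U :|: (T :\: U) = T.
Proof. by move=> h; rewrite setDE setUIr setUCr setIT; apply/setUidPr. Qed.

Lemma inversions0l U : inversions set0 U = 0%N.
Proof. by rewrite /inversions big_set0. Qed.
Lemma inversions0r T : inversions T set0 = 0%N.
Proof. by rewrite /inversions big1 // => i _; rewrite big_set0. Qed.

Lemma inversionsUl T U V : [disjoint T & U] ->
  inversions (T :|: U) V = (inversions T V + inversions U V)%N.
Proof.
by move=> d; rewrite /inversions -bigU //=; apply: eq_bigl => i; rewrite !inE.
Qed.
Lemma inversionsUr T U V : [disjoint U & V] ->
  inversions T (U :|: V) = (inversions T U + inversions T V)%N.
Proof.
move=> d; rewrite /inversions -big_split /=; apply: eq_bigr => i _.
by rewrite -bigU //=; apply: eq_bigl => j; rewrite !inE.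
Qed.

Lemma inversionsC T U : [disjoint T & U] ->
  (inversions T U + inversions U T)%N = (#|T| * #|U|)%N.
Proof.
move=> d; rewrite /inversions [X in (_ + X)%N]exchange_big /= -big_split /=.
rewrite -sum_nat_const; apply: eq_bigr => i iT.
rewrite -big_split /= -sum1_card; apply: eq_bigr => j jU.
case: (ltngtP j i) => // /val_inj e.
by move/pred0P/(_ i): d; rewrite /= iT -e jU.
Qed.

Lemma gr_mulE f g S : gr_mul f g S =
  \sum_(T : {set 'I_s} | T \subset S)
    (-1) ^+ inversions T (S :\: T) * (f T * g (S :\: T)).
Proof. by rewrite ffunE. Qed.

Fact gr_mulA : associative gr_mul.
Proof.
move=> f g h; apply/ffunP => S; rewrite !gr_mulE.
transitivity (\sum_(T : {set 'I_s} | T \subset S)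
   \sum_(U : {set 'I_s} | U \subset S :\: T)
    (-1) ^+ (inversions T (S :\: T) + inversions U ((S :\: T) :\: U)) *
      (f T * g U * h ((S :\: T) :\: U))).
  apply: eq_bigr => T _; rewrite gr_mulE !mulr_sumr.
  by apply: eq_bigr => U _; rewrite exprD; ring.
transitivity (\sum_(T : {set 'I_s} | T \subset S)
   \sum_(W : {set 'I_s} | (W \subset S) && (T \subset W))
    (-1) ^+ (inversions W (S :\: W) + inversions T (W :\: T)) *
      (f T * g (W :\: T) * h (S :\: W))).
  apply: eq_bigr => T TS.
  rewrite [RHS](reindex_onto (fun U => T :|: U) (fun W => W :\: T)) /=; last first.
    by move=> W /andP[_ TW]; apply: setUD.
  apply: eq_big => U.
    rewrite subsetD subUset TS subsetUl andbT /=; congr (_ && _).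
    rewrite setDUl setDv set0U; apply/idP/eqP => [d|<-]; last first.
      by rewrite disjoints_subset setDE subsetIr.
    by apply/setDidPl.
  rewrite subsetD => /andP[US d].
  have -> : (T :|: U) :\: T = U by rewrite setDUl setDv set0U; apply/setDidPl.
  have -> : S :\: (T :|: U) = (S :\: T) :\: U by rewrite setDDl.
  congr ((-1) ^+ _ * _).
  have {1}-> : S :\: T = U :|: ((S :\: T) :\: U).
    by rewrite setUD // subsetD US.
  rewrite inversionsUr ?inversionsUl; first by rewrite -addnA addnC.
  - by rewrite disjoint_sym.
  - by rewrite disjoint_sym disjoints_subset setDE subsetIr.
rewrite (exchange_big_dep (fun W : {set 'I_s} => W \subset S)) /=; last first.
  by move=> T W _ /andP[].
apply: eq_bigr => W WS; rewrite gr_mulE mulr_suml mulr_sumr.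
apply: eq_big => [T|T /andP[_ TW]].
  by rewrite WS andTb; apply/andP/idP => [[]|TW] //; split=> //; apply: subset_trans TW WS.
by rewrite exprD; ring.
Qed.

Fact gr_mul1 : left_id (gr_const 1) gr_mul.
Proof.
move=> f; apply/ffunP => S; rewrite gr_mulE (bigD1 set0) ?sub0set //=.
rewrite big1 ?addr0; first by rewrite ffunE eqxx inversions0l setD0 !mul1r.
by move=> T /andP[_ /negbTE T0]; rewrite ffunE T0 mul0r mulr0.
Qed.
Fact gr_mulr1 : right_id (gr_const 1) gr_mul.
Proof.
move=> f; apply/ffunP => S; rewrite gr_mulE (bigD1 S) //=.
rewrite big1 ?addr0; first by rewrite ffunE setDv eqxx inversions0r mul1r mulr1.
move=> T /andP[TS nTS]; rewrite ffunE setD_eq0.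
case: ifP => [ST|_]; last by rewrite !mulr0.
by rewrite eqEsubset TS ST in nTS.
Qed.
Fact gr_mulDl : left_distributive gr_mul +%R.
Proof.
move=> f g h; apply/ffunP => S; rewrite gr_mulE [RHS]ffunE !gr_mulE -big_split.
by apply: eq_bigr => T _; rewrite ffunE /=; ring.
Qed.
Fact gr_mulDr : right_distributive gr_mul +%R.
Proof.
move=> f g h; apply/ffunP => S; rewrite gr_mulE [RHS]ffunE !gr_mulE -big_split.
by apply: eq_bigr => T _; rewrite ffunE /=; ring.
Qed.
HB.instance Definition _ := GRing.Zmodule_isPzRing.Build grass
  gr_mulA gr_mul1 gr_mulr1 gr_mulDl gr_mulDr.

Fact gr_const_zmod : zmod_morphism gr_const.
Proof.
by move=> a b; apply/ffunP => S; rewrite !ffunE; case: ifP; rewrite ?subr0.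
Qed.
Fact gr_const_monoid : monoid_morphism gr_const.
Proof.
split=> // a b; apply/ffunP => S; rewrite [RHS]gr_mulE ffunE.
rewrite (bigD1 set0) ?sub0set //= big1 ?addr0.
  by rewrite !ffunE eqxx inversions0l setD0 mul1r; case: ifP; rewrite ?mulr0.
by move=> T /andP[_ /negbTE T0]; rewrite ffunE T0 mul0r mulr0.
Qed.
HB.instance Definition _ :=
  GRing.isZmodMorphism.Build R grass gr_const gr_const_zmod.
HB.instance Definition _ :=
  GRing.isMonoidMorphism.Build R grass gr_const gr_const_monoid.

Definition gr_parity p f : Prop := forall S, f S != 0 -> odd #|S| = p.

Fact gr_parity_const c : gr_parity false (gr_const c).
Proof.
by move=> S; rewrite ffunE; case: (S =P set0) => [->|_]; rewrite ?cards0 ?eqxx.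
Qed.
Fact gr_parity0 p : gr_parity p 0.
Proof. by move=> S; rewrite ffunE eqxx. Qed.
Fact gr_parityD p f g : gr_parity p f -> gr_parity p g -> gr_parity p (f + g).
Proof.
move=> hf hg S; rewrite ffunE.
by have [->|/hf //] := eqVneq (f S) 0; rewrite add0r; apply: hg.
Qed.
Fact gr_parity_dec f : exists f0 f1,
  [/\ gr_parity false f0, gr_parity true f1 & f = f0 + f1].
Proof.
exists [ffun S : {set 'I_s} => if odd #|S| then 0 else f S].
exists [ffun S : {set 'I_s} => if odd #|S| then f S else 0].
split.
- by move=> S; rewrite ffunE; case: odd; rewrite ?eqxx.
- by move=> S; rewrite ffunE; case: odd; rewrite ?eqxx.
by apply/ffunP => S; rewrite !ffunE; case: odd; rewrite ?addr0 ?add0r.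
Qed.
Fact gr_parity_cap f : gr_parity false f -> gr_parity true f -> f = 0.
Proof.
move=> h0 h1; apply/ffunP => S; rewrite [RHS]ffunE; apply/eqP.
by apply: contraT => n0; rewrite -(h0 S n0) (h1 S n0).
Qed.
Fact gr_parityM p q f g :
  gr_parity p f -> gr_parity q g -> gr_parity (p (+) q) (f * g).
Proof.
move=> hf hg S; rewrite gr_mulE => n0.
have [T /and3P[TS fT gT]] :
    exists T, [&& T \subset S, f T != 0 & g (S :\: T) != 0].
  apply/existsP; apply: contraNT n0; rewrite negb_exists => /forallP h.
  rewrite big1 // => T TS; have := h T; rewrite TS /= negb_and !negbK.
  by case/orP => /eqP ->; rewrite ?mul0r !mulr0.
by rewrite -(hf _ fT) -(hg _ gT) -oddD -(cardsID T S) (setIidPr TS).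
Qed.
Fact gr_parityC p q f g : gr_parity p f -> gr_parity q g ->
  f * g = (-1) ^+ (p && q) * (g * f).
Proof.
move=> hf hg.
have e : f * g = [ffun S => (-1) ^+ (p && q) * (g * f : grass) S].
  apply/ffunP => S; rewrite [RHS]ffunE !gr_mulE.
  rewrite (reindex_onto (fun T => S :\: T) (fun T => S :\: T)) /=; last first.
    by move=> T TS; rewrite setDDr setDv set0U; apply/setIidPr.
  rewrite mulr_sumr; apply: eq_big => [T|T /andP[_ /eqP e]].
    rewrite subsetDl /=; apply/eqP/idP => [<-|TS]; first exact: subsetDl.
    by rewrite setDDr setDv set0U; apply/setIidPr.
  rewrite e; set U := S :\: T.
  have [->|fU] := eqVneq (f U) 0; first by rewrite mul0r !mulr0.
  have [->|gT] := eqVneq (g T) 0; first by rewrite mul0r !mulr0.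
  have d : [disjoint U & T] by rewrite disjoints_subset /U setDE subsetIr.
  have -> : (-1) ^+ (p && q) = (-1) ^+ (inversions U T + inversions T U) :> R.
    by rewrite (inversionsC d) -[RHS]signr_odd oddM (hf _ fU) (hg _ gT).
  rewrite exprD; set x := (-1) ^+ inversions U T; set y := (-1) ^+ inversions T U.
  have yy : y * y = 1 by rewrite -expr2 sqrr_sign.
  transitivity (x * (y * y) * (f U * g T)); last by ring.
  by rewrite yy mulr1.
rewrite e; apply/ffunP => S; rewrite [LHS]ffunE.
by case: (p && q); rewrite !(expr0, expr1) ?mul1r // !mulN1r [RHS]ffunE.
Qed.
End Grassmann.

Section SuperPowerSeries.
Variables (K : numFieldType) (r s : nat).

Definition super_powser : Type := grass (powser K r) s.
HB.instance Definition _ := GRing.PzRing.on super_powser.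

Definition sps_const (k : K) : super_powser := @gr_const (powser K r) s (@ps_const K r k).
HB.instance Definition _ := GRing.RMorphism.copy sps_const
  (@gr_const (powser K r) s \o @ps_const K r).

Fact sps_parity_const k : gr_parity false (sps_const k).
Proof. exact: gr_parity_const. Qed.

HB.instance Definition _ := isSuperAlgebra.Build K super_powser
  (sconst := sps_const) sps_parity_const (@gr_parity0 _ s)
  (@gr_parityD _ s) (@gr_parity_dec _ s) (@gr_parity_cap _ s)
  (@gr_parityM _ s) (@gr_parityC _ s).
End SuperPowerSeries.

Definition smooth (K : numFieldType) (A : superAlgType K) : Prop :=
  forall (B : superAlgType K) (J : superideal B), nilpotent_superideal J ->
  forall f : superHom A (squot J), exists g : superHom A B,
    forall a, squot_pi J (g a) = f a.

(* the inverse of a bijective morphism is again a morphism: it preserves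
   parity by the direct sum decomposition *)
Definition siso (K : numFieldType) (A B : superAlgType K) : Prop :=
  exists f : superHom A B, bijective f.

Definition fioresi_smooth (K : numFieldType) (A : superAlgType K) : Prop :=
  forall P : closed_point A, exists r s : nat,
    siso (completion (local_max P)) (super_powser K r s).

(* Main.v *)
(* Smooth implies Fioresi. Lift a homogeneous basis of P / P^2 to elements x, y
   of A. Evaluating power series at x, y maps S = C[[X]] tensor Lambda(Y) onto each
   A / P^n. To see that a series of order k with value 0 in A / P^(k+1) has
   order k + 1, use smoothness to lift A -> A / P^2 along
   S / (order >= k + 2) -> A / P^2: the lift sends x, y to X, Y up to order 2,
   so it preserves leading forms, and it sends P^(k+1) to order >= k + 1.

   Fioresi implies smooth. Write A = F / I with F = C[X] tensor Lambda(Y). By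
   square-zero lifting it is enough to find an even derivation D : F -> I / I^2
   that is the identity on I. Lifting the formal coordinates at a closed point M
   to F / M^n gives, for each n, such a D up to an error in M^n; Krull's
   intersection theorem for modules over C[X] turns these into a D that is
   multiplication by some s outside M on I. The s so obtained form an ideal of
   F_0, which lies in no maximal ideal. Residue fields are C because C is
   uncountable. *)
Require Import Defs.
From HB Require Import structures.
From mathcomp Require Import all_boot all_order all_algebra.
From mathcomp Require Import reals complex.
From mathcomp Require classical_sets.
From mathcomp Require Import boolp ssrcomplements mpoly zify lra.

Set Implicit Arguments.
Unset Strict Implicit.
Unset Printing Implicit Defensive.

Import Order.TTheory GRing.Theory Num.Theory.
Local Open Scope ring_scope.

(** * Homomorphisms and ideals of superalgebras *)

(** From smooth to Fioresi, smoothness lifts only along nilpotent kernels, so S is cut at order k +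
    2 and compared with A one order at a time. In the other direction the obstacle is that the lifts
    to F / M^n for different n are unrelated and give no derivation at M itself. What survives is
    linear. For generators f_1, ..., f_t of I, the tuples (D f_1, ..., D f_t), up to (I^2)^t, form a
    C[X]-submodule N of F^t, since even derivations can be added and multiplied by even elements.
    The lifts put (f_1, ..., f_t) in N + (M^n)^t for every n, and Krull's theorem gives a multiplier
    1 - a into N, with a in the ideal of C[X] generated by the X_i - c_i, hence in M. Here F is a
    free C[X]-module with basis the products Y_T, so that commutative algebra applies. Even elements
    of I are multipliers too, with D = 0; a maximal superideal that contains all multipliers
    therefore contains I and comes from a closed point of A, where formal coordinates exist. The
    residue field C supplies the c_i, and the constant terms of the power series. *)

Section SuperHoms.
Variable K : numFieldType.
Implicit Types A B C : superAlgType K.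

Lemma superhomC A B (f : superHom A B) k : f (sconst k) = sconst k.
Proof. exact: morph_sconst. Qed.

Lemma superhomP A B (f : superHom A B) p x : parity p x -> parity p (f x).
Proof. exact: morph_parity. Qed.

Lemma superhom_of A B (f : A -> B) :
    zmod_morphism f -> monoid_morphism f ->
    (forall k, f (sconst k) = sconst k) ->
    (forall p x, parity p x -> parity p (f x)) ->
  exists g : superHom A B, g =1 f.
Proof.
move=> fz fm fk fp.
pose fz' := GRing.isZmodMorphism.Build A B f fz.
pose fm' := GRing.isMonoidMorphism.Build A B f fm.
pose fs' := isSuperMorphism.Build K A B f fk fp.
pose g : superHom A B := HB.pack f fz' fm' fs'.
by exists g.
Qed.

Section Comp.
Variables (A B C : superAlgType K) (g : superHom B C) (f : superHom A B).
Fact comp_sconst k : (g \o f) (sconst k) = sconst k.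
Proof. by rewrite /= !morph_sconst. Qed.
Fact comp_parity p x : parity p x -> parity p ((g \o f) x).
Proof. by move=> hx /=; do 2!apply: superhomP. Qed.
HB.instance Definition _ :=
  isSuperMorphism.Build K A C (g \o f) comp_sconst comp_parity.
End Comp.

Section Id.
Variable A : superAlgType K.
Fact id_sconst k : @idfun A (sconst k) = sconst k. Proof. by []. Qed.
Fact id_parity p (x : A) : parity p x -> parity p (@idfun A x). Proof. by []. Qed.
HB.instance Definition _ := isSuperMorphism.Build K A A idfun id_sconst id_parity.
End Id.

Section Pi.
Variables (A : superAlgType K) (J : superideal A).
Fact squot_pi_zmod : zmod_morphism (squot_pi J).
Proof. by move=> x y; rewrite squot_piD squot_piN. Qed.
Fact squot_pi_monoid : monoid_morphism (squot_pi J).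
Proof. by split=> // x y; rewrite squot_piM. Qed.
Fact squot_pi_parity p x : parity p x -> parity p (squot_pi J x).
Proof. by move=> hx; exists x. Qed.
HB.instance Definition _ :=
  GRing.isZmodMorphism.Build A (squot J) (squot_pi J) squot_pi_zmod.
HB.instance Definition _ :=
  GRing.isMonoidMorphism.Build A (squot J) (squot_pi J) squot_pi_monoid.
HB.instance Definition _ := isSuperMorphism.Build K A (squot J) (squot_pi J)
  (fun=> erefl) squot_pi_parity.
Lemma squot_pi_surj (x : squot J) : exists a, squot_pi J a = x.
Proof. by exists (squot_repr x); rewrite squot_reprK. Qed.
Lemma squot_pi_eq0 a : squot_pi J a = 0 <-> J a.
Proof. by rewrite -(squot_pi0 J) squot_piP subr0. Qed.
End Pi.

Definition surj (T U : Type) (f : T -> U) := forall y, exists x, f x = y.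

(** The homogeneous components of any preimage map to those of [y], so the component of parity [p]
    is itself a preimage. *)
Lemma surj_parity A B (f : superHom A B) p y : surj f -> parity p y ->
  exists2 x, parity p x & f x = y.
Proof.
move=> sf hy; have [x ex] := sf y; have [x0 [x1 [h0 h1 e]]] := parity_dec x.
have ey : f x0 + f x1 = y by rewrite -rmorphD /= -e ex.
case: p hy => hy.
  have [_ e1] := parity_uniq (superhomP _ h0) (superhomP _ h1) (parity0 false) hy
    (etrans ey (esym (add0r y))).
  by exists x1.
have [e0 _] := parity_uniq (superhomP _ h0) (superhomP _ h1) hy (parity0 true)
  (etrans ey (esym (addr0 y))).
by exists x0.
Qed.

(** The chosen preimages [s] need be neither additive nor homogeneous; both defects lie in the
    kernel of [p] and disappear after [f]. *)
Lemma superhom_factor A B C (p : superHom A B) (f : superHom A C) :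
    surj p -> (forall u, p u = 0 -> f u = 0) ->
  exists g : superHom B C, forall u, g (p u) = f u.
Proof.
move=> sp kf.
pose s b := projT1 (cid (sp b)).
have sK b : p (s b) = b by rewrite /s; case: cid.
have e u v : p u = p v -> f u = f v.
  by move=> /eqP; rewrite -subr_eq0 -rmorphB => /eqP/kf/eqP;
     rewrite rmorphB subr_eq0 => /eqP.
have [||||g hg] := @superhom_of B C (f \o s).
- by move=> x y /=; rewrite -rmorphB; apply: e; rewrite rmorphB /= !sK.
- split=> [|x y] /=; first by rewrite -(rmorph1 f); apply: e; rewrite rmorph1 sK.
  by rewrite -rmorphM; apply: e; rewrite rmorphM /= !sK.
- by move=> k /=; rewrite -(superhomC f); apply: e; rewrite sK superhomC.
- move=> q x hx /=; have [u hu eu] := surj_parity sp hx.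
  by rewrite (e (s x) u) ?sK //; apply: superhomP.
by exists g => u; rewrite hg /=; apply: e; rewrite sK.
Qed.

Lemma superhom_inv A B (f : superHom A B) :
  bijective f -> exists g : superHom B A, cancel f g /\ cancel g f.
Proof.
move=> [h fK hK].
have [|u hu|g hg] := @superhom_factor A B A f idfun.
- by move=> b; exists (h b).
- by rewrite /= -[u]fK hu -(rmorph0 f) fK.
by exists g; split=> [a|b]; rewrite ?hg // -{1}(hK b) hg /= hK.
Qed.

Section Kernel.
Variables (A B : superAlgType K) (f : superHom A B).
Definition ker_mem (x : A) : Prop := f x = 0.
Fact ker0 : ker_mem 0. Proof. exact: rmorph0. Qed.
Fact kerD x y : ker_mem x -> ker_mem y -> ker_mem (x + y).
Proof. by rewrite /ker_mem rmorphD /= => -> ->; rewrite addr0. Qed.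
Fact kerMl a x : ker_mem x -> ker_mem (a * x).
Proof. by rewrite /ker_mem rmorphM /= => ->; rewrite mulr0. Qed.
Fact kerMr a x : ker_mem x -> ker_mem (x * a).
Proof. by rewrite /ker_mem rmorphM /= => ->; rewrite mul0r. Qed.
Fact ker_graded x : ker_mem x -> exists x0 x1,
  [/\ parity false x0, parity true x1, x = x0 + x1, ker_mem x0 & ker_mem x1].
Proof.
have [x0 [x1 [h0 h1 ->]]] := parity_dec x; rewrite /ker_mem rmorphD /= => e.
have [|e0 e1] := @parity_uniq _ _ (f x0) (f x1) 0 0 (superhomP _ h0)
  (superhomP _ h1) (parity0 _) (parity0 _); first by rewrite addr0.
by exists x0, x1.
Qed.
Definition si_ker : superideal A := SuperIdeal ker0 kerD kerMl kerMr ker_graded.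
End Kernel.

Section Exp.
Variables (A : superAlgType K).
Implicit Types I J : superideal A.

Lemma si_mul_sub I J I' J' : (forall x, I x -> I' x) -> (forall x, J x -> J' x) ->
  forall x, si_mul I J x -> si_mul I' J' x.
Proof.
move=> h h' x; elim=> [|a b y ha hb _ IH]; first exact: si0.
by apply: siD => //; apply: prod_span1; [apply: h|apply: h'].
Qed.

Lemma si_exp_sub I J n : (forall x, I x -> J x) ->
  forall x, si_exp I n x -> si_exp J n x.
Proof. by move=> h; elim: n => //= n IH; apply: si_mul_sub. Qed.

Lemma si_expM I m n x y : si_exp I m x -> si_exp I n y -> si_exp I (m + n) (x * y).
Proof.
elim: m x => [|m IH] x; first by move=> _; apply: siMl.
rewrite addSn => hx hy; elim: hx => [|a b z ha hb _ IHz].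
  by rewrite mul0r; apply: si0.
rewrite mulrDl -mulrA; apply: siD => //.
by apply: prod_span1 => //; apply: IH.
Qed.

Lemma si_exp_le I m n : (m <= n)%N -> forall x, si_exp I n x -> si_exp I m x.
Proof.
move=> /subnKC <-; elim: (n - m)%N => [|k IH] x; first by rewrite addn0.
by rewrite addnS => /si_expS; apply: IH.
Qed.

Lemma si_exp1 I x : si_exp I 1 x <-> I x.
Proof.
split=> [|hx]; last by rewrite -[x]mulr1; apply: prod_span1.
by elim=> [|a b z ha _ _ IH]; [apply: si0|apply: siD => //; apply: siMr].
Qed.
End Exp.

Lemma si_exp_map A B (f : superHom A B) (I : superideal A) (J : superideal B) n :
  (forall x, I x -> J (f x)) -> forall x, si_exp I n x -> si_exp J n (f x).
Proof.
move=> h; elim: n => //= n IH x; elim=> [|a b y ha hb _ IHy].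
  by rewrite rmorph0; apply: prod_span0.
by rewrite rmorphD rmorphM; constructor; [apply: h|apply: IH|].
Qed.

Lemma si_exp_surj A B (f : superHom A B) (I : superideal A) (J : superideal B) n :
  surj f -> (forall y, J y -> exists2 x, I x & f x = y) ->
  forall y, si_exp J n y -> exists2 x, si_exp I n x & f x = y.
Proof.
move=> sf h; elim: n => [|n IH] y; first by have [x <-] := sf y; exists x.
elim=> [|a b z ha hb _ [z' hz' <-]]; first by exists 0; [apply: si0|apply: rmorph0].
have [a' ha' <-] := h _ ha; have [b' hb' <-] := IH _ hb.
by exists (a' * b' + z'); rewrite ?rmorphD ?rmorphM //; constructor.
Qed.

(** Transports the definition of smoothness from literal quotients [squot J] to arbitrary
    surjections, by identifying the target with the quotient by the kernel. *)
Lemma smooth_lift A B C (p : superHom B C) (f : superHom A C) : smooth A ->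
    surj p -> nilpotent_superideal (si_ker p) ->
  exists g : superHom A B, forall a, p (g a) = f a.
Proof.
move=> sA sp np.
have [u /= hu|q hq] := @superhom_factor B C _ p (squot_pi (si_ker p) : superHom _ _) sp.
  exact/squot_pi_eq0.
have [g hg] := sA B _ np (q \o f : superHom _ _).
exists g => a; have /= := hg a; have [u <-] := sp (f a).
rewrite hq => /squot_piP; rewrite /= /ker_mem rmorphB => /eqP.
by rewrite subr_eq0 => /eqP.
Qed.

(** Lift successively along B/J^(k+2) -> B/J^(k+1); the kernel has square zero because 2(k+1) >=
    k+2. *)
Lemma smooth_of_square_zero A :
    (forall B C (p : superHom B C) (f : superHom A C), surj p ->
      (forall x y, p x = 0 -> p y = 0 -> x * y = 0) ->
      exists g : superHom A B, forall a, p (g a) = f a) ->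
  smooth A.
Proof.
move=> H B J [n nJ] f.
(* [J] and [si_exp J 1] have the same elements but give different quotient types; [i0] passes from
   one to the other. *)
have [u /= hu|i0 hi0] := @superhom_factor B (squot J) _ (squot_pi J : superHom _ _)
   (squot_pi (si_exp J 1) : superHom _ _) (@squot_pi_surj _ _).
  by apply/squot_pi_eq0/si_exp1/squot_pi_eq0.
(* Compatibility with [f] is stated on representatives [u] in [B], which spares the composite
   transition maps B/J^(k+1) -> B/J. *)
have lift k : exists g : superHom A (squot (si_exp J k.+1)), forall a u,
    g a = squot_pi _ u -> squot_pi J u = f a.
  elim: k => [|k [g hg]].
    exists (i0 \o f : superHom _ _) => a u /=; have [v <-] := squot_pi_surj (f a).
    by rewrite hi0 /= => /squot_piP/si_exp1 h; apply/esym/squot_piP.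
  have [u /= /squot_pi_eq0 hu|p hp] := @superhom_factor B _ _
    (squot_pi (si_exp J k.+2) : superHom _ _) (squot_pi (si_exp J k.+1) : superHom _ _)
    (@squot_pi_surj _ _).
    by apply/squot_pi_eq0; apply: (@si_expS _ _ J k.+1).
  have [||g' hg'] := H _ _ p g.
  - by move=> y; have [u <-] := squot_pi_surj y; exists (squot_pi _ u); rewrite hp.
  - move=> x y; have [u <-] := squot_pi_surj x; have [v <-] := squot_pi_surj y.
    rewrite !hp /= => /squot_pi_eq0 hu /squot_pi_eq0 hv.
    rewrite -squot_piM; apply/squot_pi_eq0.
    apply: (@si_exp_le _ J k.+2 (k.+1 + k.+1)); last exact: si_expM.
    by rewrite addnS !addSn !ltnS leq_addr.
  exists g' => a u e; apply: hg; rewrite -hg' e.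
  by rewrite (hp u).
have [g hg] := lift n.
have [u /= hu|q hq] := @superhom_factor B _ _ (squot_pi (si_exp J n.+1) : superHom _ _)
  (idfun : superHom B B) (@squot_pi_surj _ _).
  by apply: nJ; apply: (@si_expS _ _ J n); apply/squot_pi_eq0.
exists (q \o g : superHom _ _) => a /=; apply: hg.
by have [u <-] := squot_pi_surj (g a); rewrite hq.
Qed.

End SuperHoms.

(** * Ordered products of odd elements and maps out of exterior algebras *)

Section OrderedProduct.
Variables (K : numFieldType) (B : superAlgType K) (s : nat) (c : 'I_s -> B).
Hypothesis c_odd : forall i, parity true (c i).
Implicit Types (T U : {set 'I_s}) (l : seq 'I_s).

Lemma parity_prod (I : Type) (l : seq I) (P : pred I) (F : I -> B) :
  (forall i, P i -> parity false (F i)) ->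
  parity false (\prod_(i <- l | P i) F i).
Proof.
move=> h; elim/big_ind: _ => //; first exact: parity1.
by move=> x y hx hy; apply: (parityM hx hy).
Qed.

Lemma parity_sum (I : Type) (l : seq I) (P : pred I) (F : I -> B) p :
  (forall i, P i -> parity p (F i)) -> parity p (\sum_(i <- l | P i) F i).
Proof.
move=> h; elim/big_ind: _ => //; first exact: parity0.
by move=> x y hx hy; apply: parityD.
Qed.

Definition oprod T : B := \prod_(i <- enum 'I_s | i \in T) c i.

Lemma oprod_seq_parity l T :
  parity (odd (count (mem T) l)) (\prod_(i <- l | i \in T) c i).
Proof.
elim: l => [|x l IH]; first by rewrite big_nil; apply: parity1.
rewrite big_cons /=; case: (x \in T) => //=.
exact: (parityM (c_odd x) IH).
Qed.

Lemma oprod_parity T : parity (odd #|T|) (oprod T).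
Proof.
have := oprod_seq_parity (enum 'I_s) T.
suff -> : count (mem T) (enum 'I_s) = #|T| by [].
by rewrite cardE -size_filter; congr size; rewrite enumT.
Qed.

(** Moving the head of the second product across the tail of the first costs one sign per factor,
    and these are the new inversions because the head is the least index of the list. A repeated
    factor squares to zero. *)
Lemma oprod_seqM l T U : sorted (fun i j : 'I_s => (i < j)%N) l ->
  (\prod_(i <- l | i \in T) c i) * (\prod_(i <- l | i \in U) c i) =
  if has (mem (T :&: U)) l then 0 else
    (-1) ^+ (\sum_(i <- l | i \in T) \sum_(j <- l | j \in U) (j < i))%N *
    \prod_(i <- l | i \in T :|: U) c i.
Proof.
elim: l => [|x l IH] /=; first by move=> _; rewrite !big_nil mul1r.
rewrite path_sortedE; last by move=> j i k; apply: ltn_trans.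
move=> /andP[/allP xl sl]; rewrite !big_cons !inE.
set PT := \prod_(i <- l | _) _ in IH *.
set PU := \prod_(i <- l | _ \in U) _ in IH *.
have e0 : (\sum_(j <- l | j \in U) (j < x) = 0)%N.
  rewrite big_seq_cond big1 // => j /andP[/xl xj _].
  by rewrite ltnNge (ltnW xj).
have e1 : (\sum_(i <- l | i \in T) \sum_(j <- x :: l | j \in U) (j < i) =
    (x \in U) * count (mem T) l +
    \sum_(i <- l | i \in T) \sum_(j <- l | j \in U) (j < i))%N.
  rewrite -sum1_count big_distrr /= -big_split /=.
  rewrite big_seq_cond [RHS]big_seq_cond; apply: eq_bigr => i /andP[/xl xi _].
  by rewrite big_cons xi; case: (x \in U).
have sC n (y z : B) : y * ((-1) ^+ n * z) = (-1) ^+ n * (y * z).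
  by rewrite mulrA (commr_sign y n) -mulrA.
have cT y z : parity true y ->
    PT * (y * z) = (-1) ^+ count (mem T) l * (y * (PT * z)).
  move=> hy; rewrite mulrA (parityC (oprod_seq_parity l T) hy) andbT signr_odd.
  by rewrite -!mulrA.
rewrite ltnn e0 e1; have {}IH := IH sl.
case xT: (x \in T); case xU: (x \in U) => /=.
- by rewrite -mulrA cT // sC [c x * (c x * _)]mulrA odd_sqr0 // mul0r mulr0.
- rewrite add0n -mulrA IH; case: ifP => _; rewrite ?mulr0 //.
- rewrite cT // IH mul1n; case: ifP => _; rewrite ?mulr0 // sC mulrA.
  by rewrite exprD.
- by rewrite IH mul0n add0n.
Qed.

Lemma oprodM T U : oprod T * oprod U =
  if [disjoint T & U] then (-1) ^+ inversions T U * oprod (T :|: U) else 0.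
Proof.
have sl : sorted (fun i j : 'I_s => (i < j)%N) (enum 'I_s).
  by have := iota_ltn_sorted 0 s; rewrite -val_enum_ord sorted_map.
rewrite /oprod oprod_seqM //.
have -> : has (mem (T :&: U)) (enum 'I_s) = ~~ [disjoint T & U].
  rewrite -setI_eq0; apply/hasP/set0Pn => [[x _ hx]|[x hx]]; exists x => //.
  by rewrite mem_enum.
case: [disjoint T & U] => //=; congr ((-1) ^+ _ * _).
rewrite /inversions big_enum_cond /=; apply: eq_bigr => i _.
by rewrite big_enum_cond.
Qed.

Lemma oprod0 : oprod set0 = 1.
Proof. by rewrite /oprod big1 // => i; rewrite inE. Qed.

Lemma oprod1 i : oprod [set i] = c i.
Proof.
rewrite /oprod (eq_bigl (pred1 i)); last by move=> j; rewrite inE.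
by rewrite -big_filter filter_pred1_uniq ?enum_uniq ?mem_enum // big_seq1.
Qed.

Section GrassmannEval.
Variables (R0 : comNzRingType) (e : {rmorphism R0 -> B}).
Hypothesis e_even : forall x, parity false (e x).

(** The universal map out of the exterior algebra: it extends [e] and sends Y_i to [c i]. *)
Definition gr_eval (f : grass R0 s) : B := \sum_T e (f T) * oprod T.

Fact gr_eval_zmod : zmod_morphism gr_eval.
Proof.
move=> f g; rewrite /gr_eval -sumrB; apply: eq_bigr => T _.
have -> : (f - g) T = f T - g T by rewrite !ffunE.
by rewrite rmorphB mulrBl.
Qed.

Lemma gr_eval_const x : gr_eval (gr_const s x) = e x.
Proof.
rewrite /gr_eval (bigD1 set0) //= big1 ?addr0.
  by rewrite ffunE eqxx oprod0 mulr1.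
by move=> T /negbTE T0; rewrite ffunE T0 rmorph0 mul0r.
Qed.

Fact gr_eval_monoid : monoid_morphism gr_eval.
Proof.
split=> [|f g]; first by rewrite -[1]/(gr_const s 1) gr_eval_const rmorph1.
have sC n (y z : B) : y * ((-1) ^+ n * z) = (-1) ^+ n * (y * z).
  by rewrite mulrA (commr_sign y n) -mulrA.
have se n : e ((-1) ^+ n) = (-1) ^+ n by rewrite rmorphXn /= rmorphN1.
(* Both sides become this sum over disjoint pairs: on the left through S = T u U, on the right
   because [oprodM] kills the other pairs. *)
transitivity (\sum_(T : {set 'I_s}) \sum_(U : {set 'I_s} | [disjoint T & U])
    (-1) ^+ inversions T U * (e (f T * g U) * oprod (T :|: U))).
  transitivity (\sum_(S : {set 'I_s}) \sum_(T : {set 'I_s} | T \subset S)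
    (-1) ^+ inversions T (S :\: T) * (e (f T * g (S :\: T)) * oprod S)).
    apply: eq_bigr => S _; rewrite -[(f * g) S]/(gr_mul f g S) gr_mulE rmorph_sum.
    rewrite mulr_suml; apply: eq_bigr => T _.
    by rewrite (rmorphM e ((-1) ^+ _)) /= se mulrA.
  rewrite (exchange_big_dep xpredT) //=; apply: eq_bigr => T _.
  rewrite (reindex_onto (fun U => T :|: U) (fun S => S :\: T)) /=; last first.
    by move=> S TS; apply: setUD.
  apply: eq_big => U; last first.
    by move=> /andP[_ /eqP ->].
  rewrite subsetUl /= setDUl setDv set0U disjoint_sym.
  exact: (sameP eqP setDidPl).
rewrite /gr_eval big_distrlr /=; apply: eq_bigr => T _.
rewrite big_mkcond /=; apply: eq_bigr => U _.
rewrite -mulrA [oprod T * _]mulrA -(evenC _ (e_even _)) -mulrA oprodM.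
case: ifP => _; last by rewrite !mulr0.
by rewrite !sC rmorphM mulrA.
Qed.

Lemma gr_eval_parity p f : gr_parity p f -> parity p (gr_eval f).
Proof.
move=> hf; apply: parity_sum => T _.
have [->|/hf <-] := eqVneq (f T) 0; first by rewrite rmorph0 mul0r; apply: parity0.
exact: (parityM (e_even _) (oprod_parity _)).
Qed.

End GrassmannEval.
End OrderedProduct.

(** * Free superalgebras *)

Section MpolyEval.
Variables (K : numFieldType) (B : superAlgType K) (r : nat) (b : 'I_r -> B).
Hypothesis b_even : forall i, parity false (b i).
Implicit Types (m : 'X_{1..r}) (p : {mpoly K[r]}).

Definition mon m : B := \prod_(i < r) b i ^+ m i.

Lemma parityX (x : B) n : parity false x -> parity false (x ^+ n).
Proof.
move=> hx; elim: n => [|n IH]; first exact: parity1.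
by rewrite exprS; apply: (parityM hx IH).
Qed.

Lemma mon_even m : parity false (mon m).
Proof. by apply: parity_prod => i _; apply: parityX. Qed.

Lemma mon0 : mon 0%MM = 1.
Proof. by rewrite /mon big1 // => i _; rewrite mnm0E expr0. Qed.

Lemma monD m m' : mon (m + m') = mon m * mon m'.
Proof.
rewrite /mon; elim/big_rec3: _ => [|i x y z _ ->]; first by rewrite mulr1.
rewrite mnmDE exprD -!mulrA; congr (_ * _).
by rewrite mulrA (evenC y (parityX (m' i) (b_even i))) -mulrA.
Qed.

Lemma mon1 i : mon U_(i) = b i.
Proof.
rewrite /mon (eq_bigr (fun j => if i == j then b j else 1)) => [|j _].
  by rewrite -big_mkcond /= (big_pred1 i).
by rewrite mnm1E; case: eqP; rewrite ?expr1 ?expr0.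
Qed.

Definition mp_eval p : B := \sum_(m <- msupp p) sconst p@_m * mon m.

(** A common degree bound lets polynomials with different supports be summed over one index set. *)
Lemma mp_evalE p i : (msize p <= i)%N ->
  mp_eval p = \sum_(m : 'X_{1..r < i}) sconst p@_m * mon m.
Proof.
move=> le_pi; set I : subFinType _ := 'X_{1..r < i}.
rewrite /mp_eval (big_mksub I) ?msupp_uniq //=; first last.
  by move=> x /msize_mdeg_lt /leq_trans; apply.
rewrite big_rmcond //= => j /memN_msupp_eq0 ->.
by rewrite rmorph0 mul0r.
Qed.

Fact mp_eval_zmod : zmod_morphism mp_eval.
Proof.
move=> p q; pose i := maxn (msize p) (maxn (msize q) (msize (p - q))).
rewrite !(@mp_evalE _ i) ?leq_max ?leqnn ?orbT // -sumrB.
by apply: eq_bigr => m _; rewrite mcoeffB rmorphB mulrBl.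
Qed.
HB.instance Definition _ :=
  GRing.isZmodMorphism.Build {mpoly K[r]} B mp_eval mp_eval_zmod.

Lemma mp_evalZX k m : mp_eval (k *: 'X_[m]) = sconst k * mon m.
Proof.
have [->|k0] := eqVneq k 0; first by rewrite scale0r !raddf0 mul0r.
rewrite /mp_eval (msuppMCX _ k0) big_seq1 mcoeffZ mcoeffX eqxx.
by rewrite mulr1.
Qed.

Lemma mp_evalC k : mp_eval k%:MP = sconst k.
Proof. by rewrite -[k%:MP]mulr1 -mpolyX0 mul_mpolyC mp_evalZX mon0 mulr1. Qed.

Lemma mp_evalX i : mp_eval 'X_i = b i.
Proof. by rewrite -['X_i]scale1r mp_evalZX rmorph1 mul1r mon1. Qed.

Fact mp_eval_monoid : monoid_morphism mp_eval.
Proof.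
split=> [|p q]; first by rewrite -mpolyC1 mp_evalC rmorph1.
rewrite [p in LHS]mpolyE [q in LHS]mpolyE big_distrlr /= raddf_sum.
rewrite [in RHS]/mp_eval big_distrlr /=; apply: eq_bigr => m _.
rewrite raddf_sum; apply: eq_bigr => m' _ /=.
rewrite -scalerAl -scalerAr scalerA -mpolyXD mp_evalZX rmorphM monD -!mulrA.
congr (_ * _); rewrite mulrA [RHS]mulrA; congr (_ * _).
by apply: evenC; apply: parity_sconst.
Qed.
Lemma mp_eval_even p : parity false (mp_eval p).
Proof.
apply: parity_sum => m _.
exact: (parityM (parity_sconst _) (mon_even _)).
Qed.

End MpolyEval.

(** * The monomial basis of an exterior algebra *)

Section GrassDelta.
Variables (R0 : comNzRingType) (s : nat).
Implicit Types (T U : {set 'I_s}) (f : grass R0 s).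

(** The basis element Y_T. *)
Definition gdelta T : grass R0 s := [ffun S : {set 'I_s} => (S == T)%:R].

Lemma gdelta0 : gdelta set0 = 1.
Proof.
apply/ffunP => S; rewrite -[1]/(gr_const s 1) !ffunE.
by case: eqP.
Qed.

Lemma gr_constM x f S : (gr_const s x * f) S = x * f S.
Proof.
rewrite -[LHS]/(gr_mul _ _ S) gr_mulE (bigD1 set0) ?sub0set //= big1.
  by rewrite ffunE eqxx inversions0l mul1r setD0 addr0.
by move=> T /andP[_ /negbTE T0]; rewrite ffunE T0 mul0r mulr0.
Qed.

Lemma gdeltaM T U : [disjoint T & U] -> 
  gdelta T * gdelta U = gr_const s ((-1) ^+ inversions T U) * gdelta (T :|: U).
Proof.
move=> d; apply/ffunP => S; rewrite gr_constM -[LHS]/(gr_mul _ _ S) gr_mulE.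
rewrite big_mkcond (bigD1 T) //= big1 ?addr0 => [|V /negbTE VT]; last first.
  by rewrite !ffunE VT mul0r mulr0 if_same.
rewrite !ffunE eqxx mul1r; have [->|n] := eqVneq S (T :|: U).
  rewrite subsetUl; suff -> : (T :|: U) :\: T = U by rewrite eqxx.
  by rewrite setDUl setDv set0U; apply/setDidPl; rewrite disjoint_sym.
rewrite mulr0; case: ifP => // TS.
case: eqP => e; last by rewrite mulr0.
by rewrite -e setUD ?eqxx // in n.
Qed.

Lemma gdelta_set1M (i : 'I_s) U : (forall j, j \in U -> (i < j)%N) ->
  gdelta (i |: U) = gdelta [set i] * gdelta U.
Proof.
move=> h; rewrite gdeltaM; last first.
  by rewrite disjoints1; apply/negP => /h; rewrite ltnn.
suff -> : inversions [set i] U = 0%N by rewrite expr0 mul1r.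
rewrite /inversions big_set1 big1 // => j jU.
by rewrite ltnNge ltnW // h.
Qed.

(** Splitting off the least index creates no inversion, so by [gdelta_set1M] the induction step
    multiplies by Y_i without a sign. *)
Lemma gdelta_ind (P : {set 'I_s} -> Prop) : P set0 ->
  (forall (i : 'I_s) U, (forall j, j \in U -> (i < j)%N) -> P U -> P (i |: U)) ->
  forall T, P T.
Proof.
move=> P0 PS T; have [n] := ubnP #|T|; elim: n T => // n IH T.
have [->//|/set0Pn [i0 i0T]] := eqVneq T set0.
rewrite ltnS => leT; case: (arg_minnP (@nat_of_ord s) i0T) => i; move=> iT' mini; have iT : i \in T := iT'.
rewrite -(setD1K iT); apply: PS => [j|].
  rewrite !inE => /andP[ji jT]; rewrite ltn_neqAle mini // andbT.
  by apply: contraNneq ji => /val_inj ->.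
by apply: IH; apply: leq_trans leT; rewrite [in X in (_ < X)%N](cardsD1 i) iT.
Qed.

Lemma grassE f : f = \sum_(T : {set 'I_s}) gr_const s (f T) * gdelta T.
Proof.
apply/ffunP => S; rewrite sum_ffunE (bigD1 S) //= big1 ?addr0 => [|T TS].
  by rewrite gr_constM ffunE eqxx mulr1.
by rewrite gr_constM ffunE eq_sym (negbTE TS) mulr0.
Qed.

Lemma gdelta_parity T : gr_parity (odd #|T|) (gdelta T).
Proof. by move=> S; rewrite ffunE; case: (S =P T) => [->|]; rewrite ?eqxx. Qed.

End GrassDelta.

Section FreeSuperalgebra.
Variables (K : numFieldType) (r s : nat).

Definition spoly : Type := grass {mpoly K[r]} s.
HB.instance Definition _ := GRing.PzRing.on spoly.

Definition spoly_const (k : K) : spoly := @gr_const {mpoly K[r]} s (@mpolyC r K k).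
HB.instance Definition _ := GRing.RMorphism.copy spoly_const
  (@gr_const {mpoly K[r]} s \o @mpolyC r K).

Fact spoly_parity_const k : gr_parity false (spoly_const k).
Proof. exact: gr_parity_const. Qed.

HB.instance Definition _ := isSuperAlgebra.Build K spoly
  (sconst := spoly_const) spoly_parity_const (@gr_parity0 _ s)
  (@gr_parityD _ s) (@gr_parity_dec _ s) (@gr_parity_cap _ s)
  (@gr_parityM _ s) (@gr_parityC _ s).

Definition spX (i : 'I_r) : spoly := gr_const s 'X_i.
Definition spY (j : 'I_s) : spoly := gdelta _ [set j].

Lemma spX_even i : parity false (spX i).
Proof. exact: gr_parity_const. Qed.

Lemma spY_odd j : parity true (spY j).
Proof. by have := @gdelta_parity {mpoly K[r]} s [set j]; rewrite cards1. Qed.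

(** The explicit formula is part of the conclusion because truncated evaluation and the comparison
    of leading forms compute with it. *)
Lemma spoly_hom (B : superAlgType K) (b : 'I_r -> B) (c : 'I_s -> B) :
    (forall i, parity false (b i)) -> (forall j, parity true (c j)) ->
  exists g : superHom spoly B,
    [/\ forall i, g (spX i) = b i, forall j, g (spY j) = c j &
        forall f, g f = \sum_T mp_eval b (f T) * oprod c T].
Proof.
move=> hb hc.
pose em := GRing.isMonoidMorphism.Build _ _ (mp_eval b) (mp_eval_monoid hb).
pose e : {rmorphism {mpoly K[r]} -> B} := HB.pack (mp_eval b) em.
have e_even x : parity false (e x) by apply: mp_eval_even.
have [||||g hg] := @superhom_of K spoly B (gr_eval c e).
- exact: gr_eval_zmod.
- exact: (gr_eval_monoid hc e_even).
- by move=> k; rewrite (gr_eval_const c e) /=; apply: mp_evalC.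
- exact: (gr_eval_parity hc e_even).
exists g; split=> [i|j|f]; rewrite hg //.
  by rewrite (gr_eval_const c e) /=; apply: mp_evalX.
rewrite /gr_eval (bigD1 [set j]) //= big1 ?addr0 => [|T /negbTE Tj].
  have -> : spY j [set j] = 1 by rewrite ffunE eqxx.
  by rewrite (mp_eval_monoid hb).1 oprod1 mul1r.
have -> : spY j T = 0 by rewrite ffunE Tj.
by rewrite raddf0 mul0r.
Qed.

Lemma spoly_gen (S : spoly -> Prop) : subalgebra S ->
  (forall i, S (spX i)) -> (forall j, S (spY j)) -> forall f, S f.
Proof.
move=> [SC SD SM] SX SY f; rewrite [f]grassE.
have S0 : S 0 by rewrite -(rmorph0 (@sconst K spoly)).
have S1 : S 1 by rewrite -(rmorph1 (@sconst K spoly)).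
elim/big_ind: _ => // T _; apply: (SM); last first.
  elim/gdelta_ind: T => [|i U h IH]; first by rewrite gdelta0.
  by rewrite gdelta_set1M //; apply: (SM) => //; apply: SY.
rewrite [f T]mpolyE rmorph_sum; elim/big_ind: _ => // m _ /=.
rewrite -mul_mpolyC rmorphM; apply: (SM); first exact: (SC).
rewrite mpolyXE_id rmorph_prod /=; elim/big_ind: _ => // i _.
by rewrite rmorphXn; elim: (m i) => [|n IH] //; rewrite exprS; apply: (SM) (SX i) IH.
Qed.

Lemma spoly_hom_uniq (B : superAlgType K) (u v : superHom spoly B) :
  (forall i, u (spX i) = v (spX i)) -> (forall j, u (spY j) = v (spY j)) ->
  u =1 v.
Proof.
move=> eX eY; apply: spoly_gen => //; split=> [k|x y ex ey|x y ex ey].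
- by rewrite !superhomC.
- by rewrite !rmorphD /= ex ey.
- by rewrite !rmorphM /= ex ey.
Qed.

End FreeSuperalgebra.

(** * Super power series *)

Section GrassMap.
Variables (R1 R2 : comNzRingType) (s : nat) (phi : {rmorphism R1 -> R2}).
Definition gr_map (f : grass R1 s) : grass R2 s := [ffun T => phi (f T)].
Fact gr_map_zmod : zmod_morphism gr_map.
Proof. by move=> f g; apply/ffunP => T; rewrite !ffunE rmorphB. Qed.
Fact gr_map_monoid : monoid_morphism gr_map.
Proof.
split=> [|f g]; apply/ffunP => S.
  rewrite !ffunE; case: ifP => _; [exact: rmorph1|exact: rmorph0].
rewrite -[RHS]/(gr_mul _ _ S) ffunE -[X in phi X]/(gr_mul f g S) !gr_mulE.
rewrite rmorph_sum; apply: eq_bigr => T _ /=.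
by rewrite rmorphM rmorphXn /= rmorphN1 rmorphM !ffunE.
Qed.
End GrassMap.

Section PowerSeries.
Variables (K : numFieldType) (r : nat).
Implicit Types (f g : powser K r) (m : 'X_{1..r}).

Lemma psBE f g m : (f - g) m = f m - g m. Proof. by []. Qed.
Lemma ps0E m : (0 : powser K r) m = 0.
Proof. by rewrite -[LHS]/(@ps_const K r 0 m) /ps_const if_same. Qed.
Lemma ps1E m : (1 : powser K r) m = (m == 0%MM)%:R.
Proof. by rewrite -[LHS]/(@ps_const K r 1 m) /ps_const; case: eqP. Qed.
Lemma ps_sumE (I : Type) (l : seq I) (P : pred I) (F : I -> powser K r) m :
  (\sum_(i <- l | P i) F i) m = \sum_(i <- l | P i) F i m.
Proof.
elim/big_rec2: _ => [|i x y _ <-]; first exact: ps0E.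
by rewrite psDE.
Qed.
Lemma ps_signM n f m : ((-1) ^+ n * f) m = (-1) ^+ n * f m.
Proof. by rewrite -!(signr_odd _ n); case: odd; rewrite ?expr0 ?mul1r // expr1 !mulN1r. Qed.

Lemma psME f g m N : (mdeg m < N)%N ->
  (f * g) m = (ps_trunc N f * ps_trunc N g)@_m.
Proof. exact: ps_mulE. Qed.

Lemma psM_low a b f g : (forall m, (mdeg m < a)%N -> f m = 0) ->
  (forall m, (mdeg m < b)%N -> g m = 0) ->
  forall m, (mdeg m < a + b)%N -> (f * g) m = 0.
Proof.
move=> hf hg m lt; rewrite -[LHS]/(ps_mul f g m) /ps_mul.
apply: big1 => k /eqP e; have ed := congr1 (@mdeg r) e.
rewrite ed mdegD in lt.
have [h|h] := ltnP (mdeg k.1) a; first by rewrite hf ?mul0r.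
rewrite [g _]hg ?mulr0 // -(ltn_add2l (mdeg k.1)) (leq_trans lt) //.
by rewrite leq_add2r.
Qed.

Lemma ps_constM c g m : (@ps_const K r c * g) m = c * g m.
Proof.
rewrite (psME _ _ (ltnSn _)).
transitivity ((c%:MP_[r] * ps_trunc (mdeg m).+1 g)@_m).
  apply: mcoeffM_eq => // k le; rewrite ps_truncE // mcoeffC /ps_const.
  by case: eqP; rewrite ?mulr1 ?mulr0.
by rewrite mcoeffCM ps_truncE.
Qed.

Definition mp2ps (p : {mpoly K[r]}) : powser K r := fun m => p@_m.
Fact mp2ps_zmod : zmod_morphism mp2ps.
Proof. by move=> p q; apply: funext => m; rewrite psBE /mp2ps mcoeffB. Qed.
Fact mp2ps_monoid : monoid_morphism mp2ps.
Proof.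
split=> [|p q]; apply: funext => m; first by rewrite ps1E /mp2ps mcoeff1.
rewrite (psME _ _ (ltnSn _)); apply: mcoeffM_eq => k le; by rewrite ps_truncE.
Qed.
HB.instance Definition _ :=
  GRing.isZmodMorphism.Build {mpoly K[r]} (powser K r) mp2ps mp2ps_zmod.
HB.instance Definition _ :=
  GRing.isMonoidMorphism.Build {mpoly K[r]} (powser K r) mp2ps mp2ps_monoid.

Definition psX i : powser K r := mp2ps 'X_i.

Lemma psXM i f m : (psX i * f) m = if (0 < m i)%N then f (m - U_(i))%MM else 0.
Proof.
rewrite (psME _ _ (ltnSn _)).
transitivity ((ps_trunc (mdeg m).+1 f * 'X_i)@_m).
  by rewrite mulrC; apply: mcoeffM_eq => k le; rewrite // ps_truncE.
case: ifP => [mi|mi].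
  have le : (U_(i) <= m)%MM.
    by apply/mnm_lepP => j; rewrite mnm1E; case: eqP => // <-.
  rewrite -[in LHS](submK le) addmC mcoeffMX ps_truncE // ltnS.
  by rewrite mdegD leq_addl.
apply/eqP; rewrite mcoeff_eq0 (perm_mem (msuppMX _ _)).
apply/mapP => -[k _ e]; move: mi; rewrite e mnmDE mnm1E eqxx.
by rewrite ltn_addr.
Qed.

(** Each monomial other than 1 is charged to one chosen variable dividing it; [g i] collects,
    divided by X_i, the monomials charged to X_i. No coefficient is used twice, so the order drops
    by at most one. *)
Lemma ps_ord_sum f : f 0%MM = 0 -> exists g : 'I_r -> powser K r,
  f = \sum_i psX i * g i /\
  forall n, (forall m, (mdeg m < n.+1)%N -> f m = 0) ->
    forall i m, (mdeg m < n)%N -> g i m = 0.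
Proof.
move=> f0; pose lead m := [pick i | (0 < m i)%N].
pose g i : powser K r := fun m =>
  if lead (m + U_(i))%MM == Some i then f (m + U_(i))%MM else 0.
exists g; split.
  apply: funext => m; rewrite ps_sumE.
  case em: (lead m) => [i|].
    have mi : (0 < m i)%N by move: em; rewrite /lead; case: pickP => // j hj [<-].
    rewrite (bigD1 i) //= big1 ?addr0 => [|j ji].
      rewrite psXM mi /g submK ?em ?eqxx //.
      by apply/mnm_lepP => k; rewrite mnm1E; case: eqP => // <-.
    rewrite psXM; case: ifP => // mj; rewrite /g submK ?em.
      by case: eqP => // -[e]; rewrite e eqxx in ji.
    by apply/mnm_lepP => k; rewrite mnm1E; case: eqP => // <-.
  have m0 i : m i = 0%N.
    by move: em; rewrite /lead; case: pickP => // /(_ i); rewrite lt0n; case: eqP.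
  have -> : m = 0%MM by apply/mnmP => i; rewrite m0 mnm0E.
  by rewrite f0 big1 // => i _; rewrite psXM mnm0E.
move=> n h i m lt; rewrite /g; case: ifP => // _.
by apply: h; rewrite mdegD mdeg1 addn1 ltnS.
Qed.

End PowerSeries.

Section SuperPowerSeries.
Variables (K : numFieldType) (r s : nat).
Local Notation SS := (super_powser K r s).
Implicit Types (f g : SS) (m : 'X_{1..r}) (T U : {set 'I_s}).

Lemma spsBE f g T m : (f - g) T m = f T m - g T m.
Proof. by rewrite !ffunE. Qed.
Lemma spsDE f g T m : (f + g) T m = f T m + g T m.
Proof. by rewrite !ffunE. Qed.
Lemma sps0E T m : (0 : SS) T m = 0.
Proof. by rewrite ffunE ps0E. Qed.

(** The order for the grading in which all X_i and all Y_j have degree 1. *)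
Definition ord_ge n f : Prop := forall T m, (mdeg m + #|T| < n)%N -> f T m = 0.

Lemma ord_geM a b f g : ord_ge a f -> ord_ge b g -> ord_ge (a + b) (f * g).
Proof.
move=> hf hg S m lt; rewrite -[_ S]/(gr_mul f g S) gr_mulE ps_sumE.
apply: big1 => T TS; rewrite ps_signM; apply/eqP; rewrite mulf_eq0; apply/orP; right.
have eS : #|S| = (#|T| + #|S :\: T|)%N by rewrite -(cardsID T S) (setIidPr TS).
apply/eqP; apply: (@psM_low _ _ (a - #|T|) (b - #|S :\: T|)) => [k|k|].
- by rewrite ltn_subRL addnC; apply: hf.
- by rewrite ltn_subRL addnC; apply: hg.
rewrite eS in lt.
lia.
Qed.

Fact ord_ge0 n : ord_ge n 0.
Proof. by move=> T m _; rewrite sps0E. Qed.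
Fact ord_geD n f g : ord_ge n f -> ord_ge n g -> ord_ge n (f + g).
Proof. by move=> hf hg T m lt; rewrite spsDE hf // hg // addr0. Qed.
Fact ord_geMl n g f : ord_ge n f -> ord_ge n (g * f).
Proof. by apply: (@ord_geM 0) => T m. Qed.
Fact ord_geMr n g f : ord_ge n f -> ord_ge n (f * g).
Proof. by move=> hf; rewrite -[n]addn0; apply: ord_geM hf _ => T m. Qed.
Fact ord_ge_graded n f : ord_ge n f -> exists f0 f1,
  [/\ parity false f0, parity true f1, f = f0 + f1, ord_ge n f0 & ord_ge n f1].
Proof.
move=> hf.
exists ([ffun S : {set 'I_s} => if odd #|S| then 0 else f S] : SS).
exists ([ffun S : {set 'I_s} => if odd #|S| then f S else 0] : SS).
split.
- by move=> S; rewrite ffunE; case: odd; rewrite ?eqxx.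
- by move=> S; rewrite ffunE; case: odd; rewrite ?eqxx.
- by apply/ffunP => S; rewrite !ffunE; case: odd; rewrite ?addr0 ?add0r.
- by move=> S m lt; rewrite ffunE; case: odd; rewrite ?ps0E ?hf.
- by move=> S m lt; rewrite ffunE; case: odd; rewrite ?ps0E ?hf.
Qed.

Definition ord_ideal n : superideal SS :=
  SuperIdeal (@ord_ge0 n) (@ord_geD n) (@ord_geMl n) (@ord_geMr n) (@ord_ge_graded n).

Lemma ord_geW n n' f : (n' <= n)%N -> ord_ge n f -> ord_ge n' f.
Proof. by move=> le hf T m lt; apply: hf; apply: leq_trans lt le. Qed.

Lemma ord_ge_exp n f : si_exp (ord_ideal 1) n f -> ord_ge n f.
Proof.
elim: n f => [f _|n IH f] //.
by elim=> [|a b x ha hb _ hx]; [exact: ord_ge0|apply: ord_geD => //; apply: (ord_geM ha); apply: IH].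
Qed.

Definition spsX (i : 'I_r) : SS := gr_const s (psX K i).
Definition spsY (j : 'I_s) : SS := gdelta _ [set j].

Lemma spsX_even i : parity false (spsX i).
Proof. exact: gr_parity_const. Qed.
Lemma spsY_odd j : parity true (spsY j).
Proof. by have := @gdelta_parity (powser K r) s [set j]; rewrite cards1. Qed.

Definition sps_incl (h : spoly K r s) : SS := gr_map (@mp2ps K r) h.

Lemma sps_inclE h T m : sps_incl h T m = (h T)@_m.
Proof. by rewrite ffunE. Qed.

Lemma sps_incl_hom : exists g : superHom (spoly K r s) SS, g =1 sps_incl.
Proof.
apply: superhom_of.
- exact: gr_map_zmod.
- exact: gr_map_monoid.
- move=> k; apply/ffunP => T; apply: funext => m; rewrite sps_inclE.
  rewrite !ffunE; case: ifP => _; last by rewrite mcoeff0 ps0E.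
  by rewrite mcoeffC /ps_const; case: eqP; rewrite ?mulr1 ?mulr0.
- move=> p h hh S; rewrite ffunE => n0; apply: hh.
  by apply: contraNneq n0 => ->; rewrite rmorph0.
Qed.

Lemma sps_inclX i : sps_incl (spX K s i) = spsX i.
Proof. by apply/ffunP => T; rewrite !ffunE; case: ifP; rewrite ?rmorph0. Qed.
Lemma sps_inclY j : sps_incl (spY K r j) = spsY j.
Proof. by apply/ffunP => T; rewrite !ffunE; case: eqP; rewrite ?rmorph1 ?rmorph0. Qed.

(** Only the degree in X is cut, the exterior part being finite; what is lost still has order at
    least [N]. *)
Definition sps_trunc N f : spoly K r s := [ffun T : {set 'I_s} => ps_trunc N (f T)].

Lemma sps_truncE N f T m : (mdeg m < N)%N -> (sps_trunc N f T)@_m = f T m.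
Proof. by move=> lt; rewrite ffunE ps_truncE. Qed.

Lemma sps_trunc_high N f T m : (N <= mdeg m)%N -> (sps_trunc N f T)@_m = 0.
Proof.
move=> le; rewrite ffunE raddf_sum /=; apply: big1 => k _.
rewrite mcoeffZ mcoeffX; case: eqP => [e|]; last by rewrite mulr0.
by move: le; rewrite -e leqNgt bmdeg.
Qed.

Lemma sps_incl_trunc N f : ord_ge N (f - sps_incl (sps_trunc N f)).
Proof.
move=> T m lt; rewrite spsBE sps_inclE sps_truncE ?subrr //.
by apply: leq_ltn_trans lt; rewrite leq_addr.
Qed.

(** Vanishing in order at least [n] plays the part of continuity: it reduces the claim to the
    polynomials, which the variables generate. *)
Lemma sps_hom_uniq (B : superAlgType K) (u v : superHom SS B) n :
  (forall i, u (spsX i) = v (spsX i)) -> (forall j, u (spsY j) = v (spsY j)) ->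
  (forall f, ord_ge n f -> u f = 0) -> (forall f, ord_ge n f -> v f = 0) ->
  u =1 v.
Proof.
move=> eX eY hu hv f; have [g hg] := sps_incl_hom.
have e : (u \o g : superHom _ _) =1 (v \o g : superHom _ _).
  by apply: spoly_hom_uniq => [i|j] /=; rewrite hg ?sps_inclX ?sps_inclY.
have := @sps_incl_trunc n f; set d := _ - _ => h.
have -> : f = d + sps_incl (sps_trunc n f) by rewrite subrK.
by rewrite (rmorphD u) (rmorphD v) /= (hu d) // (hv d) // -hg; congr (_ + _); apply: (e (sps_trunc n f)).
Qed.

(** No continuity of [u] is involved: a series of order n is a finite sum of products of n variables
    with series, by repeated use of [ps_ord_sum]. *)
Lemma sps_ord_exp (B : superAlgType K) (u : superHom SS B) (J : superideal B) :
  (forall i, J (u (spsX i))) -> (forall j, J (u (spsY j))) ->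
  forall n f, ord_ge n f -> si_exp J n (u f).
Proof.
move=> hX hY.
have hc n (f : powser K r) : (forall m, (mdeg m < n)%N -> f m = 0) ->
    si_exp J n (u (gr_const s f : SS)).
  elim: n f => [//|n IH] f hf.
  have f0 : f 0%MM = 0 by apply: hf; rewrite mdeg0.
  have [g [fE hg]] := ps_ord_sum f0; rewrite fE.
  have -> : gr_const s (\sum_i psX K i * g i) = \sum_i spsX i * gr_const s (g i) :> SS.
    by rewrite (rmorph_sum (@gr_const _ s)); apply: eq_bigr => i _; apply: rmorphM.
  rewrite rmorph_sum; elim/big_ind: _ => [|x y|i _].
  - exact: si0.
  - exact: siD.
  rewrite rmorphM /=; apply: prod_span1 => //; apply: IH => m; apply: (hg n hf).
have hd T : si_exp J #|T| (u (gdelta _ T : SS)).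
  elim/gdelta_ind: T => [|i U h IH]; first by rewrite cards0.
  rewrite gdelta_set1M // cardsU1; have -> : i \notin U by apply/negP => /h; rewrite ltnn.
  by rewrite rmorphM /=; apply: (prod_span1 (hY i) IH).
move=> n f hf; rewrite [f]grassE rmorph_sum; elim/big_ind: _ => [|x y|T _].
- exact: si0.
- exact: siD.
rewrite rmorphM /=; apply: (@si_exp_le _ _ J n (n - #|T| + #|T|)).
  by rewrite addnC -leq_subLR.
by apply: si_expM => //; apply: hc => m; rewrite ltn_subRL addnC; apply: hf.
Qed.

Lemma sps_hom (B : superAlgType K) (b : 'I_r -> B) (c : 'I_s -> B) N :
    (forall i, parity false (b i)) -> (forall j, parity true (c j)) ->
    (forall m, (N <= mdeg m)%N -> mon b m = 0) ->
  exists g : superHom SS B,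
    [/\ forall i, g (spsX i) = b i, forall j, g (spsY j) = c j &
      forall f, g f = \sum_T (\sum_(m : 'X_{1..r < N}) sconst (f T m) * mon b m) * oprod c T].
Proof.
move=> hb hc hN; have [ev [evX evY evE]] := spoly_hom hb hc.
(* Monomials of degree at least [N] in X die in [B], so truncation, which is not multiplicative,
   becomes so after [ev]. *)
have low (h : spoly K r s) : (forall T m, (mdeg m < N)%N -> (h T)@_m = 0) -> ev h = 0.
  move=> hh; rewrite evE big1 // => T _; rewrite /mp_eval big1 ?mul0r // => m _.
  by have [/hh ->|/hN ->] := ltnP (mdeg m) N; rewrite ?rmorph0 ?mul0r ?mulr0.
have low2 (h h' : spoly K r s) : (forall T m, (mdeg m < N)%N -> (h T)@_m = (h' T)@_m) -> ev h = ev h'.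
  move=> hh; apply/eqP; rewrite -subr_eq0 -rmorphB; apply/eqP; apply: low => T m lt.
  by rewrite !ffunE mcoeffB hh // subrr.
have [||||g hg] := @superhom_of K SS B (fun f => ev (sps_trunc N f)).
- move=> f g; rewrite -rmorphB; apply: low2 => T m lt.
  by rewrite sps_truncE // !ffunE mcoeffB psBE !ps_truncE.
- split=> [|f g].
    rewrite -(rmorph1 ev); apply: low2 => T m lt; rewrite sps_truncE // !ffunE.
    by case: ifP => _; rewrite ?ps0E ?mcoeff0 // ps1E mcoeff1.
  rewrite -rmorphM; apply: low2 => S m lt; rewrite sps_truncE //.
  rewrite -[_ S]/(gr_mul f g S) -[X in _ = X@_m]/(gr_mul _ _ S) !gr_mulE ps_sumE raddf_sum.
  apply: eq_bigr => T _ /=; rewrite ps_signM -!(signr_odd _ (inversions _ _)).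
  rewrite (psME _ _ lt) !ffunE; case: odd; rewrite ?expr0 ?expr1 ?mul1r //.
  by rewrite !mulN1r mcoeffN.
- move=> k; rewrite -(superhomC ev); apply: low2 => T m lt; rewrite sps_truncE // !ffunE.
  case: ifP => _; rewrite ?ps0E ?mcoeff0 // mcoeffC /ps_const.
  by case: eqP; rewrite ?mulr1 ?mulr0.
- move=> p f hf; apply: superhomP => T; rewrite ffunE => n0; apply: hf.
  by apply: contraNneq n0 => ->; rewrite /ps_trunc big1 // => m _; rewrite ps0E scale0r.
have trX i : ev (sps_trunc N (spsX i)) = ev (spX K s i).
  by apply: low2 => T m lt; rewrite sps_truncE // -sps_inclX sps_inclE.
have trY j : ev (sps_trunc N (spsY j)) = ev (spY K r j).
  by apply: low2 => T m lt; rewrite sps_truncE // -sps_inclY sps_inclE.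
exists g; split=> [i|j|f]; rewrite hg ?trX ?trY //.
rewrite evE; apply: eq_bigr => T _; congr (_ * _).
rewrite (@mp_evalE _ _ _ b _ N).
  by apply: eq_bigr => m _; rewrite sps_truncE ?bmdeg.
rewrite msizeE; apply/bigmax_leqP_seq => m; rewrite mcoeff_msupp => n0 _.
by rewrite ltnNge; apply: contraNN n0 => /sps_trunc_high ->.
Qed.

End SuperPowerSeries.

(** * Noetherian modules *)

(** Zorn's lemma on subsets also asks for the union of the empty chain. Applied to the sets N0 u A,
    it gets N0 there, and its maximal set contains N0. *)
Lemma Zorn_above (T : Type) (Q : (T -> Prop) -> Prop) (N0 : T -> Prop) :
    (forall F : (T -> Prop) -> Prop, (exists A, F A) ->
      (forall A, F A -> Q A) ->
      (forall A B, F A -> F B -> (forall x, A x -> B x) \/ (forall x, B x -> A x)) ->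
      Q (fun x => exists2 A, F A & A x)) ->
    Q N0 ->
  exists A, [/\ Q A, forall x, N0 x -> A x &
    forall B, Q B -> (forall x, A x -> B x) -> forall x, B x -> A x].
Proof.
move=> QU Q0; pose ext (A : T -> Prop) : T -> Prop := fun x => N0 x \/ A x.
have [|A [QA maxA]] := @classical_sets.Zorn_bigcup T (fun A => Q (ext A)).
  move=> F FQ totF; have [[A0 FA0]|nF] := pselect (exists A, F A).
    pose F' (A : T -> Prop) := exists2 B, F B & A = ext B.
    have -> : ext (classical_sets.bigcup F id) = (fun x => exists2 A, F' A & A x).
      apply: funext => x; apply: propext; split=> [[hx|[B FB Bx]]|[_ [B FB ->] [hx|Bx]]].
      - by exists (ext A0); [exists A0|left].
      - by exists (ext B); [exists B|right].
      - by left.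
      - by right; exists B.
    apply: QU; first by exists (ext A0), A0.
      by move=> _ [B FB ->]; apply: FQ.
    move=> _ _ [A FA ->] [B FB ->].
    by have [h|h] := totF _ _ FA FB; [left|right]; move=> x [hx|hx]; by [left|right; apply: h].
  rewrite (_ : ext _ = N0) //; apply: funext => x; apply: propext.
  by split=> [[//|[A FA _]]|]; [case: nF; exists A|left].
exists (ext A); split=> // [x|B QB AB x Bx]; first by left.
apply: contrapT => nx; apply: (maxA B).
  split=> [y Ay|h]; first by apply: AB; right.
  by apply: nx; right; apply: h.
rewrite (_ : ext B = B) //; apply: funext => y; apply: propext.
by split=> [[hy|//]|]; [apply: AB; left|right].
Qed.

Section Noetherian.
Variable R : comNzRingType.

Section Submodules.
Variable V : lmodType R.
Implicit Types (N : V -> Prop) (v w : V) (vs : seq V).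

Definition submodule N :=
  [/\ N 0, forall v w, N v -> N w -> N (v + w) & forall a v, N v -> N (a *: v)].

Lemma submoduleB N v w : submodule N -> N v -> N w -> N (v - w).
Proof. by move=> [_ hD hZ] hv hw; apply: hD => //; rewrite -scaleN1r; apply: hZ. Qed.

Fixpoint lspan vs : V -> Prop :=
  if vs is w :: vs' then fun v => exists a, lspan vs' (v - a *: w) else fun v => v = 0.

Lemma lspan_submodule vs : submodule (lspan vs).
Proof.
elim: vs => [|w vs [h0 hD hZ]]; first by split=> //= [v w -> ->|a v ->]; rewrite ?addr0 ?scaler0.
split=> [|u v [a ha] [b hb]|c v [a ha]] /=.
- by exists 0; rewrite scale0r subr0.
- by exists (a + b); rewrite scalerDl opprD addrACA; apply: hD.
- by exists (c * a); rewrite -scalerA -scalerBr; apply: hZ.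
Qed.

Lemma lspan_min vs N : submodule N -> {in vs, forall v, N v} ->
  forall v, lspan vs v -> N v.
Proof.
move=> sN; have [h0 hD hZ] := sN; elim: vs => [_ v /= -> //|w vs IH h v /= [a ha]].
rewrite -[v](subrK (a *: w)); apply: hD.
  by apply: IH => // u hu; apply: h; rewrite inE hu orbT.
by apply: hZ; apply: h; rewrite mem_head.
Qed.

Lemma lspan_mem vs v : v \in vs -> lspan vs v.
Proof.
elim: vs => [//|w vs IH]; rewrite inE => /orP[/eqP ->|/IH h] /=.
  by exists 1; rewrite scale1r subrr; case: (lspan_submodule vs).
by exists 0; rewrite scale0r subr0.
Qed.

Lemma lspan_sub vs ws v : {subset vs <= ws} -> lspan vs v -> lspan ws v.
Proof.
move=> h; apply: lspan_min => [|u /h]; [exact: lspan_submodule|exact: lspan_mem].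
Qed.

Definition fin_gen N := exists vs, {in vs, forall v, N v} /\ forall v, N v -> lspan vs v.

Definition noetherian := forall N, submodule N -> fin_gen N.

Lemma noetherian_acc (N : nat -> V -> Prop) : noetherian ->
    (forall n, submodule (N n)) -> (forall n v, N n v -> N n.+1 v) ->
  exists k, forall n v, N n v -> N k v.
Proof.
move=> noV sN incN.
have mono m n v : (m <= n)%N -> N m v -> N n v.
  by move=> /subnKC <-; elim: (n - m)%N => [|d IH] h; rewrite ?addn0 // addnS; apply: incN; apply: IH.
have [|vs [hvs gen]] := noV (fun v => exists n, N n v).
  split=> [|v w [m hm] [n hn]|a v [n hn]].
  - by exists 0%N; case: (sN 0%N).
  - exists (maxn m n); have [_ hD _] := sN (maxn m n).
    by apply: hD; [apply: mono hm|apply: mono hn]; rewrite ?leq_maxl ?leq_maxr.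
  - by exists n; have [_ _ hZ] := sN n; apply: hZ.
have [k hk] : exists k, {in vs, forall v, N k v}.
  elim: vs hvs {gen} => [|w vs IH] h; first by exists 0%N.
  have [k hk] : exists k, {in vs, forall v, N k v}.
    by apply: IH => u hu; apply: h; rewrite inE hu orbT.
  have [n hn] := h w (mem_head _ _); exists (maxn k n) => u.
  rewrite inE => /orP[/eqP ->|/hk hu].
    by apply: mono hn; rewrite leq_maxr.
  by apply: mono hu; rewrite leq_maxl.
by exists k => n v hv; apply: lspan_min (sN k) hk _ (gen v _); exists n.
Qed.

End Submodules.

(** Induction on the generators [w :: ws]: the coefficients of [w] in elements of [N] form a
    finitely generated ideal. Lifting its generators to [N] and subtracting leaves elements of [N]
    in the span of [ws]. *)
Lemma noetherian_lspan (V : lmodType R) (ws : seq V) (N : V -> Prop) :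
  noetherian R^o -> submodule N -> (forall v, N v -> lspan ws v) -> fin_gen N.
Proof.
move=> noR; elim: ws N => [|w ws IH] N sN hN.
  by exists [::]; split=> // v; rewrite in_nil.
have [N0 ND NZ] := sN.
have [W0 WD WZ] := lspan_submodule ws.
have [|rs [hrs genr]] := noR (fun a : R^o => exists2 v, N v & lspan ws (v - a *: w)).
  split=> [|a b [u hu au] [v hv bv]|c a [u hu au]].
  - by exists 0 => //; rewrite scale0r subr0.
  - by exists (u + v); [apply: ND|rewrite scalerDl opprD addrACA; apply: WD].
  - by exists (c *: u); [apply: NZ|rewrite -scalerA -scalerBr; apply: WZ].
have [|v1|vs1 [hvs1 gen1]] := IH (fun v => N v /\ lspan ws v).
- split=> [|u v [hu gu] [hv gv]|a v [hv gv]]; split=> //.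
  + exact: ND. + exact: WD. + exact: NZ. + exact: WZ.
- by case.
have [vs2 [hvs2 gen2]] : exists vs2, {in vs2, forall v, N v} /\
    forall a, lspan (rs : seq R^o) a -> exists2 v, lspan vs2 v & lspan ws (v - a *: w).
  elim: rs hrs {genr} => [|r rs IHr] h.
    exists [::]; split=> [v|a /= ->]; rewrite ?in_nil //.
    by exists 0 => //; rewrite scale0r subr0.
  have [|vs2 [hvs2 gen2]] := IHr.
    by move=> u hu; apply: h; rewrite inE hu orbT.
  have [u hu ru] := h r (mem_head _ _); exists (u :: vs2); split=> [v|a [c ca]].
    by rewrite inE => /orP[/eqP ->|/hvs2].
  have [v hv av] := gen2 _ ca; exists (v + c *: u).
    by exists c; rewrite addrK.
  have -> : v + c *: u - a *: w = (v - (a - c *: r) *: w) + c *: (u - r *: w).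
    rewrite scalerBr scalerBl scalerA -[c *: r]/(c * r) opprB addrACA.
    by rewrite [_ *: w - _]addrC addrK.
  by apply: WD => //; apply: WZ.
exists (vs2 ++ vs1); split=> [v|v hv].
  by rewrite mem_cat => /orP[/hvs2|/hvs1[]].
have [a ha] := hN _ hv.
have [u hu au] := gen2 a (genr a (ex_intro2 _ _ v hv ha)).
have Nu : N u by apply: lspan_min hu.
have [_ SD _] := lspan_submodule (vs2 ++ vs1).
rewrite -[v](subrK u) addrC; apply: SD.
  by apply: lspan_sub hu => x hx; rewrite mem_cat hx.
apply: lspan_sub (gen1 _ _) => [x hx|]; first by rewrite mem_cat hx orbT.
split; first exact: submoduleB.
have -> : v - u = (v - a *: w) - (u - a *: w) by rewrite opprB addrA subrK.
exact: submoduleB (lspan_submodule ws) _ _.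
Qed.

Lemma noetherian_ffun (T : finType) : noetherian R^o -> noetherian {ffun T -> R^o}.
Proof.
move=> noR N sN.
pose ws := [seq [ffun y => (y == x)%:R] : {ffun T -> R^o} | x <- enum T].
apply: (@noetherian_lspan _ ws) => // v _.
have [W0 WD WZ] := lspan_submodule ws.
have -> : v = \sum_(x <- enum T) v x *: ([ffun y => (y == x)%:R] : {ffun T -> R^o}).
  apply/ffunP => y; rewrite big_enum sum_ffunE (bigD1 y) //= big1 ?addr0.
    by rewrite !ffunE eqxx [_ *: _]mulr1.
  by move=> x xy; rewrite !ffunE eq_sym (negbTE xy) [_ *: _]mulr0.
rewrite big_seq_cond; elim/big_ind: _ => // x /andP[hx _].
by apply: WZ; apply: lspan_mem; apply: map_f.
Qed.

(* L, maximal among the submodules that contain N and the multiples of v by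
   the ideal (as) but not v, contains the image of a power of each a in as:
   otherwise it would contain a ^ k w as soon as a ^ (k + 1) w. *)
Lemma krull (V : lmodType R) (N : V -> Prop) (rs : seq R^o) (v : V) :
    noetherian V -> submodule N ->
    (forall L, submodule L -> (forall w, N w -> L w) ->
      {in rs, forall a, exists k, forall w, L (a ^+ k *: w)} -> L v) ->
  exists a, lspan rs a /\ N ((1 - a) *: v).
Proof.
move=> noV sN hyp; have [N0 ND NZ] := sN.
have [S0 SD SZ] := lspan_submodule rs.
pose N' x := exists n a, [/\ N n, lspan rs a & x = n + a *: v].
have sN' : submodule N'.
  split=> [|_ _ [n [a [hn ha ->]]] [n' [a' [hn' ha' ->]]]|c _ [n [a [hn ha ->]]]].
  - by exists 0, 0; split=> //; rewrite scale0r addr0.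
  - exists (n + n'), (a + a'); split; [exact: ND|exact: SD|].
    by rewrite scalerDl addrACA.
  - exists (c *: n), (c *: a); split; [exact: NZ|exact: SZ|].
    by rewrite scalerDr scalerA.
have [[n [a [hn ha e]]]|nv] := pselect (N' v).
  by exists a; split=> //; rewrite scalerBl scale1r {1}e addrK.
have [F [A0 FA0] FQ totF||L [[sL nL] LN' maxL]] :=
    @Zorn_above V (fun L => submodule L /\ ~ L v) N'; last 1 first.
- exfalso; apply: (nL); have [L0 LD LZ] := sL.
  have Lav a : a \in rs -> L (a *: v).
    by move=> ha; apply: LN'; exists 0, a; split=> //; rewrite ?add0r //; apply: lspan_mem.
  apply: hyp => // [w hw|a ha].
    by apply: LN'; exists w, 0; split=> //; rewrite scale0r addr0.
  have [|n w h|k stab] := @noetherian_acc V (fun k w => L (a ^+ k *: w)) noV.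
  - move=> k; split=> [|x y hx hy|c x hx]; first by rewrite scaler0.
      by rewrite scalerDr; apply: LD.
    by rewrite scalerA mulrC -scalerA; apply: LZ.
  - by rewrite exprS -scalerA; apply: LZ.
  (* Suppose v = l + a^k y lies in L + a^k V. As a v is in [L], so is a^(k+1) y, hence a^k y by
     stability, hence [v]: a contradiction. So L + a^k V avoids [v] and equals [L] by maximality. *)
  exists k => w; pose L2 x := exists l y, L l /\ x = l + a ^+ k *: y.
  have sL2 : submodule L2.
    split=> [|_ _ [l [y [hl ->]]] [l' [y' [hl' ->]]]|c _ [l [y [hl ->]]]].
    - by exists 0, 0; rewrite scaler0 addr0.
    - by exists (l + l'), (y + y'); rewrite scalerDr addrACA; split=> //; apply: LD.
    - exists (c *: l), (c *: y); rewrite scalerDr !scalerA [c * _]mulrC.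
      by split=> //; apply: (LZ).
  have LL2 x : L x -> L2 x by move=> hx; exists x, 0; rewrite scaler0 addr0.
  have [L2v|nL2] := pselect (L2 v); last first.
    by apply: (maxL L2) => //; exists 0, w; rewrite add0r.
  have [l [y [hl e]]] := L2v.
  apply: contrapT => _; apply: (nL); rewrite e; apply: (LD) => //; apply: (stab k.+1).
  rewrite exprS -scalerA; have -> : a ^+ k *: y = v - l by rewrite e addrAC subrr add0r.
  by rewrite scalerBr; apply: submoduleB => //; [apply: Lav|apply: LZ].
- split; last by case=> A /FQ[].
  split=> [|x y [A FA Ax] [B FB By]|c x [A FA Ax]].
  - by exists A0 => //; have [[]] := FQ _ FA0.
  - have [h|h] := totF _ _ FA FB.
      by exists B => //; have [[_ hD _] _] := FQ _ FB; apply: hD => //; apply: h.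
    by exists A => //; have [[_ hD _] _] := FQ _ FA; apply: hD => //; apply: h.
  - by exists A => //; have [[_ _ hZ] _] := FQ _ FA; apply: hZ.
- by [].
Qed.

End Noetherian.

(** Hilbert's basis theorem. Leading coefficients of [I] are realised in one degree [M]; they reduce
    every element of [I] to degree at most [M], where [noetherian_lspan] applies over [R]. *)
Lemma noetherian_poly (R : comNzRingType) :
  noetherian R^o -> noetherian ({poly R} : comNzRingType)^o.
Proof.
move=> noR I sI; have [I0 ID IZ'] := sI.
have IZ (p f : {poly R}) : I f -> I (p * f) by apply: IZ'.
have IC (c : R) (f : {poly R}) : I f -> I (c *: f) by rewrite -mul_polyC; apply: IZ.
have shift (f : {poly R}) n k : (size f <= n.+1)%N ->
    (size ('X^k * f)%R <= (k + n).+1)%N /\ ('X^k * f)`_(k + n) = f`_n.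
  move=> sf; split; last by rewrite coefXnM ltnNge leq_addr /= addKn.
  by apply: leq_trans (size_polyMleq _ _) _; rewrite size_polyXn; lia.
(* The degree is only bounded by [n], so that a sum whose leading terms cancel still belongs to
   [A]. *)
pose A (a : R^o) := exists f n, [/\ I f, (size f <= n.+1)%N & f`_n = a].
have [|rs [hrs genr]] := noR A.
  split=> [|a b [f [n [hf sf <-]]] [g [m [hg sg <-]]]|c _ [f [n [hf sf <-]]]].
  - by exists 0, 0%N; rewrite size_poly0 coef0.
  - exists ('X^m * f + 'X^n * g), (m + n)%N.
    have [s1 e1] := shift f n m sf; have [s2 e2] := shift g m n sg.
    rewrite [(n + m)%N]addnC in s2 e2; split.
    + by apply: ID; apply: IZ.
    + by apply: leq_trans (size_polyD _ _) _; rewrite geq_max s1.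
    + by rewrite coefD e1 e2.
  - exists (c *: f), n; split; [exact: IC| |by rewrite coefZ].
    exact: leq_trans (size_scale_leq _ _) sf.
have [M hM] : exists M, {in rs, forall r : R^o, exists f,
    [/\ I f, (size f <= M.+1)%N & f`_M = r]}.
  elim: rs hrs {genr} => [|r rs IH] h; first by exists 0%N.
  have [|M hM] := IH; first by move=> u hu; apply: h; rewrite inE hu orbT.
  have [f [n [hf sf ef]]] := h r (mem_head _ _).
  exists (n + M)%N => u; rewrite inE => /orP[/eqP ->|/hM [g [hg sg eg]]].
    have [s1 e1] := shift f n M sf; rewrite [(M + n)%N]addnC in s1 e1.
    by exists ('X^M * f); rewrite e1; split=> //; apply: IZ.
  have [s1 e1] := shift g M n sg.
  by exists ('X^n * g); rewrite e1; split=> //; apply: IZ.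
pose PM (f : {poly R}) := I f /\ (size f <= M.+1)%N.
have sPM : submodule PM.
  split=> [|f g [hf sf] [hg sg]|c f [hf sf]]; split=> //.
  - by rewrite size_poly0.
  - exact: ID.
  - by apply: leq_trans (size_polyD _ _) _; rewrite geq_max sf.
  - exact: IC.
  - exact: leq_trans (size_scale_leq _ _) sf.
have [|gs [hgs gen]] := @noetherian_lspan R {poly R} [seq 'X^i | i <- iota 0 M.+1] PM noR sPM.
  move=> f [_ sf]; have -> : f = \sum_(i < M.+1) f`_i *: 'X^i.
    rewrite -[LHS](@coefK _ f) poly_def (big_ord_widen _ (fun i => f`_i *: 'X^i) sf).
    rewrite [RHS](bigID (fun i : 'I_M.+1 => (i < size f)%N)) /=.
    rewrite [X in _ + X]big1 ?addr0 // => i; rewrite -leqNgt => le.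
    by rewrite nth_default // scale0r.
  have [S0 SD SZ] := lspan_submodule [seq 'X^i | i <- iota 0 M.+1 : seq nat] (V := {poly R}).
  elim/big_ind: _ => // i _; apply: SZ; apply: lspan_mem.
  by apply: map_f; rewrite mem_iota /= ltn_ord.
have lead a : A a -> exists2 g, PM g & g`_M = a.
  move=> /genr; have [P0 PD PZ] := sPM.
  apply: (@lspan_min R R^o rs (fun a => exists2 g, PM g & g`_M = a)).
    split=> [|x y [f hf <-] [g hg <-]|c x [f hf <-]].
    - by exists 0; rewrite ?coef0.
    - by exists (f + g); [apply: PD|rewrite coefD].
    - by exists (c *: f); [apply: PZ|rewrite coefZ].
  by move=> r /hM [f [hf sf ef]]; exists f.
have PMspan f : PM f -> lspan (gs : seq ({poly R} : comNzRingType)^o) f.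
  move=> /gen; have [S0 SD SZ] := lspan_submodule (gs : seq ({poly R} : comNzRingType)^o).
  apply: (@lspan_min R {poly R} gs (lspan (gs : seq ({poly R} : comNzRingType)^o))).
    split=> // c v hv; rewrite -mul_polyC; exact: (SZ c%:P).
  by move=> v hv; apply: lspan_mem.
exists gs; split=> [f hf|f]; first by have [] := hgs f hf.
have [S0 SD SZ] := lspan_submodule (gs : seq ({poly R} : comNzRingType)^o).
have [n] := ubnP (size f); elim: n f => // n IH f; rewrite ltnS => sf hf.
have [le|lt] := leqP (size f) M.+1; first exact: PMspan.
have [g hg eg] : exists2 g, PM g & g`_M = lead_coef f.
  apply: lead; exists f, (size f).-1; split=> //.
  by rewrite prednK //; apply: leq_trans lt.
pose d := ((size f).-1 - M)%N.
have hd : (d + M = (size f).-1)%N by rewrite /d; lia.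
have [s1 e1] := shift g M d hg.2; rewrite hd in s1 e1.
rewrite -[f](subrK ('X^d * g)); apply: SD; last by apply: (SZ 'X^d); apply: PMspan.
apply: IH; last first.
  by rewrite -mulN1r mulrA; apply: ID => //; apply: IZ; case: hg.
apply: leq_trans sf; rewrite (@leq_ltn_trans (size f).-1) //; last by lia.
apply/leq_sizeP => j; rewrite leq_eqVlt => /orP[/eqP <-|lj].
  by rewrite coefB e1 eg subrr.
have h1 := leq_trans s1 lj; have h2 := leq_trans (leqSpred (size f)) lj.
by rewrite coefB (nth_default _ h1) (nth_default _ h2) subrr.
Qed.

Lemma noetherian_surj (R R' : comNzRingType) (phi : {rmorphism R -> R'}) :
  (forall y, exists x, phi x = y) -> noetherian R^o -> noetherian R'^o.
Proof.
move=> sphi noR I [I0 ID IZ].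
have [|vs [hvs gen]] := noR (fun x : R^o => I (phi x)).
  split=> [|x y hx hy|a x hx]; rewrite ?rmorph0 //.
    by rewrite rmorphD; apply: ID.
  by rewrite [phi _]rmorphM; apply: IZ.
exists [seq phi x | x <- vs]; split=> [_ /mapP [x hx ->]|y hy]; first exact: hvs.
case: (sphi y) hy => x <- hy; have := gen _ hy.
have [S0 SD SZ] := lspan_submodule ([seq phi x | x <- vs] : seq R'^o).
apply: (@lspan_min R R^o vs (fun x => lspan ([seq phi x | x <- vs] : seq R'^o) (phi x))).
  split=> [|u v hu hv|a v hv]; rewrite ?rmorph0 //.
    by rewrite rmorphD; apply: SD.
  by rewrite [phi _]rmorphM; apply: SZ.
by move=> v hv; apply: lspan_mem; apply: map_f.
Qed.

Lemma noetherian_field (F : fieldType) : noetherian (F : comNzRingType)^o.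
Proof.
move=> I [I0 ID IZ].
have [[x hx x0]|n] := pselect (exists2 x, I x & x != 0).
  exists [:: x]; split=> [v|v _]; first by rewrite inE => /eqP ->.
  by exists (v / x); rewrite /= [_ *: _]mulfVK // subrr.
exists [::]; split=> [v|v hv]; first by rewrite in_nil.
by apply/eqP; apply: contrapT => /negP v0; apply: n; exists v.
Qed.

(** Quotients of Noetherian rings are Noetherian, so a surjection from an iterated univariate
    polynomial ring, built one variable at a time, is enough. *)
Lemma noetherian_mpoly (F : fieldType) n :
  noetherian ({mpoly F[n]} : comNzRingType)^o.
Proof.
suff [S [noS [phi [phiC phiX]]]] : exists (S : comNzRingType), noetherian S^o /\
    exists phi : {rmorphism S -> {mpoly F[n]}}, (forall c, exists x, phi x = c%:MP) /\
      forall i : 'I_n, (i < n)%N -> exists x, phi x = 'X_i.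
  apply: (@noetherian_surj S {mpoly F[n]} phi _ noS).
  move=> p; rewrite [p]mpolyE.
  have S0 : exists x, phi x = 0 by exists 0; apply: rmorph0.
  have SD p1 p2 : (exists x, phi x = p1) -> (exists x, phi x = p2) ->
      exists x, phi x = p1 + p2.
    by move=> [x <-] [y <-]; exists (x + y); apply: rmorphD.
  have SM p1 p2 : (exists x, phi x = p1) -> (exists x, phi x = p2) ->
      exists x, phi x = p1 * p2.
    by move=> [x <-] [y <-]; exists (x * y); apply: rmorphM.
  have S1 : exists x, phi x = 1 by exists 1; apply: rmorph1.
  elim/big_ind: _ => // m _; rewrite -mul_mpolyC; apply: (SM) => //.
  rewrite mpolyXE_id; elim/big_ind: _ => // i _.
  by elim: (m i) => [|k IH] //; rewrite exprS; apply: (SM) => //; apply: phiX.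
suff: forall k, (k <= n)%N -> exists (S : comNzRingType), noetherian S^o /\
    exists phi : {rmorphism S -> {mpoly F[n]}}, (forall c, exists x, phi x = c%:MP) /\
      forall i : 'I_n, (i < k)%N -> exists x, phi x = 'X_i.
  by apply.
elim=> [_|k IH lt].
  exists (F : comNzRingType); split; first exact: noetherian_field.
  by exists (@mpolyC n F : {rmorphism _ -> _}); split=> // c; exists c.
have [S [noS [phi [phiC phiX]]]] := IH (ltnW lt).
exists ({poly S} : comNzRingType); split; first exact: noetherian_poly.
have cX : commr_rmorph phi ('X_(Ordinal lt)) by move=> x; apply: mulrC.
exists (horner_morph cX : {rmorphism _ -> _}); split=> [c|i].
  by have [x ex] := phiC c; exists x%:P; rewrite /= horner_morphC.
rewrite ltnS leq_eqVlt => /orP[/eqP e|/phiX [x ex]].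
  by exists 'X; rewrite /= horner_morphX; congr 'X_ _; apply: val_inj.
by exists x%:P; rewrite /= horner_morphC.
Qed.

(** * Nullstellensatz *)

(** Cantor's nested intervals: the n-th step shrinks the interval to a closed one that misses [T n],
    and the supremum of the left ends lies in all of them. *)
Lemma real_avoid (R : realType) (T : nat -> seq R) : exists x, forall n, x \notin T n.
Proof.
have shrink (l : seq R) a b : a < b -> exists p : R * R,
    [/\ a <= p.1, p.1 < p.2, p.2 <= b & forall x, p.1 <= x <= p.2 -> x \notin l].
  elim: l a b => [|y l IH] a b ab; first by exists (a, b); split.
  have [le|lt] := leP y ((a + b) / 2%:R).
    (* The extra quarter of the length keeps [y] strictly outside, even when it is the midpoint. *)
    have [|p [h1 h2 h3 h4]] := IH ((a + b) / 2%:R + (b - a) / 4%:R) b; first by lra.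
    exists p; split=> //; first by lra.
    move=> x hx; rewrite inE negb_or h4 // andbT.
    by apply/eqP => e; move: hx; rewrite e => /andP[]; lra.
  have [|p [h1 h2 h3 h4]] := IH a ((a + b) / 2%:R); first by lra.
  exists p; split=> //; first by lra.
  move=> x hx; rewrite inE negb_or h4 // andbT.
  by apply/eqP => e; move: hx; rewrite e => /andP[]; lra.
have step (z : nat * (R * R)) : exists q : R * R, z.2.1 < z.2.2 ->
    [/\ z.2.1 <= q.1, q.1 < q.2, q.2 <= z.2.2 & forall x, q.1 <= x <= q.2 -> x \notin T z.1].
  case: z => n [a b] /=; have [/(shrink (T n)) [p hp]|_] := boolP (a < b).
    by exists p.
  by exists (a, b).
have [f hf] := choice step.
pose s := fix s n : R * R := if n is n'.+1 then f (n', s n') else (0, 1).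
have lt n : (s n).1 < (s n).2.
  by elim: n => [|n IH] /=; [exact: ltr01|have [] := hf (n, s n) IH].
have hs n := hf (n, s n) (lt n).
have mono m n : (m <= n)%N -> (s m).1 <= (s n).1 /\ (s n).2 <= (s m).2.
  move=> /subnKC <-; elim: (n - m)%N => [|k [h1 h2]]; first by rewrite addn0.
  rewrite addnS; have [g1 _ g2 _] := hs (m + k)%N.
  by split; [apply: le_trans g1|apply: le_trans h2].
have ub m n : (s m).1 <= (s n).2.
  have [h1 _] := mono _ _ (leq_maxl m n); have [_ h2] := mono _ _ (leq_maxr m n).
  by apply: le_trans h1 (le_trans (ltW (lt _)) h2).
pose E : R -> Prop := fun x => exists n, x = (s n).1.
have Eub n : classical_sets.ubound E (s n).2 by move=> _ [m ->]; apply: ub.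
exists (sup E) => n; have [_ _ _] := hs n; apply.
have le1 : (s n.+1).1 <= sup E.
  by apply: ub_le_sup; [exists (s 0%N).2; apply: Eub|exists n.+1].
have le2 : sup E <= (s n.+1).2.
  by apply: ge_sup; [exists (s 0%N).1; exists 0%N|apply: Eub].
by rewrite le1 le2.
Qed.

Lemma complex_avoid (R : realType) (T : nat -> seq (complex R)) :
  exists x, forall n, x \notin T n.
Proof.
have [x hx] := real_avoid (fun n => map (@complex.Re R) (T n)).
exists (real_complex R x) => n; apply: contra (hx n) => h.
by apply/mapP; exists (real_complex R x).
Qed.

(** * Linear spans over the base field and the filtration by words *)

Section KSpan.
Variables (K : numFieldType) (A : superAlgType K).
Implicit Types (l : seq A) (x y : A).

Definition kspan l x := exists c : 'I_(size l) -> K, x = \sum_i sconst (c i) * l`_i.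

Lemma kspan0 l : kspan l 0.
Proof. by exists (fun=> 0); rewrite big1 // => i _; rewrite rmorph0 mul0r. Qed.

Lemma kspanD l x y : kspan l x -> kspan l y -> kspan l (x + y).
Proof.
move=> [c ->] [d ->]; exists (fun i => c i + d i); rewrite -big_split.
by apply: eq_bigr => i _; rewrite rmorphD mulrDl.
Qed.

Lemma kspanZ l k x : kspan l x -> kspan l (sconst k * x).
Proof.
move=> [c ->]; exists (fun i => k * c i); rewrite mulr_sumr.
by apply: eq_bigr => i _; rewrite rmorphM mulrA.
Qed.

Lemma kspan_mem l x : x \in l -> kspan l x.
Proof.
move=> hx; have lt : (index x l < size l)%N by rewrite index_mem.
exists (fun i => (i == Ordinal lt)%:R); rewrite (bigD1 (Ordinal lt)) //= big1.
  by rewrite eqxx rmorph1 mul1r nth_index // addr0.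
by move=> i /negbTE ->; rewrite rmorph0 mul0r.
Qed.

Lemma kspan_min l (S : A -> Prop) : S 0 -> (forall x y, S x -> S y -> S (x + y)) ->
  (forall k x, S x -> S (sconst k * x)) -> {in l, forall x, S x} ->
  forall x, kspan l x -> S x.
Proof.
move=> S0 SD SZ h x [c ->]; elim/big_ind: _ => // i _; apply: SZ; apply: h.
exact: mem_nth.
Qed.

Lemma kspan_dep l n (u : 'I_n -> A) : (size l < n)%N -> (forall i, kspan l (u i)) ->
  exists2 c : 'I_n -> K, (exists i, c i != 0) & \sum_i sconst (c i) * u i = 0.
Proof.
move=> lt /choice [c hc].
pose C : 'M[K]_(n, size l) := \matrix_(i, j) c i j.
have : kermx C != 0.
  rewrite -mxrank_eq0 mxrank_ker -lt0n subn_gt0.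
  exact: leq_ltn_trans (rank_leq_col _) lt.
case/rowV0Pn => v /sub_kermxP vC /rV0Pn v0; exists (fun i => v 0 i) => //.
transitivity (\sum_j sconst ((v *m C) 0 j) * l`_j); last first.
  by rewrite vC big1 // => j _; rewrite mxE rmorph0 mul0r.
under eq_bigr do rewrite hc mulr_sumr; rewrite exchange_big /=.
apply: eq_bigr => j _; rewrite mxE rmorph_sum mulr_suml; apply: eq_bigr => i _.
by rewrite mxE rmorphM mulrA.
Qed.

Fixpoint words (gs : seq A) n : seq A :=
  if n is n'.+1 then words gs n' ++ [seq g * w | g <- gs, w <- words gs n'] else [:: 1].

Lemma words_span (gs : seq A) :
  (forall S : A -> Prop, subalgebra S -> (forall g, g \in gs -> S g) -> forall x, S x) ->
  forall x, exists n, kspan (words gs n) x.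
Proof.
move=> gen; pose S x := exists n, kspan (words gs n) x.
have incl n x : kspan (words gs n) x -> kspan (words gs n.+1) x.
  apply: kspan_min; [exact: kspan0|exact: kspanD|exact: kspanZ|].
  by move=> y hy; apply: kspan_mem; rewrite /= mem_cat hy.
have mono m n x : (m <= n)%N -> kspan (words gs m) x -> kspan (words gs n) x.
  move=> /subnKC <-; elim: (n - m)%N => [|k IH] h; rewrite ?addn0 // addnS.
  by apply: incl; apply: IH.
have SD x y : S x -> S y -> S (x + y).
  move=> [m hm] [n hn]; exists (maxn m n).
  by apply: kspanD; [apply: mono hm|apply: mono hn]; rewrite ?leq_maxl ?leq_maxr.
have SZ k x : S x -> S (sconst k * x) by move=> [n hn]; exists n; apply: kspanZ.
have Sg g x : g \in gs -> S x -> S (g * x).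
  move=> hg [n hn]; exists n.+1; move: x hn; apply: kspan_min.
  - by rewrite mulr0; apply: kspan0.
  - by move=> x y hx hy; rewrite mulrDr; apply: kspanD.
  - move=> k x hx; rewrite mulrA -(evenC g (parity_sconst k)) -mulrA.
    exact: kspanZ.
  - move=> x hx; apply: kspan_mem; rewrite /= mem_cat; apply/orP; right.
    by apply/allpairsP; exists (g, x).
have S1 : S 1 by exists 0%N; apply: kspan_mem; rewrite mem_head.
have Sall x : forall y, S y -> S (x * y).
  apply: (gen (fun x => forall y, S y -> S (x * y))).
    split=> [k y|x1 x2 h1 h2 y hy|x1 x2 h1 h2 y hy].
    - exact: SZ.
    - by rewrite mulrDl; apply: SD; [apply: h1|apply: h2].
    - by rewrite -mulrA; apply: h1; apply: h2.
  by move=> g hg y; apply: Sg.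
by move=> x; have := Sall x 1 S1; rewrite mulr1.
Qed.

End KSpan.

Lemma poly_eval (K : numFieldType) (A : superAlgType K) (a : A) : parity false a ->
  exists phi : {rmorphism {poly K} -> A}, phi 'X = a /\ forall c, phi c%:P = sconst c.
Proof.
move=> ha; pose b (i : 'I_1) := a; have hb i : parity false (b i) by [].
pose em := GRing.isMonoidMorphism.Build _ _ (mp_eval b) (mp_eval_monoid hb).
pose e : {rmorphism {mpoly K[1]} -> A} := HB.pack (mp_eval b) em.
have cX : commr_rmorph (@mpolyC 1 K) ('X_ord0) by move=> x; apply: mulrC.
exists (e \o horner_morph cX : {rmorphism _ -> _}); split=> [|c] /=.
  by rewrite horner_morphX mp_evalX.
by rewrite horner_morphC mp_evalC.
Qed.

Lemma finite_of_bounded (T : eqType) (Q : T -> Prop) n :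
  (forall l : seq T, uniq l -> {in l, forall x, Q x} -> (size l <= n)%N) ->
  exists l : seq T, forall x, Q x -> x \in l.
Proof.
move=> bd; apply: contrapT => nl.
suff [l [ul hl sl]] : exists l : seq T, [/\ uniq l, {in l, forall x, Q x} & size l = n.+1].
  by have := bd l ul hl; rewrite sl ltnn.
elim: n.+1 => [|k [l [ul hl sl]]]; first by exists [::].
have [[x [hx xl]]|h] := pselect (exists x, Q x /\ x \notin l).
  exists (x :: l); rewrite /= xl ul sl; split=> // y; rewrite inE.
  by case/orP => [/eqP ->|/hl].
case: nl; exists l => x hx; apply: contrapT => /negP xl; apply: h; by exists x.
Qed.

(* If no a - c lies in P, the inverses of the a - c modulo P are linearly
   independent, whereas A is a countable union of finite-dimensional spaces. *)
Lemma nullstellensatz (K : numClosedFieldType) :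
    (forall T : nat -> seq K, exists x, forall n, x \notin T n) ->
  forall (A : superAlgType K) (P : closed_point A), finitely_generated A ->
  forall a, exists c, P (a - sconst c).
Proof.
move=> unc A P [gs gen] a0.
have [a [a1 [ha ha1 ->]]] := parity_dec a0.
suff [c hc] : exists c, P (a - sconst c).
  by exists c; rewrite addrAC; apply: siD => //; apply: pt_odd.
apply: contrapT => na.
have nP c : ~ P (a - sconst c) by move=> h; apply: na; exists c.
have ac c : parity false (a - sconst c) by apply: parityB => //; apply: parity_sconst.
have mulP (l : seq K) : pt_compl P (\prod_(c <- l) (a - sconst c)).
  elim: l => [|c l IH]; first by rewrite big_nil; apply: (den1 (pt_den P)).
  by rewrite big_cons; apply: (denM (d := pt_den P)).
have [phi [phiX phiC]] := poly_eval ha.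
have phiXC c : phi ('X - c%:P) = a - sconst c by rewrite rmorphB /= phiX phiC.
(* The base field is algebraically closed, so p(a) is a nonzero constant times a product of factors
   a - c, none of them in [P]. *)
have polyP p : p != 0 -> ~ P (phi p).
  move=> p0; have [r ->] := closed_field_poly_normal p.
  rewrite -mul_polyC rmorphM rmorph_prod /= phiC => h.
  have [_] := mulP r; apply.
  under eq_bigr do rewrite -phiXC.
  have l0 : lead_coef p != 0 by rewrite lead_coef_eq0.
  set X := \prod_(i <- r) _ in h *.
  have -> : X = sconst (lead_coef p)^-1 * (sconst (lead_coef p) * X).
    by rewrite mulrA -rmorphM mulVf // rmorph1 mul1r.
  exact: siMl.
have inv c : exists b, P (1 - b * (a - sconst c)).
  have [p [b [hp e]]] := adjoin1 (ac c) (@nP c).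
  by exists b; rewrite e addrK.
have [u hu] := choice inv.
(* [n c] is a level of the filtration that contains the inverse of a - c. Each level has finite
   dimension, so it can serve only finitely many c. *)
have [n hn] := choice (fun c => words_span gen (u c)).
have fin k : exists l : seq K, forall c, n c = k -> c \in l.
  apply: (@finite_of_bounded _ _ (size (words gs k))) => l ul hl.
  rewrite leqNgt; apply/negP => lt.
  pose cs := tnth (in_tuple l).
  have [|lam [i0 li0] e0] := @kspan_dep _ _ (words gs k) _ (u \o cs) lt.
    by move=> i /=; rewrite -(hl (cs i)) ?mem_tnth //; apply: hn.
  (* The numerator of the sum of lam_i / (X - c_i): the linear relation puts p(a) in [P], while p
     does not vanish at c_i0 because lam_i0 is nonzero. *)
  pose p := \sum_i lam i *: \prod_(j < size l | j != i) ('X - (cs j)%:P).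
  have Pp : P (phi p).
    rewrite rmorph_sum /=.
    have -> : \sum_i phi (lam i *: \prod_(j | j != i) ('X - (cs j)%:P)) =
      \sum_i sconst (lam i) * (phi (\prod_(j | j != i) ('X - (cs j)%:P)) *
         (1 - u (cs i) * (a - sconst (cs i)))).
      apply/eqP; rewrite -subr_eq0 -sumrB; apply/eqP.
      transitivity (phi (\prod_j ('X - (cs j)%:P)) * \sum_i sconst (lam i) * u (cs i)); last first.
        by rewrite e0 mulr0.
      rewrite mulr_sumr; apply: eq_bigr => i _.
      rewrite -mul_polyC rmorphM /= phiC -mulrBr.
      have -> : phi (\prod_j ('X - (cs j)%:P)) =
          (a - sconst (cs i)) * phi (\prod_(j | j != i) ('X - (cs j)%:P)).
        by rewrite (bigD1 i) //= rmorphM /= phiXC.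
      set Q := phi _; set d := a - _; rewrite [Q * _]mulrBr mulr1 opprB addrC subrK.
      rewrite -mulrA (evenC _ (ac _)) -/d -!mulrA mulrA.
      by rewrite (evenC Q (parity_sconst _)) -mulrA.
    elim/big_ind: _ => [|x y|i _]; [exact: si0|exact: siD|].
    by do 2!apply: siMl; apply: hu.
  apply: (polyP p) => //; apply/eqP => p0.
  have : p.[cs i0] = 0 by rewrite p0 horner0.
  rewrite /p horner_sum (bigD1 i0) //= [X in _ + X]big1 ?addr0 => [|i ii0]; last first.
    rewrite hornerZ horner_prod (bigD1 i0) 1?eq_sym //= hornerXsubC subrr mul0r mulr0.
    by [].
  rewrite hornerZ horner_prod; apply/eqP; rewrite mulf_neq0 //.
  apply/prodf_neq0 => j ji; rewrite hornerXsubC subr_eq0 eq_sym.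
  apply: contraNneq ji => e; apply/eqP/val_inj/eqP.
  rewrite -(nth_uniq 0 _ _ ul) ?ltn_ord //.
  by apply/eqP; move: e; rewrite /cs !(tnth_nth 0).
have [T hT] := choice fin.
by have [x /(_ (n x)) /negP] := unc T; apply; apply: hT.
Qed.

(** * Completed local rings *)

Section LocalMap.
Variables (K : numFieldType) (A : superAlgType K) (P : closed_point A).
Local Notation m := (local_max P).

Definition locmap (a : A) : local_ring P := sfrac a (dens1 (pt_den P)).

Fact locmap_zmod : zmod_morphism locmap.
Proof. by move=> a b; rewrite /locmap sfracD sfracN. Qed.
Fact locmap_monoid : monoid_morphism locmap.
Proof. by split=> // a b; rewrite /locmap -{1}densM11 sfracM. Qed.
HB.instance Definition _ :=
  GRing.isZmodMorphism.Build A (local_ring P) locmap locmap_zmod.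
HB.instance Definition _ :=
  GRing.isMonoidMorphism.Build A (local_ring P) locmap locmap_monoid.
Fact locmap_parity p a : parity p a -> parity p (locmap a).
Proof. by move=> ha; exists a, (dens1 (pt_den P)). Qed.
HB.instance Definition _ := isSuperMorphism.Build K A (local_ring P) locmap
  (fun=> erefl) locmap_parity.

Lemma locmap_max a : P a -> m (locmap a).
Proof. by move=> ha; exists a, (dens1 (pt_den P)). Qed.

Lemma local_exp n x : si_exp m n x ->
  exists a (s : dens (pt_den P)), si_exp P n a /\ x = sfrac a s.
Proof.
elim: n x => [|n IH] x; first by elim/sfracW: x => a s _; exists a, s.
elim=> [|y z w [a [s [ha ->]]] hz _ [c [t [hc ->]]]].
  by exists 0, (dens1 (pt_den P)); split; [exact: si0|rewrite sfrac0E].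
have [b [u [hb ->]]] := IH _ hz.
exists (dval t * (a * b) + dval (densM s u) * c), (densM (densM s u) t); split.
  by apply: siD; apply: siMl => //; apply: prod_span1.
by rewrite -sfracM; rewrite -[LHS]/(sloc_add _ _) sloc_addE.
Qed.

(** The inverse modulo [P] is refined through 1 - (b + c - bsc)s = (1 - bs)(1 - cs). *)
Lemma pt_compl_inv s n : pt_compl P s -> exists b, si_exp P n (1 - b * s).
Proof.
move=> [hs ns]; have [p [b [hp e]]] := adjoin1 hs ns.
have hb : P (1 - b * s) by rewrite e addrK.
elim: n => [|n [c hc]]; first by exists 0.
exists (b + c - b * s * c).
have -> : 1 - (b + c - b * s * c) * s = (1 - b * s) * (1 - c * s).
  rewrite mulrBl mulrDl mulrBr mulr1 mulrBl mul1r !opprB !mulrA opprD !addrA.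
  by congr (_ - _); rewrite addrAC.
exact: prod_span1.
Qed.

Lemma pt_compl_cancel s n a : pt_compl P s -> si_exp P n (s * a) -> si_exp P n a.
Proof.
move=> /(pt_compl_inv n) [b hb] ha.
have -> : a = (1 - b * s) * a + b * (s * a) by rewrite mulrBl mul1r mulrA subrK.
by apply: siD; [apply: siMr|apply: siMl].
Qed.

Definition dloc n : A -> squot (si_exp m n) := squot_pi (si_exp m n) \o locmap.
HB.instance Definition _ n := SuperMorphism.copy (dloc n)
  (squot_pi (si_exp m n) \o locmap).

(** Denominators are units modulo P^n, so they can be cancelled. With [dloc_surj] this identifies A
    / P^n with the quotient of the local ring, and denominators disappear from the sequel. *)
Lemma dloc_ker n a : dloc n a = 0 <-> si_exp P n a.
Proof.
split=> [/squot_pi_eq0/local_exp [b [s [hb /sfracP [u e]]]]|ha]; last first.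
  by apply/squot_pi_eq0; apply: (@si_exp_map _ _ _ locmap) ha; apply: locmap_max.
apply: (@pt_compl_cancel (dval (densM u s))); first exact: (@densP _ _ (pt_den P)).
by rewrite dvalM -mulrA e dval1 mul1r; apply: siMl.
Qed.

Lemma dloc_surj n : surj (dloc n).
Proof.
move=> x; have [y <-] := squot_pi_surj x; elim/sfracW: y => a s.
have [b hb] := pt_compl_inv n (densP s).
exists (a * b); apply/squot_piP; rewrite -opprB; apply: siN.
have -> : sfrac a s - locmap (a * b) =
    sfrac 1 s * locmap (a * (1 - b * dval s)).
  rewrite /locmap -sfracM mul1r.
  have e : densM s (dens1 (pt_den P)) = s.
    by apply: dval_inj; rewrite dvalM dval1 mulr1.
  rewrite e mulrBr mulr1 mulrA sfracD sfracN; congr (_ - _).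
  rewrite -(densC s); apply/sfracP; exists (dens1 _).
  by rewrite !dval1 !mul1r.
apply: siMl; apply: (@si_exp_map _ _ _ locmap _ _ n locmap_max).
exact: siMl.
Qed.

Lemma squot_trans_dloc n a : squot_trans (dloc n.+1 a) = dloc n a.
Proof. exact: squot_transE. Qed.

End LocalMap.

Section Image.
Variables (K : numFieldType) (A B : superAlgType K) (f : superHom A B).
Hypothesis sf : surj f.
Variable I : superideal A.

Definition image_mem (y : B) : Prop := exists2 x, I x & f x = y.
Fact image0 : image_mem 0.
Proof. by exists 0; [exact: si0|exact: rmorph0]. Qed.
Fact imageD x y : image_mem x -> image_mem y -> image_mem (x + y).
Proof. by move=> [a ha <-] [b hb <-]; exists (a + b); [exact: siD|exact: rmorphD]. Qed.
Fact imageMl a x : image_mem x -> image_mem (a * x).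
Proof.
move=> [b hb <-]; have [c <-] := sf a.
by exists (c * b); [exact: siMl|exact: rmorphM].
Qed.
Fact imageMr a x : image_mem x -> image_mem (x * a).
Proof.
move=> [b hb <-]; have [c <-] := sf a.
by exists (b * c); [exact: siMr|exact: rmorphM].
Qed.
Fact image_graded x : image_mem x -> exists x0 x1,
  [/\ parity false x0, parity true x1, x = x0 + x1, image_mem x0 & image_mem x1].
Proof.
move=> [a ha <-]; have [a0 [a1 [h0 h1 -> s0 s1]]] := si_graded ha.
exists (f a0), (f a1); split; [exact: superhomP|exact: superhomP|exact: rmorphD| |].
  by exists a0.
by exists a1.
Qed.
Definition si_image : superideal B :=
  SuperIdeal image0 imageD imageMl imageMr image_graded.

Lemma si_image_exp n y : si_exp si_image n y -> exists2 x, si_exp I n x & f x = y.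
Proof. by apply: si_exp_surj. Qed.
End Image.

Section Monomials.
Variables (K : numFieldType) (B : superAlgType K).

Lemma mp_eval_congr r (b b' : 'I_r -> B) (p : {mpoly K[r]}) x x' (I : superideal B) :
  (forall m, p@_m != 0 -> I (mon b m * x - mon b' m * x')) ->
  I (mp_eval b p * x - mp_eval b' p * x').
Proof.
move=> h; rewrite /mp_eval !mulr_suml -sumrB; elim/big_rec: _ => [|m y _ hy].
  exact: si0.
apply: siD => //; rewrite -!mulrA -mulrBr.
have [->|/h] := eqVneq p@_m 0; last exact: siMl.
by rewrite rmorph0 mul0r; apply: si0.
Qed.

Lemma si_expX (I : superideal B) (x : B) n : I x -> si_exp I n (x ^+ n).
Proof. by move=> hx; elim: n => [//|n IH]; rewrite exprS; apply: prod_span1. Qed.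

Lemma mon_exp r (b : 'I_r -> B) (I : superideal B) m :
  (forall i, I (b i)) -> si_exp I (mdeg m) (mon b m).
Proof.
move=> h; rewrite mdegE /mon; elim/big_rec2: _ => [//|i x y _ IH].
by apply: si_expM => //; apply: si_expX.
Qed.

Lemma sps_hom_nil r s (b : 'I_r -> B) (c : 'I_s -> B) (I : superideal B) n :
    (forall i, parity false (b i)) -> (forall j, parity true (c j)) ->
    (forall i, I (b i)) -> (forall j, I (c j)) ->
    (forall x, si_exp I n x -> x = 0) ->
  exists g : superHom (super_powser K r s) B,
    [/\ forall i, g (spsX K s i) = b i, forall j, g (spsY K r j) = c j &
      forall f, ord_ge n f -> g f = 0].
Proof.
move=> hb hc Ib Ic In.
have [m le|g [gX gY _]] := @sps_hom K r s B b c n hb hc.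
  by apply: In; apply: si_exp_le le _ _; apply: mon_exp.
exists g; split=> // f hf; apply: In; apply: sps_ord_exp hf => [i|j].
  by rewrite gX.
by rewrite gY.
Qed.

End Monomials.

(** * Comparison of leading forms *)

Section Close.
Variables (K : numFieldType) (r s : nat).
Local Notation SS := (super_powser K r s).
Implicit Types (a b : SS).

Definition same_lead d a a' := [/\ ord_ge d a, ord_ge d a' & ord_ge d.+1 (a - a')].

Lemma same_leadM d e a a' b b' :
  same_lead d a a' -> same_lead e b b' -> same_lead (d + e) (a * b) (a' * b').
Proof.
move=> [ha ha' haa] [hb hb' hbb]; split; try exact: ord_geM.
have -> : a * b - a' * b' = (a - a') * b + a' * (b - b').
  by rewrite mulrBl mulrBr addrA subrK.
apply: ord_geD; first by rewrite -addSn; apply: ord_geM.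
by rewrite -addnS; apply: ord_geM.
Qed.

Lemma same_lead1 : same_lead 0 1 1.
Proof. by split=> //; rewrite subrr; apply: ord_ge0. Qed.

Lemma same_lead_mon (u v : 'I_r -> SS) m :
  (forall i, same_lead 1 (u i) (v i)) -> same_lead (mdeg m) (mon u m) (mon v m).
Proof.
move=> h; rewrite mdegE /mon; elim/big_rec3: _ => [|i x y z _ IH].
  exact: same_lead1.
apply: same_leadM => //; elim: (m i) => [|n IHn]; first exact: same_lead1.
by rewrite !exprS -add1n; apply: same_leadM.
Qed.

Lemma same_lead_oprod (u v : 'I_s -> SS) (T : {set 'I_s}) :
  (forall i, same_lead 1 (u i) (v i)) -> same_lead #|T| (oprod u T) (oprod v T).
Proof.
move=> h.
have -> : #|T| = count (mem T) (enum 'I_s).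
  by rewrite cardE -size_filter; congr size; rewrite enumT.
rewrite /oprod; elim: (enum 'I_s) => [|x l IH].
  by rewrite !big_nil; apply: same_lead1.
rewrite !big_cons /=; case: (x \in T) => //; exact: same_leadM.
Qed.

Lemma ord_ge_sum (I : Type) (l : seq I) (Q : pred I) (F : I -> SS) n :
  (forall i, Q i -> ord_ge n (F i)) -> ord_ge n (\sum_(i <- l | Q i) F i).
Proof.
move=> h; elim/big_ind: _ => // [|x y]; [exact: ord_ge0|exact: ord_geD].
Qed.

(** A monomial of degree d goes to two series with the same form of degree d, and only d >= k occurs
    in [t]. With the inclusion as [g'], this says that [g] keeps leading forms. *)
Lemma spoly_same_lead (g g' : superHom (spoly K r s) SS) k :
    (forall i, same_lead 1 (g (spX K s i)) (g' (spX K s i))) ->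
    (forall j, same_lead 1 (g (spY K r j)) (g' (spY K r j))) ->
  forall t : spoly K r s, (forall (T : {set 'I_s}) m, (mdeg m + #|T| < k)%N -> (t T)@_m = 0) ->
  ord_ge k.+1 (g t - g' t).
Proof.
move=> hX hY t ht.
have gE (h : superHom (spoly K r s) SS) : h t = \sum_T
    mp_eval (fun i => h (spX K s i)) (t T) * oprod (fun j => h (spY K r j)) T.
  have [g0 [g0X g0Y g0E]] := @spoly_hom K r s SS (fun i => h (spX K s i))
    (fun j => h (spY K r j)) (fun i => superhomP h (@spX_even K r s i))
    (fun j => superhomP h (@spY_odd K r s j)).
  by rewrite -g0E; apply: spoly_hom_uniq => i.
rewrite (gE g) (gE g') -sumrB; apply: ord_ge_sum => T _.
apply: (@mp_eval_congr _ _ _ _ _ _ _ _ (ord_ideal K r s k.+1)) => m n0.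
have le : (k <= mdeg m + #|T|)%N.
  by rewrite leqNgt; apply: contraNN n0 => /ht ->.
apply: (@ord_geW _ _ _ (mdeg m + #|T|).+1) => //.
by have [_ _] := same_leadM (same_lead_mon m hX) (same_lead_oprod T hY).
Qed.

End Close.

Lemma max_superideal_sconst (K : numFieldType) (A : superAlgType K) (P : closed_point A) (c : K) :
  P (sconst c) -> c = 0.
Proof.
move=> h; apply/eqP; apply: contrapT => /negP c0; have [n1 _] := pt_max P; apply: n1.
by rewrite -(rmorph1 (@sconst K A)) -(mulVf c0) rmorphM; apply: siMl.
Qed.

(** * Smooth superalgebras have formal coordinates *)

Section Lin.
Variables (K : numFieldType) (A : superAlgType K).

Definition lin n (x : 'I_n -> A) (al : 'I_n -> K) : A := \sum_i sconst (al i) * x i.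

Lemma linD n (x : 'I_n -> A) al be :
  lin x al + lin x be = lin x (fun i => al i + be i).
Proof. by rewrite /lin -big_split; apply: eq_bigr => i _; rewrite rmorphD mulrDl. Qed.

Lemma linZ n (x : 'I_n -> A) k al : sconst k * lin x al = lin x (fun i => k * al i).
Proof. by rewrite /lin mulr_sumr; apply: eq_bigr => i _; rewrite rmorphM mulrA. Qed.

Lemma lin0 n (x : 'I_n -> A) : lin x (fun=> 0) = 0.
Proof. by rewrite /lin big1 // => i _; rewrite rmorph0 mul0r. Qed.

Lemma lin1 n (x : 'I_n -> A) i : lin x (fun j => (j == i)%:R) = x i.
Proof.
rewrite /lin (bigD1 i) //= big1 ?addr0 => [|j /negbTE ->].
  by rewrite eqxx rmorph1 mul1r.
by rewrite rmorph0 mul0r.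
Qed.

Lemma lin_mem n (x : 'I_n -> A) (I : superideal A) al : (forall i, I (x i)) -> I (lin x al).
Proof.
by move=> h; rewrite /lin; elim/big_ind: _ => [|u v|i _]; [exact: si0|exact: siD|exact: siMl].
Qed.

(** Eliminates the generator [x i0] by a relation in which its coefficient is invertible; [w]
    carries the part of the relation in the variables of the other parity. *)
Lemma lin_drop n (x : 'I_n.+1 -> A) (I : superideal A) al i0 w :
    al i0 != 0 -> I (lin x al + w) ->
  forall al', exists al'' k, I (lin x al' - (lin (fun i => x (lift i0 i)) al'' + sconst k * w)).
Proof.
move=> n0 h al'; pose t := al' i0 / al i0.
exists (fun i => al' (lift i0 i) - t * al (lift i0 i)), (- t).
suff -> : lin x al' - (lin (fun i => x (lift i0 i))
    (fun i => al' (lift i0 i) - t * al (lift i0 i)) + sconst (- t) * w) =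
    sconst t * (lin x al + w) by apply: siMl.
rewrite mulrDr linZ rmorphN mulNr opprB addrCA [RHS]addrC; congr (_ + _).
rewrite /lin (bigD1_ord i0) //= [RHS](bigD1_ord i0) //= -addrA.
congr (_ + _); first by rewrite /t mulfVK.
rewrite -sumrB; apply: eq_bigr => i _.
by rewrite rmorphB mulrBl opprB addrCA subrr addr0.
Qed.
End Lin.

Lemma lin_map (K : numFieldType) (A B : superAlgType K) (f : superHom A B) n
    (x : 'I_n -> A) al : f (lin x al) = lin (fun i => f (x i)) al.
Proof.
rewrite /lin rmorph_sum; apply: eq_bigr => i _.
by rewrite rmorphM /= superhomC.
Qed.

(** * Homogeneous bases of P / P^2 *)

Section Cotangent.
Variables (K : numFieldType) (A : superAlgType K) (P : closed_point A).
Hypothesis residue : forall a, exists c, P (a - sconst c).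

Definition cot_span r s (x : 'I_r -> A) (y : 'I_s -> A) : Prop :=
  [/\ forall i, parity false (x i) /\ P (x i), forall j, parity true (y j) &
      forall a, P a -> exists al be, si_exp P 2 (a - (lin x al + lin y be))].

Definition cot_free r s (x : 'I_r -> A) (y : 'I_s -> A) : Prop :=
  forall al be, si_exp P 2 (lin x al + lin y be) ->
    (forall i, al i = 0) /\ (forall j, be j = 0).

(** The even parts of the generators, shifted by constants into [P], and their odd parts suffice:
    constant plus linear form modulo P^2 describes a subalgebra, as products of two linear forms lie
    in P^2. *)
Lemma cot_span_exists : finitely_generated A ->
  exists r s (x : 'I_r -> A) (y : 'I_s -> A), cot_span x y.
Proof.
move=> [gs gen].
have [e0 /choice [o0 he]] := choice (@parity_dec K A).
have [c hc] := choice residue.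
pose x (i : 'I_(size gs)) := e0 gs`_i - sconst (c (e0 gs`_i)).
pose y (i : 'I_(size gs)) := o0 gs`_i.
have Px i : P (x i) by apply: hc.
have oy j : parity true (y j) by have [] := he gs`_j.
have Py j : P (y j) by apply: pt_odd.
exists _, _, x, y; split=> // [i|].
  split=> //; apply: parityB; last exact: parity_sconst.
  by have [] := he gs`_i.
pose L v := exists al be, v = lin x al + lin y be.
have LD u v : L u -> L v -> L (u + v).
  move=> [al [be ->]] [al' [be' ->]]; rewrite addrACA !linD.
  by eexists; eexists.
have LZ k v : L v -> L (sconst k * v).
  by move=> [al [be ->]]; rewrite mulrDr !linZ; eexists; eexists.
have LP v : L v -> P v.
  by move=> [al [be ->]]; apply: siD; apply: lin_mem.
have L0 : L 0 by exists (fun=> 0), (fun=> 0); rewrite !lin0 addr0.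
pose S a := exists k v, L v /\ si_exp P 2 (a - (sconst k + v)).
have P2 u v : P u -> P v -> si_exp P 2 (u * v).
  by move=> hu hv; apply: prod_span1 => //; apply/si_exp1.
have SD u v : S u -> S v -> S (u + v).
  move=> [k [u' [Lu hu]]] [l [v' [Lv hv]]].
  exists (k + l), (u' + v'); split; first exact: LD.
  by rewrite rmorphD [sconst k + _ + _]addrACA opprD addrACA; apply: siD.
have Sall : forall a, S a.
  apply: gen => [|g /(nthP 0) [i lt <-]].
    split=> // [k|u v [k [u' [Lu hu]]] [l [v' [Lv hv]]]].
      by exists k, 0; split=> //; rewrite addr0 subrr; apply: si0.
    exists (k * l), (sconst k * v' + sconst l * u'); split.
      by apply: LD; apply: LZ.
    have -> : u * v - (sconst (k * l) + (sconst k * v' + sconst l * u')) =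
       (u - (sconst k + u')) * v + (sconst k + u') * (v - (sconst l + v')) + u' * v'.
      set p := sconst k + u'; set q := sconst l + v'.
      have -> : (u - p) * v + p * (v - q) = u * v - p * q.
        by rewrite mulrBl mulrBr addrA subrK.
      rewrite -addrA; congr (_ + _); rewrite -[u' * v']opprK -opprD; congr (- _).
      rewrite /p /q mulrDl !mulrDr rmorphM (evenC u' (parity_sconst l)).
      by rewrite -!addrA subrr addr0.
    apply: siD; first by apply: siD; [apply: siMr|apply: siMl].
    by apply: P2; apply: LP.
  have [he1 he2 ->] := he gs`_i; apply: SD.
    exists (c (e0 gs`_i)), (x (Ordinal lt)); split.
      by exists (fun j => (j == Ordinal lt)%:R), (fun=> 0); rewrite lin1 lin0 addr0.
    by rewrite /x /= [sconst _ + _]addrC subrK subrr; apply: (si0 (si_exp P 2)).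
  exists 0, (y (Ordinal lt)); split.
    by exists (fun=> 0), (fun j => (j == Ordinal lt)%:R); rewrite lin1 lin0 add0r.
  by rewrite rmorph0 add0r subrr; apply: si0.
move=> a ha; have [k [v [Lv h]]] := Sall a.
suff k0 : k = 0.
  by move: Lv h => [al [be ->]]; rewrite k0 rmorph0 add0r; exists al, be.
apply: (@max_superideal_sconst _ _ P).
have -> : sconst k = a - (a - (sconst k + v)) - v by rewrite opprB addrCA subrr addr0 addrK.
apply: siB; last exact: LP.
by apply: siB => //; apply/si_exp1; apply: (@si_expS _ _ P 1).
Qed.

Lemma cot_basis : finitely_generated A ->
  exists r s (x : 'I_r -> A) (y : 'I_s -> A), cot_span x y /\ cot_free x y.
Proof.
(* A spanning family with r + s minimal is free: a nontrivial relation would let [lin_drop] remove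
   one element, even or odd. *)
move=> fg; pose Q n := `[< exists r s (x : 'I_r -> A) (y : 'I_s -> A),
  cot_span x y /\ (r + s)%N = n >].
have exQ : exists n, Q n.
  have [r [s [x [y h]]]] := cot_span_exists fg.
  by exists (r + s)%N; apply/asboolP; exists r, s, x, y.
case: (ex_minnP exQ) => n /asboolP [r [s [x [y [hxy en]]]]] minn.
exists r, s, x, y; split=> // al be h.
have [hx hy sp] := hxy.
split=> [i0|j0]; apply/eqP; apply: contrapT => /negP n0.
  case: r x al h i0 n0 hxy en hx sp => [|r] x al h i0 n0 hxy en hx sp; first by case: (i0).
  suff /asboolP /minn : exists r s (x : 'I_r -> A) (y : 'I_s -> A),
    cot_span x y /\ (r + s)%N = n.-1 by rewrite -en addSn ltnn.
  exists r, s, (fun i => x (lift i0 i)), y; split; last by rewrite -en.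
  split=> // a /sp [al' [be' h']].
  have [al'' [k hk]] := lin_drop n0 h al'.
  exists al'', (fun j => be' j + k * be j); rewrite -linD -linZ.
  have := siD h' hk; rewrite opprD [- lin x al' - _]addrC !addrA subrK.
  by rewrite -addrA -opprD (addrCA (lin y be')) addrA.
case: s y be h j0 n0 hxy en hy sp => [|s] y be h j0 n0 hxy en hy sp; first by case: (j0).
suff /asboolP /minn : exists r s (x : 'I_r -> A) (y : 'I_s -> A),
  cot_span x y /\ (r + s)%N = n.-1 by rewrite -en addnS ltnn.
exists r, s, x, (fun i => y (lift j0 i)); split; last by rewrite -en addnS.
split=> // a /sp [al' [be' h']].
rewrite addrC in h; have [be'' [k hk]] := lin_drop n0 h be'.
exists (fun i => al' i + k * al i), be''; rewrite -linD -linZ.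
have := siD h' hk; rewrite opprD !addrA subrK -addrA -opprD.
by rewrite [lin _ be'' + _]addrC addrA.
Qed.

End Cotangent.

Lemma squot_trans_hom (K : numFieldType) (A : superAlgType K) (I : superideal A) n :
  exists g : superHom (squot (si_exp I n.+1)) (squot (si_exp I n)), g =1 @squot_trans K A I n.
Proof.
apply: superhom_of.
- by move=> x y; rewrite squot_transD squot_transN.
- split=> [|x y]; first exact: cseq1P.
  exact: squot_transM.
- by move=> k; apply: squot_transE.
- exact: squot_trans_parity.
Qed.

(** * Evaluation of power series on a basis of P / P^2 *)

Section Evaluation.
Variables (K : numFieldType) (A : superAlgType K) (P : closed_point A).
Hypothesis residue : forall a, exists c, P (a - sconst c).
Variables (r s : nat) (x : 'I_r -> A) (y : 'I_s -> A).
Hypothesis xy_span : cot_span P x y.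
Hypothesis xy_free : cot_free P x y.
Local Notation m := (local_max P).
Local Notation SS := (super_powser K r s).

Let x_even i : parity false (x i). Proof. by case: xy_span => /(_ i)[]. Qed.
Let x_mem i : P (x i). Proof. by case: xy_span => /(_ i)[]. Qed.
Let y_odd j : parity true (y j). Proof. by case: xy_span. Qed.
Let y_mem j : P (y j). Proof. exact: pt_odd. Qed.

Lemma ev_exists n : exists g : superHom SS (squot (si_exp m n)),
  [/\ forall i, g (spsX K s i) = dloc P n (x i), forall j, g (spsY K r j) = dloc P n (y j) &
      forall f, ord_ge n f -> g f = 0].
Proof.
apply: (@sps_hom_nil _ _ r s _ _ (si_image (@dloc_surj K A P n) P)) => [i|j|i|j|z].
- exact: (superhomP (dloc P n)).
- exact: (superhomP (dloc P n)).
- by exists (x i).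
- by exists (y j).
- by move=> /si_image_exp [a ha <-]; apply/dloc_ker.
Qed.

Definition ev n := projT1 (cid (ev_exists n)).
Lemma evX n i : ev n (spsX K s i) = dloc P n (x i).
Proof. by rewrite /ev; case: cid => g []. Qed.
Lemma evY n j : ev n (spsY K r j) = dloc P n (y j).
Proof. by rewrite /ev; case: cid => g []. Qed.
Lemma ev_ord n f : ord_ge n f -> ev n f = 0.
Proof. by rewrite /ev; case: cid => g [? ? h]; apply: h. Qed.

Lemma ev_trans n f : squot_trans (ev n.+1 f) = ev n f.
Proof.
have [g hg] := squot_trans_hom m n; rewrite -hg.
apply: (@sps_hom_uniq _ _ _ _ (g \o ev n.+1 : superHom _ _) (ev n) n.+1) => [i|j|h hh|h hh] /=.
- by rewrite !evX hg squot_trans_dloc.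
- by rewrite !evY hg squot_trans_dloc.
- by rewrite ev_ord // rmorph0.
- by apply: ev_ord; apply: ord_geW hh.
Qed.

Lemma ev_le n k f : (k <= n)%N -> ev n f = 0 -> ev k f = 0.
Proof.
move=> /subnKC <-; elim: (n - k)%N => [|d IH]; first by rewrite addn0.
rewrite addnS => e; apply: IH; rewrite -ev_trans e.
exact: cseq0P.
Qed.

(** One step of successive approximation: an element of P^k is the value of a series up to P^(k+1).
    For k = 0 this is the residue field; then each factor in [P] is a linear form modulo P^2. *)
Lemma ev_exp_surj n k a : si_exp P k a ->
  exists f a', si_exp P k.+1 a' /\ dloc P n a = ev n f + dloc P n a'.
Proof.
elim: k a => [|k IH] a.
  move=> _; have [c hc] := residue a.
  exists (sconst c), (a - sconst c); split; first exact/si_exp1.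
  by rewrite superhomC rmorphB /= superhomC addrC subrK.
elim=> [|b c z hb hc _ [f [z' [hz' ez]]]].
  exists 0, 0; split; first exact: (si0 (si_exp P k.+2)).
  by rewrite !rmorph0 addr0.
have [_ _ /(_ b hb) [al [be hlin]]] := xy_span.
have [g [c' [hc' ec]]] := IH _ hc.
set b2 := b - _ in hlin.
pose X := lin (fun i => spsX K s i) al + lin (fun j => spsY K r j) be.
have eb : dloc P n b = ev n X + dloc P n b2.
  have -> : ev n X = dloc P n (lin x al + lin y be).
    rewrite /X !rmorphD /= !lin_map /lin; congr (_ + _); apply: eq_bigr => i _.
      by rewrite evX.
    by rewrite evY.
  by rewrite -rmorphD /b2 addrC subrK.
have eg : ev n g = dloc P n (c - c') by rewrite rmorphB /= ec addrK.
exists (X * g + f), (b2 * (c - c') + b * c' + z'); split.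
  apply: siD => //; apply: siD.
    apply: (@si_expM _ _ P 2 k) => //; apply: siB => //.
    exact: (@si_expS _ _ P k).
  by apply: (@prod_span1 _ _ P (si_exp P k.+1)).
rewrite !rmorphD /= ez !rmorphM /= -eg addrACA; congr (_ + _).
by rewrite {1}ec mulrDr {1}eb mulrDl -addrA.
Qed.

Lemma ev_surj n : surj (ev n).
Proof.
move=> d; have [a <-] := dloc_surj d.
have h k : exists f a', si_exp P k a' /\ dloc P n a = ev n f + dloc P n a'.
  elim: k => [|k [f [a' [ha' e]]]].
    by exists 0, a; split=> //; rewrite rmorph0 add0r.
  have [g [a'' [ha'' e']]] := ev_exp_surj n ha'.
  exists (f + g), a''; split=> //.
  by rewrite e e' rmorphD /= addrA.
have [f [a' [ha' e]]] := h n.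
by exists f; rewrite e (dloc_ker P n a').2 // addr0.
Qed.

Lemma ev1_ord f : ev 1 f = 0 -> ord_ge 1 f.
Proof.
move=> e; pose c := f set0 0%MM.
have h : ord_ge 1 (f - sconst c).
  move=> T k; rewrite ltnS leqn0 addn_eq0 cards_eq0 mdeg_eq0 => /andP[/eqP -> /eqP ->].
  by rewrite spsBE !ffunE eqxx /ps_const eqxx subrr.
have c0 : c = 0.
  apply: (@max_superideal_sconst _ _ P); apply/si_exp1/dloc_ker.
  have := ev_ord h; rewrite rmorphB /= e superhomC sub0r => /eqP.
  by rewrite oppr_eq0 => /eqP; rewrite superhomC.
by move: h; rewrite c0 rmorph0 subr0.
Qed.

(** The linear form [X] of [f] is a combination of basis elements that vanishes in P / P^2, so
    freeness makes it zero. *)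
Lemma ev2_ord f : ev 2 f = 0 -> ord_ge 2 f.
Proof.
move=> e; have h1 := ev1_ord (ev_le (isT : (1 <= 2)%N) e).
pose al i := f set0 U_(i)%MM; pose be j := f [set j] 0%MM.
pose X := lin (fun i => spsX K s i) al + lin (fun j => spsY K r j) be.
have hX T k : X T k =
    \sum_i (if T == set0 then al i * (k == U_(i)%MM)%:R else 0) +
    \sum_j (if T == [set j] then be j * (k == 0%MM)%:R else 0).
  rewrite /X spsDE /lin !sum_ffunE !ps_sumE; congr (_ + _); apply: eq_bigr => i _.
    rewrite -[sconst _]/(gr_const s (@ps_const K r (al i))) gr_constM ffunE.
    case: ifP => _; last by rewrite mulr0 ps0E.
    by rewrite ps_constM /psX /mp2ps mcoeffX eq_sym.
  rewrite -[sconst _]/(gr_const s (@ps_const K r (be i))) gr_constM ffunE.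
  case: ifP => _; last by rewrite mulr0 ps0E.
  by rewrite mulr1 /ps_const; case: eqP; rewrite ?mulr1 ?mulr0.
have h : ord_ge 2 (f - X).
  move=> T k; rewrite spsBE hX ltnS leq_eqVlt ltnS leqn0 addn_eq0 => /orP[|/andP[/eqP k0 /eqP T0]].
    case kT: #|T| => [|n].
      move/eqP: kT; rewrite cards_eq0 => /eqP ->; rewrite addn0 => /mdeg1P [i /eqP ->].
      rewrite eqxx (bigD1 i) //= eqxx mulr1 big1 => [|j ji].
        rewrite [X in _ - (_ + X)]big1 ?addr0 ?subrr // => j _.
        by rewrite eq_sym -cards_eq0 cards1.
      by rewrite eq_mnm1 eq_sym (negbTE ji) mulr0.
    rewrite addnS eqSS addn_eq0 mdeg_eq0 => /andP[/eqP -> /eqP n0].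
    move: kT; rewrite n0 => /eqP /cards1P [j ->].
    rewrite big1 ?add0r => [|i _]; last by rewrite -cards_eq0 cards1.
    rewrite (bigD1 j) //= eqxx eqxx mulr1 big1 ?addr0 ?subrr // => i ij.
    by rewrite eqEsubset sub1set inE eq_sym (negbTE ij).
  rewrite h1 ?k0 ?T0 //; move/eqP: T0; rewrite cards_eq0 => /eqP ->.
  rewrite eqxx !big1 ?addr0 ?subr0 // => i _; first by rewrite eq_sym -cards_eq0 cards1.
  by move/eqP: k0; rewrite mdeg_eq0 => /eqP ->; rewrite eq_sym mnm1_eq0 mulr0.
have : dloc P 2 (lin x al + lin y be) = 0.
  have := ev_ord h; rewrite rmorphB /= e sub0r => /eqP; rewrite oppr_eq0 => /eqP <-.
  rewrite /X !rmorphD /= !lin_map /lin; congr (_ + _); apply: eq_bigr => i _.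
    by rewrite evX.
  by rewrite evY.
move=> /dloc_ker /xy_free [al0 be0].
suff X0 : X = 0 by move: h; rewrite X0 subr0.
by rewrite /X /lin !big1 ?addr0 // => i _; rewrite ?al0 ?be0 rmorph0 mul0r.
Qed.

Hypothesis A_smooth : smooth A.

Lemma ev_ker n f : ev n f = 0 -> ord_ge n f.
Proof.
suff H k : (k <= n)%N -> ev n f = 0 -> ord_ge k f by apply: H.
elim: k => [//|k IH] lt e0; have hk := IH (ltnW lt) e0.
have {}e0 := ev_le lt e0.
(* A polynomial equal to [f] up to order k + 1. Unlike [f] it can be evaluated in [A] itself, where
   its value [E t] lies in P^(k+1). *)
pose t := sps_trunc k.+1 f.
have [E [EX EY _]] := @spoly_hom K r s A x y x_even y_odd.
have [inc hinc] := sps_incl_hom K r s.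
have evE j (u : spoly K r s) : ev j (inc u) = dloc P j (E u).
  apply: (@spoly_hom_uniq _ _ _ _ (ev j \o inc : superHom _ _) (dloc P j \o E : superHom _ _)).
    by move=> i /=; rewrite hinc sps_inclX evX EX.
  by move=> i /=; rewrite hinc sps_inclY evY EY.
have ht : ord_ge k.+1 (f - inc t) by rewrite hinc; apply: sps_incl_trunc.
have EtP : si_exp P k.+1 (E t).
  apply/dloc_ker; rewrite -evE; have := ev_ord ht.
  by rewrite rmorphB /= e0 sub0r => /eqP; rewrite oppr_eq0 => /eqP.
pose B := squot (ord_ideal K r s k.+2).
pose pi : superHom SS B := squot_pi (ord_ideal K r s k.+2).
have pisurj : surj pi by apply: squot_pi_surj.
have pi0 u : pi u = 0 <-> ord_ge k.+2 u by apply: squot_pi_eq0.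
have [u hu|p hp] := @superhom_factor K _ B _ pi (ev 2) pisurj.
  by apply: ev_ord; apply: ord_geW ((pi0 u).1 hu).
have psurj : surj p.
  by move=> d; have [u <-] := ev_surj d; exists (pi u).
(* By [ev1_ord] the kernel consists of classes of series of order at least 1, so its power k + 2 is
   zero in [B]. *)
have pnil : nilpotent_superideal (si_ker p).
  exists k.+2 => z hz.
  have [y0 hy0|u hu <-] := @si_exp_surj K _ _ pi (ord_ideal K r s 1) (si_ker p) k.+2 pisurj _ z hz.
    have [u hu] := pisurj y0; exists u => //; apply: ev1_ord.
    apply: (ev_le (isT : (1 <= 2)%N)); rewrite -hp hu; exact: hy0.
  by apply/pi0; apply: ord_ge_exp.
have [th hth] := smooth_lift (dloc P 2 : superHom _ _) A_smooth psurj pnil.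
have th1 a u : P a -> th a = pi u -> ord_ge 1 u.
  move=> /si_exp1 /(dloc_ker P 1) ha e; apply: ev1_ord.
  by rewrite -ev_trans -hp -[p _]/(p (pi u)) -e hth squot_trans_dloc.
have th2 a u u0 : th a = pi u -> ev 2 u0 = dloc P 2 a -> ord_ge 2 (u - u0).
  by move=> e e'; apply: ev2_ord; rewrite rmorphB /= -hp -e hth e' subrr.
have lead a u u0 : P a -> th a = pi u -> ev 2 u0 = dloc P 2 a -> same_lead 1 u u0.
  move=> ha e e'; have h1 := th1 _ _ ha e; have h2 := th2 _ _ _ e e'.
  split=> //; have -> : u0 = u - (u - u0) by rewrite opprB addrC subrK.
  apply: ord_geD => //; apply: (siN (I := ord_ideal K r s 1)).
  by apply: ord_geW h2.
have /choice [u hu] i : exists v : SS, parity false v /\ pi v = th (x i).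
  by have [v hv e] := surj_parity pisurj (superhomP th (x_even i)); exists v.
have /choice [v hv] j : exists v : SS, parity true v /\ pi v = th (y j).
  by have [v hv e] := surj_parity pisurj (superhomP th (y_odd j)); exists v.
(* [psi] lifts [th \o E] from [B] to series, so that orders of [psi t] can be compared with those of
   [t]. *)
have [psi [psiX psiY _]] := @spoly_hom K r s SS u v (fun i => (hu i).1) (fun j => (hv j).1).
have psiE : pi (psi t) = th (E t).
  apply: (@spoly_hom_uniq _ _ _ _ (pi \o psi : superHom _ _) (th \o E : superHom _ _)).
    by move=> i /=; rewrite psiX EX; apply: (hu i).2.
  by move=> j /=; rewrite psiY EY; apply: (hv j).2.
have close : ord_ge k.+1 (psi t - inc t).
  apply: spoly_same_lead => [i|j|T j lt'].
  - by rewrite psiX hinc sps_inclX; apply: (lead (x i)); rewrite ?evX ?(hu i).2.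
  - by rewrite psiY hinc sps_inclY; apply: (lead (y j)); rewrite ?evY ?(hv j).2.
  rewrite sps_truncE; first exact: hk.
  by rewrite ltnS; apply: ltnW; apply: leq_ltn_trans lt'; rewrite leq_addr.
have [w hw ew] : exists2 w, ord_ge k.+1 w & pi w = th (E t).
  have hJ a : P a -> si_image pisurj (ord_ideal K r s 1) (th a).
    move=> ha; have [u1 e1] := pisurj (th a); exists u1 => //.
    exact: (th1 a).
  have [w hw ew] := si_image_exp (si_exp_map hJ EtP).
  by exists w => //; apply: ord_ge_exp.
have hd : ord_ge k.+2 (psi t - w) by apply/pi0; rewrite rmorphB /= psiE ew subrr.
(* Every summand has order at least k + 1: truncation, then [w] from E t in P^(k+1), then equality
   modulo order k + 2, and last the preserved leading forms. *)
have -> : f = (f - inc t) + (w + (psi t - w) - (psi t - inc t)).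
  by rewrite [w + _]addrC subrK opprB [psi t + _]addrC !subrK.
apply: ord_geD => //; apply: ord_geD; first by apply: ord_geD => //; apply: ord_geW hd.
exact: (siN (I := ord_ideal K r s k.+1)).
Qed.

Definition ev_compl (f : SS) : completion m := Completion (fun n => ev_trans n f).

Lemma ev_compl_hom : exists g : superHom SS (completion m), g =1 ev_compl.
Proof.
apply: superhom_of.
- by move=> f g; apply: cseq_inj => n /=; rewrite rmorphB.
- split=> [|f g]; apply: cseq_inj => n /=; [exact: rmorph1|exact: rmorphM].
- by move=> k; apply: cseq_inj => n /=; rewrite superhomC.
- by move=> p f hf n /=; apply: superhomP.
Qed.

Lemma ord_ge_all (f : SS) : (forall n, ord_ge n f) -> f = 0.
Proof.
move=> h; apply/ffunP => T; apply: funext => k; rewrite sps0E.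
exact: (h (mdeg k + #|T|).+1).
Qed.

Lemma ev_compl_inj : injective ev_compl.
Proof.
move=> f g e; apply/eqP; rewrite -subr_eq0; apply/eqP/ord_ge_all => n.
apply: ev_ker; rewrite rmorphB /=; apply/eqP; rewrite subr_eq0.
by rewrite -[ev n f]/(cseq (ev_compl f) n) e.
Qed.

Lemma ev_compl_surj z : exists f, ev_compl f = z.
Proof.
have /choice [fs hfs] n : exists f, ev n f = cseq z n by apply: ev_surj.
have hle j n : (j <= n)%N -> ev j (fs n) = cseq z j.
  move=> /subnKC <-; elim: (n - j)%N => [|d IH]; first by rewrite addn0.
  have h k : ev k (fs (j + d.+1)%N) = cseq z k -> forall i, (i <= k)%N ->
      ev i (fs (j + d.+1)%N) = cseq z i.
    elim: k => [|k IHk] e i; first by rewrite leqn0 => /eqP ->.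
    rewrite leq_eqVlt => /orP[/eqP -> //|]; rewrite ltnS; apply: IHk.
    by rewrite -ev_trans e cseqP.
  by apply: h (hfs _) _ _; rewrite leq_addr.
(* A diagonal choice: by [ev_ker] the coefficients of degree d agree in all [fs n] with n > d, so
   they are read off at n = d + 1. *)
pose f : SS := [ffun T : {set 'I_s} => fun k => fs (mdeg k + #|T|).+1 T k].
exists f; apply: cseq_inj => n /=; rewrite -hfs.
apply/eqP; rewrite -subr_eq0 -rmorphB; apply/eqP/ev_ord => T k lt.
rewrite spsBE ffunE -spsBE; apply: (@ev_ker (mdeg k + #|T|).+1); last exact: ltnSn.
by rewrite rmorphB /= !hle ?subrr.
Qed.

Lemma completion_siso : siso (completion m) SS.
Proof.
have [g hg] := ev_compl_hom.
have /choice [h hK] z : exists f, ev_compl f = z by apply: ev_compl_surj.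
have bg : bijective g.
  exists h => [f|z]; last by rewrite hg hK.
  by apply: ev_compl_inj; rewrite hK hg.
have [g' [gK g'K]] := superhom_inv bg.
by exists g'; exists g.
Qed.

End Evaluation.

Lemma smooth_fioresi (K : numFieldType) (A : superAlgType K) :
    finitely_generated A ->
    (forall (P : closed_point A) a, exists c, P (a - sconst c)) ->
  smooth A -> fioresi_smooth A.
Proof.
move=> fg res sA P; have [r [s [x [y [h1 h2]]]]] := cot_basis (res P) fg.
by exists r, s; apply: (completion_siso (res P) h1 h2 sA).
Qed.

(** * Formal coordinates imply smoothness *)

Section IdealOps.
Variables (K : numFieldType) (A : superAlgType K).
Implicit Types (I J : superideal A).

Lemma si_ext_graded (L : A -> Prop) J : (forall x, L x <-> J x) ->
  forall x, L x -> exists x0 x1,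
    [/\ parity false x0, parity true x1, x = x0 + x1, L x0 & L x1].
Proof.
move=> e x /e /si_graded [x0 [x1 [h0 h1 ex s0 s1]]].
by exists x0, x1; split=> //; apply/e.
Qed.

(** Zorn's lemma is applied to underlying sets, with [Q] asking that a proper set be that of some
    superideal. *)
Lemma max_superideal J : ~ J 1 ->
  exists M, maximal_superideal M /\ forall x, J x -> M x.
Proof.
move=> J1; pose Q (L : A -> Prop) := (exists I, forall x, L x <-> I x) /\ ~ L 1.
have [F [L0 FL0] FQ totF||L [[[M eM] L1] JL maxL]] := @Zorn_above A Q J.
- split; last by case=> L /FQ [].
  pose U x := exists2 L, F L & L x.
  have U0 : U 0 by exists L0 => //; have [[I e] _] := FQ _ FL0; apply/e; apply: si0.
  have UD x y : U x -> U y -> U (x + y).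
    move=> [L FL hx] [L' FL' hy]; have [h|h] := totF _ _ FL FL'.
      by exists L' => //; have [[I e] _] := FQ _ FL'; apply/e; apply: siD; apply/e => //; apply: h.
    by exists L => //; have [[I e] _] := FQ _ FL; apply/e; apply: siD; apply/e => //; apply: h.
  have UMl a x : U x -> U (a * x).
    by move=> [L FL hx]; exists L => //; have [[I e] _] := FQ _ FL; apply/e/siMl/e.
  have UMr a x : U x -> U (x * a).
    by move=> [L FL hx]; exists L => //; have [[I e] _] := FQ _ FL; apply/e/siMr/e.
  have Ugr x : U x -> exists x0 x1,
      [/\ parity false x0, parity true x1, x = x0 + x1, U x0 & U x1].
    move=> [L FL hx]; have [[I e] _] := FQ _ FL.
    have [x0 [x1 [h0 h1 ex s0 s1]]] := si_ext_graded e hx.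
    by exists x0, x1; split=> //; exists L.
  by exists (SuperIdeal U0 UD UMl UMr Ugr).
- by split=> //; exists J.
exists M; split; last by move=> x /JL /eM.
split=> [/eM //|I MI I1 x hx].
by apply/eM; apply: (maxL I) => //; [split=> //; exists I|move=> y /eM /MI].
Qed.

Section Sum.
Variables I J : superideal A.
Definition sum_mem x := exists u v, [/\ I u, J v & x = u + v].
Fact sum0 : sum_mem 0.
Proof. by exists 0, 0; split; rewrite ?addr0 //; apply: si0. Qed.
Fact sumD x y : sum_mem x -> sum_mem y -> sum_mem (x + y).
Proof.
move=> [u [v [hu hv ->]]] [u' [v' [hu' hv' ->]]]; exists (u + u'), (v + v').
by split; [exact: siD|exact: siD|rewrite addrACA].
Qed.
Fact sumMl a x : sum_mem x -> sum_mem (a * x).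
Proof.
move=> [u [v [hu hv ->]]]; exists (a * u), (a * v).
by split; [exact: siMl|exact: siMl|rewrite mulrDr].
Qed.
Fact sumMr a x : sum_mem x -> sum_mem (x * a).
Proof.
move=> [u [v [hu hv ->]]]; exists (u * a), (v * a).
by split; [exact: siMr|exact: siMr|rewrite mulrDl].
Qed.
Fact sum_graded x : sum_mem x -> exists x0 x1,
  [/\ parity false x0, parity true x1, x = x0 + x1, sum_mem x0 & sum_mem x1].
Proof.
move=> [u [v [hu hv ->]]].
have [u0 [u1 [hu0 hu1 -> su0 su1]]] := si_graded hu.
have [v0 [v1 [hv0 hv1 -> sv0 sv1]]] := si_graded hv.
exists (u0 + v0), (u1 + v1); split.
- exact: parityD.
- exact: parityD.
- by rewrite addrACA.
- by exists u0, v0.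
- by exists u1, v1.
Qed.
Definition si_sum : superideal A := SuperIdeal sum0 sumD sumMl sumMr sum_graded.
End Sum.

(** Binomial expansion by induction on i + j: a first factor from [I] lowers i, one from [J] lowers
    j. *)
Lemma si_exp_sum I J i j x : si_exp (si_sum I J) (i + j) x ->
  exists u v, [/\ si_exp I i u, si_exp J j v & x = u + v].
Proof.
have [n] := ubnP (i + j); elim: n i j x => // n IH [|i] [|j] x lt hx.
- by exists x, 0; split; rewrite ?addr0.
- by exists x, 0; split; rewrite ?addr0 //; apply: si0.
- by exists 0, x; split; rewrite ?add0r //; apply: si0.
elim: hx => [|_ b y [u [v [hu hv ->]]] hb _ [u' [v' [hu' hv' ->]]]].
  by exists 0, 0; split; rewrite ?addr0 //; [exact: (si0 (si_exp I i.+1))|exact: (si0 (si_exp J j.+1))].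
have [|b1 [b2 [hb1 hb2 e1]]] := IH i j.+1 b _ hb; first by [].
have [||b3 [b4 [hb3 hb4 e2]]] := IH i.+1 j b; first by rewrite addSnnS.
  by rewrite addSnnS.
exists (u * b1 + v * b3 + u'), (u * b2 + v * b4 + v'); split.
- apply: (siD (s := si_exp I i.+1)) => //; apply: (siD (s := si_exp I i.+1)); first exact: prod_span1.
  exact: (siMl (s := si_exp I i.+1)).
- apply: (siD (s := si_exp J j.+1)) => //; apply: (siD (s := si_exp J j.+1)); last exact: prod_span1.
  exact: (siMl (s := si_exp J j.+1)).
- rewrite addrACA; congr (_ + _); rewrite mulrDl {1}e1 e2 !mulrDr.
  by rewrite addrACA.
Qed.

(** Homogeneity of the generator makes a principal left ideal two-sided and graded. *)
Record homelt := HomElt { hparity : bool; hval : A; hvalP : parity hparity hval }.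

Section Principal.
Variable g : homelt.
Let c := hval g.
Definition prin_mem x := exists b, x = b * c.
Fact prin0 : prin_mem 0.
Proof. by exists 0; rewrite mul0r. Qed.
Fact prinD x y : prin_mem x -> prin_mem y -> prin_mem (x + y).
Proof. by move=> [a ->] [b ->]; exists (a + b); rewrite mulrDl. Qed.
Fact prinMl a x : prin_mem x -> prin_mem (a * x).
Proof. by move=> [b ->]; exists (a * b); rewrite mulrA. Qed.
Fact prinMr a x : prin_mem x -> prin_mem (x * a).
Proof.
move=> [b ->]; have [a' e] := parity_swap a (hvalP g).
by exists (b * a'); rewrite -!mulrA e.
Qed.
Fact prin_graded x : prin_mem x -> exists x0 x1,
  [/\ parity false x0, parity true x1, x = x0 + x1, prin_mem x0 & prin_mem x1].
Proof.
move=> [b ->]; have [b0 [b1 [h0 h1 ->]]] := parity_dec b.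
have := parityM h0 (hvalP g); have := parityM h1 (hvalP g); rewrite -/c.
case: (hparity g) => k1 k0.
  exists (b1 * c), (b0 * c); split=> //; first by rewrite mulrDl addrC.
    by exists b1.
  by exists b0.
exists (b0 * c), (b1 * c); split=> //; first by rewrite mulrDl.
  by exists b0.
by exists b1.
Qed.
Definition si_prin : superideal A := SuperIdeal prin0 prinD prinMl prinMr prin_graded.

Lemma si_prin_exp k x : si_exp si_prin k x -> exists b, x = b * c ^+ k.
Proof.
elim: k x => [|k IH] x; first by exists x; rewrite mulr1.
elim=> [|_ b y [a ->] hb _ [d ->]]; first by exists 0; rewrite mul0r.
have [b' ->] := IH _ hb; have [a' e] := parity_swap b' (hvalP g).
by exists (a * a' + d); rewrite mulrDl exprS mulrA -(mulrA a) e !mulrA.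
Qed.
End Principal.

Section Zero.
Definition zero_mem (x : A) := x = 0.
Fact zeroD x y : zero_mem x -> zero_mem y -> zero_mem (x + y).
Proof. by move=> -> ->; rewrite /zero_mem addr0. Qed.
Fact zeroMl a x : zero_mem x -> zero_mem (a * x).
Proof. by move=> ->; rewrite /zero_mem mulr0. Qed.
Fact zeroMr a x : zero_mem x -> zero_mem (x * a).
Proof. by move=> ->; rewrite /zero_mem mul0r. Qed.
Fact zero_graded x : zero_mem x -> exists x0 x1,
  [/\ parity false x0, parity true x1, x = x0 + x1, zero_mem x0 & zero_mem x1].
Proof. by move=> ->; exists 0, 0; split; rewrite /zero_mem ?addr0 //; apply: parity0. Qed.
Definition si_zero : superideal A := SuperIdeal (erefl 0) zeroD zeroMl zeroMr zero_graded.
End Zero.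

Fixpoint si_gen (gs : seq homelt) : superideal A :=
  if gs is g :: gs' then si_sum (si_prin g) (si_gen gs') else si_zero.

Fixpoint all_prop (T : Type) (Q : T -> Prop) (l : seq T) : Prop :=
  if l is x :: l' then Q x /\ all_prop Q l' else True.

Lemma si_gen_min gs (S : A -> Prop) : S 0 -> (forall x y, S x -> S y -> S (x + y)) ->
  all_prop (fun g => forall b, S (b * hval g)) gs -> forall x, si_gen gs x -> S x.
Proof.
move=> S0 SD; elim: gs => [_ x -> //|g gs IH [hg hgs] x [_ [v [[b ->] hv ->]]]].
by apply: SD => //; apply: IH.
Qed.

Lemma si_gen_mem gs : all_prop (fun g => si_gen gs (hval g)) gs.
Proof.
suff H (J : superideal A) : (forall x, si_gen gs x -> J x) -> all_prop (fun g => J (hval g)) gs.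
  exact: H.
elim: gs => //= g gs IH h; split.
  by apply: h; exists (hval g), 0; split; [exists 1; rewrite mul1r|exact: si0|rewrite addr0].
apply: IH => x hx; apply: h; exists 0, x; split=> //; last by rewrite add0r.
by exists 0; rewrite mul0r.
Qed.

Lemma si_gen_nilpotent gs J :
  all_prop (fun g => exists k, J (hval g ^+ k)) gs ->
  exists n, forall x, si_exp (si_gen gs) n x -> J x.
Proof.
elim: gs => [_|g gs IH [[k hk] /IH [n hn]]].
  exists 1%N => x /si_exp1 ->; exact: si0.
exists (k + n)%N => x /si_exp_sum [u [v [/si_prin_exp [b ->] /hn hv ->]]].
by apply: siD => //; apply: siMl.
Qed.

Lemma all_prop_map (T U : Type) (Q : T -> Prop) (f : U -> T) l :
  (forall x, Q (f x)) -> all_prop Q (map f l).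
Proof. by move=> h; elim: l => //= x l IH; split. Qed.

Lemma all_prop_cat (T : Type) (Q : T -> Prop) l l' :
  all_prop Q l -> all_prop Q l' -> all_prop Q (l ++ l').
Proof. by elim: l => //= x l IH [hx hl] hl'; split=> //; apply: IH. Qed.

Lemma all_prop_catl (T : Type) (Q : T -> Prop) l l' : all_prop Q (l ++ l') -> all_prop Q l.
Proof. by elim: l => //= x l IH [hx /IH]. Qed.
Lemma all_prop_catr (T : Type) (Q : T -> Prop) l l' : all_prop Q (l ++ l') -> all_prop Q l'.
Proof. by elim: l => //= x l IH [_ /IH]. Qed.
Lemma all_prop_in (T : eqType) (U : Type) (Q : U -> Prop) (f : T -> U) l :
  all_prop Q (map f l) -> {in l, forall x, Q (f x)}.
Proof.
elim: l => [//|x l IH] /= [hx /IH h] y; rewrite inE => /orP[/eqP -> //|]; exact: h.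
Qed.

End IdealOps.

Section GeometricSeries.
Variables (K : numFieldType) (r : nat).

(** The inverse is the geometric series with terms X_i^k / c^(k+1); the test in [g] recognises the
    powers of X_i. *)
Lemma psX_sub_unit (i : 'I_r) (c : K) : c != 0 ->
  exists g : powser K r, (@ps_const K r c - psX K i) * g = 1.
Proof.
move=> c0; pose g : powser K r := fun m =>
  if m == (U_(i) *+ mdeg m)%MM then c ^- (mdeg m).+1 else 0.
exists g; apply: funext => m; rewrite mulrBl psBE ps_constM psXM ps1E /g.
have [e|ne] := eqVneq m (U_(i) *+ mdeg m)%MM.
  rewrite e; set k := mdeg m; rewrite mulmnE mnm1E eqxx mul1n.
  have dk j : mdeg (U_(i) *+ j)%MM = j by rewrite mdegMn mdeg1 mul1n.
  case: k => [|k].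
    rewrite /= dk subr0 expr1 mulfV //.
    by rewrite -mdeg_eq0 dk eqxx.
  have -> : (U_(i) *+ k.+1 - U_(i))%MM = (U_(i) *+ k)%MM.
    by apply/mnmP => j; rewrite mnmBE !mulmnE mulnS addKn.
  rewrite /= !dk !eqxx exprS invfM mulrA mulfV // mul1r subrr.
  by rewrite -mdeg_eq0 dk.
rewrite mulr0 sub0r; case: ifP => mi.
  case: eqP => [e|_]; last first.
    rewrite oppr0; case: eqP => // m0; move: mi; by rewrite m0 mnm0E.
  case/eqP: ne.
  have le : (U_(i) <= m)%MM.
    by apply/mnm_lepP => j; rewrite mnm1E; case: eqP => // <-.
  have := submK le; rewrite e => <-.
  rewrite mdegD mdegMn !mdeg1 mul1n.
  by apply/mnmP => j; rewrite mnmDE !mulmnE; lia.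
rewrite oppr0; case: eqP => // m0; case/eqP: ne; rewrite m0 mdeg0.
by [].
Qed.
End GeometricSeries.

(** Each generator contributes its even and its odd component, hence equal numbers of even and odd
    variables. *)
Lemma presentation (K : numFieldType) (A : superAlgType K) : finitely_generated A ->
  exists n (p : superHom (spoly K n n) A), surj p.
Proof.
move=> [gs gen].
have /choice [d hd] (a : A) : exists d : A * A, [/\ parity false d.1, parity true d.2 & a = d.1 + d.2].
  by have [x0 [x1 h]] := parity_dec a; exists (x0, x1).
pose b (i : 'I_(size gs)) := (d gs`_i).1; pose c (i : 'I_(size gs)) := (d gs`_i).2.
have [|i|p [pX pY _]] := @spoly_hom K _ _ A b c.
- by move=> i; case: (hd gs`_i).
- by case: (hd gs`_i).
exists (size gs), p; apply: gen => [|g /(nthP 0) [i lt <-]].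
  split=> [k|x y [u <-] [v <-]|x y [u <-] [v <-]].
  - by exists (sconst k); apply: superhomC.
  - by exists (u + v); apply: rmorphD.
  - by exists (u * v); apply: rmorphM.
exists (spX K _ (Ordinal lt) + spY K _ (Ordinal lt)).
by rewrite rmorphD /= pX pY; have [_ _ <-] := hd gs`_i.
Qed.

Lemma spoly_fg (K : numFieldType) r s : finitely_generated (spoly K r s).
Proof.
exists ([seq spX K s i | i <- enum 'I_r] ++ [seq spY K r j | j <- enum 'I_s]).
move=> S sS h; apply: spoly_gen => // i; apply: h; rewrite mem_cat; apply/orP.
  by left; apply: map_f; rewrite mem_enum.
by right; apply: map_f; rewrite mem_enum.
Qed.

(** * Smoothness from a derivation into I / I^2 *)

Section Criterion.
Variables (K : numFieldType) (r s : nat) (A : superAlgType K).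
Local Notation F := (spoly K r s).
Variable p : superHom F A.
Hypothesis p_surj : surj p.
Let I := si_ker p.

(* An even derivation F -> I / I^2, lifted to a function F -> I. *)
Definition quasi_der (D : F -> F) : Prop :=
  [/\ zmod_morphism D, forall k, D (sconst k) = 0,
      forall b u, parity b u -> parity b (D u),
      forall u, I (D u) &
      forall u v, si_exp I 2 (D (u * v) - (D u * v + u * D v))].

Lemma quasi_der0 : quasi_der (fun=> 0).
Proof.
split=> [x y|k|b u hu|u|u v]; rewrite ?subr0 //.
- exact: parity0.
- exact: si0.
by rewrite mul0r mulr0 addr0 subr0; apply: si0.
Qed.

Lemma quasi_derD D D' : quasi_der D -> quasi_der D' -> quasi_der (fun u => D u + D' u).
Proof.
move=> [Dz Dc Dp DI DM] [Dz' Dc' Dp' DI' DM']; split=> [x y|k|b u hu|u|u v].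
- by rewrite Dz Dz' opprD addrACA.
- by rewrite Dc Dc' addr0.
- by apply: parityD; [apply: Dp|apply: Dp'].
- by apply: siD.
rewrite mulrDl mulrDr [_ + _ + (_ + _)]addrACA opprD addrACA.
exact: (siD (s := si_exp I 2)).
Qed.

Lemma quasi_derZ c D : parity false c -> quasi_der D -> quasi_der (fun u => c * D u).
Proof.
move=> hc [Dz Dc Dp DI DM]; split=> [x y|k|b u hu|u|u v].
- by rewrite Dz mulrBr.
- by rewrite Dc mulr0.
- exact: (parityM hc (Dp _ _ hu)).
- exact: siMl.
rewrite mulrA -(evenC u hc) -!mulrA -mulrDr -mulrBr.
exact: (siMl (s := si_exp I 2)).
Qed.

Lemma si_exp2M (J : superideal F) u v : J u -> J v -> si_exp J 2 (u * v).
Proof. by move=> hu hv; apply: prod_span1 => //; apply/si_exp1. Qed.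

(* u - D u is then a homomorphism modulo I^2 that kills I, hence a section of
   F / I^2 -> A, through which every square-zero lifting problem factors. *)
Lemma smooth_of_quasi_der D : quasi_der D -> (forall u, I u -> si_exp I 2 (u - D u)) ->
  smooth A.
Proof.
move=> [Dz Dc Dp DI DM] DId; apply: smooth_of_square_zero => B C q f qs q0.
have /choice [b hb] i : exists b : B, parity false b /\ q b = f (p (spX K s i)).
  have [b hb e] := surj_parity qs (superhomP f (superhomP p (@spX_even K r s i))).
  by exists b.
have /choice [c hc] j : exists c : B, parity true c /\ q c = f (p (spY K r j)).
  have [c hc e] := surj_parity qs (superhomP f (superhomP p (@spY_odd K r s j))).
  by exists c.
have [g [gX gY _]] := @spoly_hom K r s B b c (fun i => (hb i).1) (fun j => (hc j).1).
have qg u : q (g u) = f (p u).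
  apply: (@spoly_hom_uniq _ _ _ _ (q \o g : superHom _ _) (f \o p : superHom _ _)).
    by move=> i /=; rewrite gX; apply: (hb i).2.
  by move=> j /=; rewrite gY; apply: (hc j).2.
(* [g] maps [I] into the kernel of [q], whose square is zero. *)
have g0 u : si_exp I 2 u -> g u = 0.
  elim=> [|x y z hx /si_exp1 hy _ IH]; first exact: rmorph0.
  by rewrite rmorphD rmorphM /= IH addr0; apply: q0; rewrite qg ?hx ?hy rmorph0.
have geq u v : si_exp I 2 (u - v) -> g u = g v.
  by move=> /g0; rewrite rmorphB => /eqP; rewrite subr_eq0 => /eqP.
have [||||h hh] := @superhom_of K F B (fun u => g (u - D u)).
- move=> u v; rewrite -rmorphB Dz; congr (g _).
  by rewrite !opprB addrACA [RHS]addrACA; congr (_ + _); apply: addrC.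
- split=> [|u v].
    by rewrite -(rmorph1 (@sconst K F)) Dc subr0 superhomC rmorph1.
  rewrite -rmorphM; apply: geq.
  have -> : u * v - D (u * v) - (u - D u) * (v - D v) =
      - (D (u * v) - (D u * v + u * D v)) - D u * D v.
    rewrite mulrBr !mulrBl; set a := u * v; set e := u * D v - _.
    rewrite [- (a - _ - e)]opprB opprB [a - _]addrC -addrA (addrA e) [a + _]addrC subrK.
    rewrite [LHS]addrC opprB [RHS]addrAC; congr (_ - _).
    by rewrite /e addrC addrA.
  apply: (siB (I := si_exp I 2)); first exact: (siN (I := si_exp I 2)).
  exact: si_exp2M.
- by move=> k; rewrite Dc subr0 superhomC.
- by move=> b' u hu; apply: superhomP; apply: parityB => //; apply: Dp.
have [u hu|h' hh'] := @superhom_factor K F A B p h p_surj.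
  by rewrite hh; apply: g0; apply: DId.
exists h' => a; have [u <-] := p_surj a.
rewrite hh' hh qg rmorphB /=; congr (f _).
by rewrite (_ : p (D u) = 0) ?subr0 //; apply: DI.
Qed.

(** Ideals of F are submodules of the finite free C[X]-module with basis the Y_T. Generation is
    stated as an induction principle, the form in which it is used. *)
Lemma ideal_fg (J : superideal F) : exists fs : seq F, {in fs, forall f, J f} /\
  forall N : F -> Prop, N 0 -> (forall u v, N u -> N v -> N (u + v)) ->
    (forall u v, N v -> N (u * v)) -> {in fs, forall f, N f} -> forall f, J f -> N f.
Proof.
pose V := {ffun {set 'I_s} -> ({mpoly K[r]} : comNzRingType)^o}.
have scaleE (c : {mpoly K[r]}) (v : V) : c *: v = (gr_const s c : F) * (v : F) :> F.
  by apply/ffunP => S; rewrite gr_constM ffunE.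
have noV := @noetherian_ffun {mpoly K[r]} {set 'I_s} (@noetherian_mpoly K r).
have [|vs [hvs gen]] := noV (fun v : V => J (v : F)).
  split=> [|u v|c v hv]; [exact: si0|exact: siD|].
  by rewrite scaleE; apply: siMl.
exists (vs : seq F); split=> // N N0 ND NM hN f /gen.
apply: (@lspan_min _ V vs (fun v => N (v : F))) => //.
by split=> // c v hv; rewrite scaleE; apply: NM.
Qed.

End Criterion.

Section ToCompletion.
Variables (K : numFieldType) (A : superAlgType K) (P : closed_point A).
Local Notation m := (local_max P).

Definition to_compl (a : A) : completion m := Completion (fun n => squot_trans_dloc P n a).

Lemma to_compl_hom : exists g : superHom A (completion m), g =1 to_compl.
Proof.
apply: superhom_of.
- by move=> f g; apply: cseq_inj => n /=; apply: (rmorphB (dloc P n)).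
- split=> [|f g]; apply: cseq_inj => n; [exact: (rmorph1 (dloc P n))|exact: (rmorphM (dloc P n))].
- by move=> k; apply: cseq_inj => n; apply: (superhomC (dloc P n)).
- by move=> p f hf n; apply: (superhomP (dloc P n)).
Qed.

Lemma cseq_hom n : exists g : superHom (completion m) (squot (si_exp m n)),
  forall z, g z = cseq z n.
Proof.
have [||||g hg] := @superhom_of K (completion m) _ (fun z => cseq z n) => //.
by exists g.
Qed.
End ToCompletion.

(** * Lifting formal coordinates to F / M^n *)

Section LocalLift.
Variables (K : numFieldType) (r s : nat) (A : superAlgType K).
Local Notation F := (spoly K r s).
Variable p : superHom F A.
Hypothesis p_surj : surj p.
Local Notation I := (si_ker p).
Variables (M : closed_point F) (P : closed_point A).
Hypothesis MP : forall a, P a <-> exists2 u, M u & p u = a.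
Hypothesis M_residue : forall u, exists c, M (u - sconst c).
Variables r' s' : nat.
Hypothesis formal : siso (completion (local_max P)) (super_powser K r' s').
Variable n : nat.
Hypothesis n_gt0 : (0 < n)%N.
Local Notation Dn := (squot (si_exp (local_max P) n)).
Local Notation SS := (super_powser K r' s').

Let de : superHom F Dn := dloc P n \o p.

Let de_surj : surj de.
Proof.
by move=> d; have [a <-] := dloc_surj d; have [u <-] := p_surj a; exists u.
Qed.

Let de_exp u : si_exp M n u -> de u = 0.
Proof.
move=> hu; apply/dloc_ker; apply: (si_exp_map _ hu) => v hv.
by apply/MP; exists v.
Qed.

(** The kernel of F -> A / P^n is I + M^n, and a homogeneous element decomposes homogeneously. *)
Let de_ker b u : parity b u -> de u = 0 -> exists h, [/\ I h, parity b h & si_exp M n (u - h)].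
Proof.
move=> hu /dloc_ker hp.
have [|v hv ev] := si_exp_surj (I := M) p_surj _ hp.
  by move=> a /MP.
have [v0 [v1 [h0 h1 e s0 s1]]] := si_graded hv.
have pe : p u = p v0 + p v1 by rewrite -rmorphD /= -e ev.
have pu := superhomP p hu.
case: b hu pu => hu pu.
  have [e0 e1] := parity_uniq (parity0 false) pu (superhomP p h0) (superhomP p h1)
    (etrans (add0r _) pe).
  exists (u - v1); rewrite subKr; split=> //; last exact: parityB.
  by rewrite /= /ker_mem rmorphB /= e1 subrr.
have [e0 e1] := parity_uniq pu (parity0 true) (superhomP p h0) (superhomP p h1)
  (etrans (addr0 _) pe).
exists (u - v0); rewrite subKr; split=> //; last exact: parityB.
by rewrite /= /ker_mem rmorphB /= e0 subrr.
Qed.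

Let P_n1 : ~ si_exp P n 1.
Proof.
move=> h; have [P1 _] := pt_max P; apply: P1; apply/si_exp1.
exact: si_exp_le h.
Qed.

(* X_i - c is a unit for c != 0, so X_i goes to the maximal ideal of Dn. *)
Let gen_mem (rho : superHom SS Dn) i u : rho (spsX K s' i) = de u -> M u.
Proof.
move=> e; have [c hc] := M_residue u.
have [c0|c0] := eqVneq c 0; first by move: hc; rewrite c0 rmorph0 subr0.
case: P_n1; apply/(dloc_ker P n); have [g hg] := psX_sub_unit i c0.
have eg : (sconst c - rho (spsX K s' i)) * rho (gr_const s' g : SS) = 1.
  rewrite -(superhomC rho) -rmorphB -rmorphM -(rmorph1 rho) /=; congr (rho _).
  rewrite -[sconst c]/(gr_const s' (@ps_const K r' c)) /spsX.
  by rewrite -(rmorphB (@gr_const (powser K r') s')) -(rmorphM (@gr_const (powser K r') s')) hg.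
set x := _ - _ in eg; set y := rho _ in eg.
have xy k : x ^+ k * y ^+ k = 1.
  elim: k => [|k IH]; first by rewrite mulr1.
  by rewrite exprS exprSr mulrA -(mulrA x) IH mulr1.
have x0 : x ^+ n = 0.
  have -> : x = de (sconst c - u) by rewrite /x e -(superhomC de c); apply/esym; apply: (rmorphB de).
  rewrite -rmorphXn; apply: de_exp; apply: si_expX.
  by rewrite -opprB; apply: siN.
by rewrite rmorph1 -(xy n) x0 mul0r.
Qed.

(** The formal variables can be lifted from A / P^n to F / M^n. Hence F -> A -> completion -> S -> F
    / M^n is a map [tau] that kills [I] and agrees with the projection in A / P^n; [psi] lifts [tau]
    to F. *)
Lemma local_endo : exists psi : superHom F F,
  (forall u, I (u - psi u)) /\ forall u, I u -> si_exp M n (psi u).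
Proof.
have [phi bphi] := formal; have [phi' [phiK _]] := superhom_inv bphi.
have [th hth] := to_compl_hom P; have [pr hpr] := cseq_hom P n.
pose rho : superHom SS Dn := pr \o phi'.
have rhoE a : rho (phi (th a)) = dloc P n a by rewrite /= phiK hpr hth.
have /choice [b hb] i : exists b : F, parity false b /\ de b = rho (spsX K s' i).
  by have [b hb e] := surj_parity de_surj (superhomP rho (@spsX_even K r' s' i)); exists b.
have /choice [c hc] j : exists c : F, parity true c /\ de c = rho (spsY K r' j).
  by have [c hc e] := surj_parity de_surj (superhomP rho (@spsY_odd K r' s' j)); exists c.
have Mb i : M (b i) by apply: (@gen_mem rho i); rewrite (hb i).2.
have Mc j : M (c j) by apply: pt_odd; exact: (hc j).1.
pose Q := squot (si_exp M n).
pose pi : superHom F Q := squot_pi (si_exp M n).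
have pi_surj : surj pi by apply: squot_pi_surj.
have pi0 u : pi u = 0 <-> si_exp M n u by apply: squot_pi_eq0.
have [||||z|g [gX gY g0]] := @sps_hom_nil K Q r' s' (pi \o b) (pi \o c) (si_image pi_surj M) n.
- by move=> i; apply: superhomP; case: (hb i).
- by move=> j; apply: superhomP; case: (hc j).
- by move=> i; exists (b i).
- by move=> j; exists (c j).
- by move=> /si_image_exp [u hu <-]; apply/pi0.
have [u /pi0 /de_exp //|q hq] := superhom_factor (f := de) pi_surj.
(* [rho] comes from an abstract isomorphism, yet it kills order at least n: it sends the variables
   into the image of [M]. *)
have qg : (q \o g : superHom _ _) =1 rho.
  apply: (@sps_hom_uniq _ _ _ _ _ rho n) => [i|j|f hf|f hf].
  - by rewrite /= gX /= hq (hb i).2.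
  - by rewrite /= gY /= hq (hc j).2.
  - by rewrite /= g0 // rmorph0.
  have : si_exp (si_image de_surj M) n (rho f).
    apply: sps_ord_exp hf => [i|j].
      by exists (b i) => //; rewrite (hb i).2.
    by exists (c j) => //; rewrite (hc j).2.
  by move=> /si_image_exp [u /de_exp hu <-].
pose tau : superHom F Q := g \o (phi \o (th \o p)).
have qtau u : q (tau u) = de u.
  by rewrite /tau /= -[q (g _)]/((q \o g) _) qg rhoE.
(* Since [tau u] and [u] agree in A / P^n, they differ by I + M^n. Correcting the variables by
   elements of [I] only keeps [psi] the identity modulo [I]. *)
have lift (d : bool) u : parity d u -> exists h, [/\ I h, parity d h & tau u = pi (u - h)].
  move=> hu; have [e he ee] := surj_parity pi_surj (superhomP tau hu).
  have [|h [hI hh hM]] := @de_ker d (u - e) (parityB hu he).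
    have -> : de (u - e) = de u - de e by apply: (rmorphB de).
    by rewrite -(qtau u) -ee hq subrr.
  exists h; split=> //; rewrite -ee; apply/squot_piP; rewrite -opprB.
  by apply: (siN (I := si_exp M n)); rewrite addrAC.
have /choice [hX hhX] i := lift false (spX K s i) (@spX_even K r s i).
have /choice [hY hhY] j := lift true (spY K r j) (@spY_odd K r s j).
have [|j|psi [psiX psiY _]] := @spoly_hom K r s F (fun i => spX K s i - hX i)
   (fun j => spY K r j - hY j).
- by move=> i; apply: parityB; [exact: spX_even|case: (hhX i)].
- by apply: parityB; [exact: spY_odd|case: (hhY j)].
have ppsi u : p (psi u) = p u.
  apply: (@spoly_hom_uniq _ _ _ _ (p \o psi : superHom _ _) p) => i /=.
    by rewrite psiX rmorphB /=; have [-> _ _] := hhX i; rewrite subr0.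
  by rewrite psiY rmorphB /=; have [-> _ _] := hhY i; rewrite subr0.
have pipsi u : pi (psi u) = tau u.
  apply: (@spoly_hom_uniq _ _ _ _ (pi \o psi : superHom _ _) tau) => i.
    by have [_ _ ->] := hhX i; rewrite /= psiX.
  by have [_ _ ->] := hhY i; rewrite /= psiY.
exists psi; split=> u; first by rewrite /= /ker_mem rmorphB /= ppsi subrr.
by move=> hu; apply/pi0; rewrite pipsi /tau /= hu !rmorph0.
Qed.

(** Take D = id - psi; its defect from the Leibniz rule is -(u - psi u)(v - psi v), a product of two
    elements of [I]. *)
Lemma local_quasi_der : exists D : F -> F, quasi_der p D /\
  forall u, I u -> si_exp M n (u - D u).
Proof.
have [psi [hI hM]] := local_endo; exists (fun u => u - psi u); split; last first.
  by move=> u hu; rewrite opprB addrC subrK; apply: hM.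
split=> //.
- by move=> u v; rewrite rmorphB !opprB addrACA [RHS]addrACA; congr (_ + _); apply: addrC.
- by move=> k; rewrite superhomC subrr.
- by move=> b u hu; apply: parityB => //; apply: superhomP.
move=> u v.
have -> : u * v - psi (u * v) - ((u - psi u) * v + u * (v - psi v)) =
    - ((u - psi u) * (v - psi v)).
  rewrite rmorphM (mulrBr u) (mulrBr (u - psi u)) !(mulrBl _ u) opprB.
  set a := u * v; set d := u * psi v; set b := psi u * psi v.
  rewrite [a - _ + (a - d)]addrC opprD opprB addrA; congr (_ - _).
  by rewrite addrC addrA subrK.
apply: (siN (I := si_exp I 2)); exact: si_exp2M.
Qed.

End LocalLift.

Section LeftSpan.
Variables (K : numFieldType) (A : superAlgType K) (G : A -> Prop).
Hypothesis G_even : forall x, G x -> parity false x.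

Inductive left_span : A -> Prop :=
| left_span0 : left_span 0
| left_spanD b x y : G x -> left_span y -> left_span (b * x + y).

Fact left_span_add x y : left_span x -> left_span y -> left_span (x + y).
Proof.
move=> hx hy; elim: hx => [|b u v hu _ IH]; first by rewrite add0r.
by rewrite -addrA; constructor.
Qed.
Fact left_spanMl a x : left_span x -> left_span (a * x).
Proof.
elim=> [|b u v hu _ IH]; first by rewrite mulr0; constructor.
by rewrite mulrDr mulrA; constructor.
Qed.
Fact left_spanMr a x : left_span x -> left_span (x * a).
Proof.
elim=> [|b u v hu _ IH]; first by rewrite mul0r; constructor.
rewrite mulrDl -mulrA (evenC a (G_even hu)) mulrA.
by constructor.
Qed.
(** The second part serves to conclude that 1 is in [G] itself: an even element of the ideal is a
    combination of elements of [G] with even coefficients, under which [G] is closed. *)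
Lemma left_span_even x : left_span x -> exists x0 x1,
  [/\ parity false x0, parity true x1, x = x0 + x1, left_span x0 & left_span x1] /\
  (forall (H : A -> Prop), H 0 -> (forall u v, H u -> H v -> H (u + v)) ->
    (forall u v, parity false u -> G v -> H (u * v)) -> H x0).
Proof.
elim=> [|b u v hu _ [x0 [x1 [[h0 h1 -> s0 s1] hH]]]].
  by exists 0, 0; split=> //; split; rewrite ?addr0 //; first [exact: parity0|constructor].
have [b0 [b1 [g0 g1 ->]]] := parity_dec b.
exists (b0 * u + x0), (b1 * u + x1); split.
  split; [| | |by constructor|by constructor].
  - by apply: parityD => //; apply: (parityM g0 (G_even hu)).
  - by apply: parityD => //; apply: (parityM g1 (G_even hu)).
  - by rewrite mulrDl addrACA.
by move=> H H0 HD HM; apply: (HD); [apply: (HM)|apply: hH].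
Qed.
Fact left_span_graded x : left_span x -> exists x0 x1,
  [/\ parity false x0, parity true x1, x = x0 + x1, left_span x0 & left_span x1].
Proof. by move=> /left_span_even [x0 [x1 [h _]]]; exists x0, x1. Qed.
Definition si_left_span : superideal A :=
  SuperIdeal left_span0 left_span_add left_spanMl left_spanMr left_span_graded.
End LeftSpan.

Lemma image_maximal (K : numFieldType) (A B : superAlgType K) (p : superHom A B)
    (p_surj : surj p) (M : superideal A) :
  maximal_superideal M -> (forall u, p u = 0 -> M u) -> maximal_superideal (si_image p_surj M).
Proof.
move=> [M1 maxM] kM; split=> [[u hu e]|J MJ J1 y hy].
  apply: M1; rewrite -[1](subrK u) addrC; apply: siD => //; apply: kM.
  by rewrite rmorphB rmorph1 /= e subrr.
have [u eu] := p_surj y; exists u => //.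
apply: (maxM (si_ker (squot_pi J \o p : superHom _ _))).
- by move=> v hv; apply/squot_pi_eq0; apply: MJ; exists v.
- by rewrite /= /ker_mem rmorph1 => /squot_pi_eq0.
by apply/squot_pi_eq0; rewrite /= eu.
Qed.

(** * From derivations modulo M^n to a global derivation *)

Section Patching.
Variables (K : numFieldType) (r s : nat) (A : superAlgType K).
Local Notation F := (spoly K r s).
Local Notation R := ({mpoly K[r]} : comNzRingType).
Variable p : superHom F A.
Hypothesis p_surj : surj p.
Local Notation I := (si_ker p).
Hypothesis residue : forall (M : closed_point F) u, exists c, M (u - sconst c).

Section AtPoint.
Variables (t : nat) (f : 'I_t -> F).
Hypothesis f_I : forall i, I (f i).
Variable M : closed_point F.
Hypothesis local : forall n, (0 < n)%N -> exists D : F -> F, quasi_der p D /\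
  forall u, I u -> si_exp M n (u - D u).

Local Notation V := {ffun 'I_t * {set 'I_s} -> R^o}.
Let comp (w : V) (i : 'I_t) : F := [ffun S => w (i, S)].
Let emb (i : 'I_t) (u : F) : V := [ffun ij => if ij.1 == i then u ij.2 else 0].

Let compZ (c : R) (w : V) i : comp (c *: w) i = (gr_const s c : F) * comp w i.
Proof. by apply/ffunP => S; rewrite gr_constM !ffunE. Qed.
Let compD (v w : V) i : comp (v + w) i = comp v i + comp w i.
Proof. by apply/ffunP => S; rewrite !ffunE. Qed.
Let comp0 i : comp 0 i = 0.
Proof. by apply/ffunP => S; rewrite !ffunE. Qed.

Let embD i u v : emb i (u + v) = emb i u + emb i v.
Proof. by apply/ffunP => -[j S]; rewrite !ffunE /=; case: ifP; rewrite ?addr0. Qed.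
Let emb0 i : emb i 0 = 0.
Proof. by apply/ffunP => -[j S]; rewrite !ffunE /=; case: ifP. Qed.
Let embZ (c : R) i u : emb i ((gr_const s c : F) * u) = c *: emb i u.
Proof.
apply/ffunP => -[j S]; rewrite [LHS]ffunE [RHS]ffunE [in RHS]ffunE /=.
by case: ifP => _; [rewrite gr_constM|rewrite [RHS]mulr0].
Qed.

(** Through [comp], [V] is F^t as a C[X]-module, and these are the tuples of values (D f_1, ..., D
    f_t) modulo I^2: the submodule to which [krull] is applied. *)
Let good (w : V) := exists D, quasi_der p D /\ forall i, si_exp I 2 (comp w i - D (f i)).

Let good_submodule : submodule good.
Proof.
split=> [|v w [D [hD hv]] [D' [hD' hw]]|c v [D [hD hv]]].
- exists (fun=> 0); split; first exact: quasi_der0.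
  by move=> i; rewrite comp0 subr0; apply: (si0 (si_exp I 2)).
- exists (fun u => D u + D' u); split; first exact: quasi_derD.
  by move=> i; rewrite compD opprD addrACA; apply: (siD (s := si_exp I 2)).
exists (fun u => (gr_const s c : F) * D u); split.
  by apply: quasi_derZ => //; apply: gr_parity_const.
by move=> i; rewrite compZ -mulrBr; apply: (siMl (s := si_exp I 2)).
Qed.

Lemma patch_at_point : exists a : R, ~ M (gr_const s a : F) /\
  exists D, quasi_der p D /\ forall i, si_exp I 2 ((gr_const s a : F) * f i - D (f i)).
Proof.
have /choice [c hc] (i : 'I_r) := residue M (spX K s i).
pose z i : R := 'X_i - (c i)%:MP.
have zE i : (gr_const s (z i) : F) = spX K s i - sconst (c i).
  exact: (rmorphB (@gr_const R s)).
have z_even i k : parity false ((gr_const s (z i ^+ k)) : F) by apply: gr_parity_const.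
pose rs : seq R^o := [seq z i | i <- enum 'I_r].
pose v : V := [ffun ij => f ij.1 ij.2].
have vE i : comp v i = f i by apply/ffunP => S; rewrite !ffunE.
have noV := @noetherian_ffun R ('I_t * {set 'I_s})%type (@noetherian_mpoly K r).
have [|a [ha [D [hD hv]]]] := @krull R V good rs v noV good_submodule; last first.
  exists (1 - a); split; last first.
    by exists D; split=> // i; have := hv i; rewrite compZ vE.
  have Ma : M (gr_const s (a : R) : F).
    apply: (@lspan_min R R^o rs (fun a => M (gr_const s (a : R) : F))) ha.
      split=> [|x y hx hy|b x hx].
      - by rewrite (rmorph0 (@gr_const R s)); apply: si0.
      - by rewrite (rmorphD (@gr_const R s)); apply: siD.
      - by rewrite (rmorphM (@gr_const R s)); apply: siMl.
    by move=> _ /mapP [i _ ->]; rewrite zE.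
  rewrite (rmorphB (@gr_const R s)) (rmorph1 (@gr_const R s)) => h.
  by have [M1 _] := pt_max M; apply: M1; rewrite -[1](subrK (gr_const s (a : R) : F)); apply: siD.
move=> L sL goodL powL; have [L0 LD LZ] := sL.
have /choice [k hk] i : exists k, forall w, L (z i ^+ k *: w).
  by apply: powL; apply: map_f; rewrite mem_enum.
(* The z_i and the Y_j generate [M]; the z_i are nilpotent modulo the powers z_i^k_i in [gB], and
   the Y_j have square zero. So some M^n lies in the ideal of [gB], whose multiples [L] contains. *)
pose gB := [seq HomElt (z_even i (k i)) | i <- enum 'I_r].
pose gX := [seq HomElt (z_even i 1%N) | i <- enum 'I_r].
pose gY := [seq HomElt (@spY_odd K r s j) | j <- enum 'I_s].
have [|n hn] := @si_gen_nilpotent K F (gX ++ gY) (si_gen gB).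
  apply: all_prop_cat; apply: all_prop_map => i.
    exists (k i) => /=; rewrite -(rmorphXn (@gr_const R s)) expr1.
    have := all_prop_in (si_gen_mem gB); apply; exact: mem_enum.
  by exists 2%N; rewrite /= expr2 odd_sqr0; [exact: si0|exact: spY_odd].
have gM u : si_gen (gX ++ gY) u -> M u.
  apply: si_gen_min; [exact: si0|by move=> *; apply: siD|].
  apply: all_prop_cat; apply: all_prop_map => i b; apply: siMl; rewrite /= ?expr1.
    by rewrite zE.
  by apply: pt_odd; apply: spY_odd.
have Mg u : M u -> si_gen (gX ++ gY) u.
  move=> hu; have [d hd] : exists d, si_gen (gX ++ gY) (u - sconst d).
    move: u {hu}; apply: spoly_gen => [|i|j].
    - split=> [d|x y [d hx] [e hy]|x y [d hx] [e hy]].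
      + by exists d; rewrite subrr; apply: si0.
      + by exists (d + e); rewrite rmorphD opprD addrACA; apply: siD.
      exists (d * e); have -> : x * y - sconst (d * e) =
          (x - sconst d) * y + sconst d * (y - sconst e).
        by rewrite mulrBl mulrBr addrA subrK rmorphM.
      by apply: siD; [apply: siMr|apply: siMl].
    - exists (c i); rewrite -zE.
      have := all_prop_in (all_prop_catl (si_gen_mem (gX ++ gY))) (x := i) (mem_enum _ _).
      by rewrite /= expr1.
    exists 0; rewrite rmorph0 subr0.
    exact: (all_prop_in (all_prop_catr (si_gen_mem (gX ++ gY))) (x := j) (mem_enum _ _)).
  suff d0 : d = 0 by move: hd; rewrite d0 rmorph0 subr0.
  apply: (@max_superideal_sconst _ _ M); rewrite -[sconst d](subKr u).
  by apply: siB => //; apply: gM.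
have [D [hD hM]] := local (ltn0Sn n).
have JL i u : si_gen gB u -> L (emb i u).
  apply: (@si_gen_min _ _ gB (fun u => L (emb i u))) => [|x y hx hy|].
  - by rewrite emb0.
  - by rewrite embD; apply: (LD).
  by apply: all_prop_map => j b /=; rewrite -(evenC b (z_even _ _)) embZ; apply: hk.
pose w : V := [ffun ij => D (f ij.1) ij.2].
(* The tuple of the f_i is the good tuple of the D f_i plus an error in M^n, and [L] contains
   both. *)
have -> : v = w + \sum_i emb i (f i - D (f i)).
  apply/ffunP => -[i S]; rewrite [RHS]ffunE sum_ffunE (bigD1 i) //= big1 ?addr0.
    by rewrite !ffunE /= eqxx ?ffunE addrC subrK.
  by move=> j ji; rewrite ffunE /= eq_sym (negbTE ji).
apply: (LD).
  apply: goodL; exists D; split=> // i.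
  have -> : comp w i = D (f i) by apply/ffunP => S; rewrite !ffunE.
  by rewrite subrr; apply: (si0 (si_exp I 2)).
elim/big_ind: _ => // i _; apply: JL; apply: hn.
apply: (si_exp_sub Mg); apply: (@si_expS _ _ M n).
exact: hM.
Qed.
End AtPoint.

Lemma fioresi_smooth_quot : fioresi_smooth A -> smooth A.
Proof.
move=> formal; have [fs [fsI fsgen]] := ideal_fg I.
pose f (i : 'I_(size fs)) : F := fs`_i.
have fI i : I (f i) by apply: fsI; apply: mem_nth.
pose G (g : F) := parity false g /\
  exists D, quasi_der p D /\ forall i, si_exp I 2 (g * f i - D (f i)).
(* If D is the identity on generators of [I] modulo I^2, it is so on [I]: for v in [I], D(uv) is u D
   v modulo I^2, as D u and v are both in [I]. *)
suff [_ [D [hD hf]]] : G 1.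
  apply: (smooth_of_quasi_der p_surj hD) => u hu.
  suff H : I u /\ si_exp I 2 (u - D u) by case: H.
  have [Dz Dc Dp DI DM] := hD.
  have D0 : D 0 = 0 by have := Dc 0; rewrite rmorph0.
  move: u hu; apply: fsgen.
  - by split; [exact: si0|rewrite D0 subr0; apply: (si0 (si_exp I 2))].
  - move=> u v [Iu hu] [Iv hv]; split; first exact: siD.
    have -> : D (u + v) = D u + D v.
      by rewrite -[v in LHS]opprK Dz -[- v]sub0r Dz D0 sub0r opprK.
    by rewrite opprD addrACA; apply: (siD (s := si_exp I 2)).
  - move=> u v [Iv hv]; split; first exact: siMl.
    have -> : u * v - D (u * v) = u * (v - D v) - D u * v - (D (u * v) - (D u * v + u * D v)).
      rewrite mulrBr; set X := u * v; set b := D u * v; set c := u * D v.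
      by rewrite -(addrA X) -opprD [c + b]addrC opprB addrA subrK.
    apply: (siB (I := si_exp I 2)) => //; apply: (siB (I := si_exp I 2)).
      exact: (siMl (s := si_exp I 2)).
    exact: si_exp2M.
  move=> _ /(nthP 0) [i lt <-]; split; first by apply: fsI; apply: mem_nth.
  by have := hf (Ordinal lt); rewrite mul1r.
have G_even g : G g -> parity false g by case.
have G0 : G 0.
  split; first exact: parity0.
  exists (fun=> 0); split; first exact: quasi_der0.
  by move=> i; rewrite mul0r subr0; apply: (si0 (si_exp I 2)).
have GD u v : G u -> G v -> G (u + v).
  move=> [pu [D [hD hu]]] [pv [D' [hD' hv]]]; split; first exact: parityD.
  exists (fun x => D x + D' x); split; first exact: quasi_derD.
  by move=> i; rewrite mulrDl opprD addrACA; apply: (siD (s := si_exp I 2)).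
have GM u v : parity false u -> G v -> G (u * v).
  move=> pu [pv [D [hD hv]]]; split; first exact: (parityM pu pv).
  exists (fun x => u * D x); split; first exact: quasi_derZ.
  by move=> i; rewrite -mulrA -mulrBr; apply: (siMl (s := si_exp I 2)).
have [h1|n1] := pselect (si_left_span G_even 1).
  have [x0 [x1 [[h0 hx1 e _ _] /(_ G G0 GD GM) hG]]] := left_span_even G_even h1.
  have [->//] := parity_uniq (parity1 F) (parity0 true) h0 hx1 (etrans (addr0 1) e).
have [M [maxM GMx]] := max_superideal n1.
have GsubM g : G g -> M g.
  by move=> hg; apply: GMx; rewrite -[g]mul1r -[1 * g]addr0; constructor=> //; constructor.
pose Mp := ClosedPoint maxM.
(* For even u in [I], u f_i is in I^2, so D = 0 shows that u is in [G]; odd elements are always in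
   [M]. *)
have IM u : p u = 0 -> M u.
  move=> hu; have [u0 [u1 [h0 hu1 -> s0 s1]]] := si_graded (s := I) hu.
  apply: siD; last exact: (pt_odd Mp).
  apply: GsubM; split=> //; exists (fun=> 0); split; first exact: quasi_der0.
  by move=> i; rewrite subr0; apply: si_exp2M.
pose P := ClosedPoint (image_maximal p_surj maxM IM).
have [r' [s' iso]] := formal P.
have [a [na [D [hD ha]]]] := @patch_at_point _ f fI Mp (fun n n0 =>
  @local_quasi_der K r s A p p_surj Mp P (fun a => iff_refl _) (residue Mp) r' s' iso n n0).
case: na; apply: GsubM; split; first exact: gr_parity_const.
by exists D.
Qed.

End Patching.

Theorem propositionA4 (R : realType) (A : superAlgType (complex R))
    (A_fg : finitely_generated A) :
  fioresi_smooth A <-> smooth A.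
Proof.
have residue (B : superAlgType (complex R)) (P : closed_point B) :
    finitely_generated B -> forall b, exists c, P (b - sconst c).
  by move=> fg; apply: nullstellensatz fg; apply: complex_avoid.
split=> [h|]; last by apply: smooth_fioresi => // P; apply: residue.
have [n [p p_surj]] := presentation A_fg.
apply: (fioresi_smooth_quot p_surj) h => M; apply: residue.
exact: spoly_fg.
Qed.
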